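(* Let $(\mathcal{E},\langle\cdot,\cdot\rangle)$ be a non-trivial quadratic graded vector bundle of degree $\ell$ over a graded manifold $\mathcal{M}$, of graded rank $(r_j)_{j\in\mathbb{Z}}$ and total rank $n=\sum_jr_j>0$. Let $k:=-\lfloor\ell/2\rfloor$ and $\epsilon:=\ell\bmod 2\in\{0,1\}$, so that $\ell=-2k+\epsilon$. Let $x\in M$ be an arbitrary point of the underlying manifold. (i) If $\epsilon=1$ and $k$ is arbitrary, or $\epsilon=0$ and $k$ is odd, there exists a local frame $(\Phi_\alpha)_{\alpha=1}^{n/2}\cup(\overline{\Phi}_\beta)_{\beta=1}^{n/2}$ of $\mathcal{E}$ over some open neighbourhood $U$ of $x$, such that $|\Phi_\alpha|\ge k$, $|\overline{\Phi}_\beta|=-|\Phi_\beta|+2k-\epsilon$, and $\langle\Phi_\alpha,\overline{\Phi}_\beta\rangle=\delta_{\alpha\beta}$, with all other values on frame elements either zero or obtained from these by the graded symmetry. (ii) If $\epsilon=0$ and $k$ is even, there exists a local frame $(\Phi_\alpha)_{\alpha=1}^{m/2}\cup(\overline{\Phi}_\beta)_{\beta=1}^{m/2}\cup(\Xi_a)_{a=1}^{r_k}$ of $\mathcal{E}$ over some open neighbourhood $U$ of $x$, where $m=n-r_k$, such that $|\Phi_\alpha|>k$, $|\overline{\Phi}_\beta|=-|\Phi_\beta|+2k$, $|\Xi_a|=k$, and $\langle\Phi_\alpha,\overline{\Phi}_\beta\rangle=\delta_{\alpha\beta}$, $\langle\Xi_a,\Xi_b\rangle=\eta_{ab}$, where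 $\eta_{ab}$ is a Minkowski metric of some signature $(p,q)$, with all other values on frame elements either zero or obtained from these by the graded symmetry.
   Context: Graded means $\mathbb{Z}$-graded. A graded manifold $\mathcal{M}$ is a second countable Hausdorff space $M$ with a sheaf $\mathcal{C}^\infty_{\mathcal{M}}$ of graded commutative associative unital real algebras with local stalks, locally isomorphic to the model: over an open $U\subseteq\mathbb{R}^{n_0}$, degree $d$ functions are formal power series of total degree $d$ in finitely many graded-commuting variables of non-zero integer degrees with coefficients in $C^\infty(U)$. A graded vector bundle $\mathcal{E}$ over $\mathcal{M}$ of graded rank $(r_j)_{j\in\mathbb{Z}}$ ($\sum_jr_j<\infty$) is given by its sheaf of sections $\Gamma_{\mathcal{E}}$, a sheaf of graded $\mathcal{C}^\infty_{\mathcal{M}}$-modules such that every point of $M$ has an open neighbourhood $U$ with a local frame $(\Phi_\lambda)_{\lambda=1}^n$ over $U$: homogeneous $\Phi_\lambda\in\Gamma_{\mathcal{E}}(U)$, exactly $r_j$ of them of degree $j$, such that for each open $U'\subseteq U$ every $\psi\in\Gamma_{\mathcal{E}}(U')$ is uniquely $\psi=\sum_\lambda\psi^\lambda\Phi_\lambda|_{U'}$ with $\psi^\lambda\in\mathcal{C}^\infty_{\mathcal{M}}(U')$, $|\psi^\lambda|+|\Phi_\lambda|=|\psi|$. The dual $\mathcal{E}^*$ has as sections the graded $\mathcal{C}^\infty_{\mathcal{M}}$-linear maps from $\Gamma_{\mathcal{E}}$ to $\mathcal{C}^\infty_{\mathcal{M}}$ of arbitrary degree. A degree $\ell$ fiber-wise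 metric on $\mathcal{E}$ is an $\mathbb{R}$-bilinear map $\langle\cdot,\cdot\rangle:\Gamma_{\mathcal{E}}(M)\times\Gamma_{\mathcal{E}}(M)\to\mathcal{C}^\infty_{\mathcal{M}}(M)$ with $|\langle\psi,\psi'\rangle|=|\psi|+|\psi'|+\ell$; $\langle\psi,\psi'\rangle=(-1)^{(|\psi|+\ell)(|\psi'|+\ell)}\langle\psi',\psi\rangle$ (graded symmetry); $\langle\psi,f\psi'\rangle=(-1)^{|f|(|\psi|+\ell)}f\langle\psi,\psi'\rangle$; and such that $g_{\mathcal{E}}:\Gamma_{\mathcal{E}}(M)\to\Gamma_{\mathcal{E}^*}(M)$, $[g_{\mathcal{E}}(\psi)](\psi')=(-1)^{\ell(|\psi|+\ell)}\langle\psi,\psi'\rangle$, is an isomorphism. It restricts to sections over open subsets (this restriction is used in the claim). The pair $(\mathcal{E},\langle\cdot,\cdot\rangle)$ is a quadratic graded vector bundle of degree $\ell$. A Minkowski metric of signature $(p,q)$ is the constant diagonal matrix with $p$ entries $+1$ and $q$ entries $-1$. *)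

(* Defs.v *)
From HB Require Import structures.
From mathcomp Require Import all_boot all_order all_algebra.
From mathcomp Require Import finmap.
From mathcomp Require Import all_classical all_reals all_analysis.

Set Implicit Arguments.
Unset Strict Implicit.
Unset Printing Implicit Defensive.

Import Order.TTheory GRing.Theory Num.Theory.
Import numFieldNormedType.Exports.

Local Open Scope classical_set_scope.
Local Open Scope ring_scope.

(** * Sheaves of graded vector spaces, algebras and modules *)

(* A graded object is a family indexed by the degree in [int], not a direct
   sum. A bilinear operation of degree 0 takes a proof [d + e = f] as argument,
   so that no transport along equalities of degrees is ever needed. *)

Record opens (M : topologicalType) := Opens {
  oset :> set M;
  oset_open : open oset }.

Definition whole (M : topologicalType) : opens M := Opens (@openT M).

Lemma sub_whole (M : topologicalType) (V : opens M) : V `<=` whole M.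
Proof. exact: subsetT. Qed.

Record gsheaf (R : realType) (M : topologicalType) := GSheaf {
  gsec :> opens M -> int -> lmodType R;
  gres : forall U V : opens M, V `<=` U ->
    forall d : int, {linear gsec U d -> gsec V d};
  gres_id : forall (U : opens M) (h : U `<=` U) (d : int) (s : gsec U d),
    gres h d s = s;
  gres_comp : forall (U V W : opens M) (hVU : V `<=` U) (hWV : W `<=` V)
      (hWU : W `<=` U) (d : int) (s : gsec U d),
    gres hWV d (gres hVU d s) = gres hWU d s;
  gsheaf_sep : forall (I : Type) (C : I -> opens M) (U : opens M)
      (hC : forall i, C i `<=` U), U `<=` \bigcup_i C i ->
    forall (d : int) (s t : gsec U d),
      (forall i, gres (hC i) d s = gres (hC i) d t) -> s = t;
  gsheaf_glue : forall (I : Type) (C : I -> opens M) (U : opens M)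
      (hC : forall i, C i `<=` U), U `<=` \bigcup_i C i ->
    forall (d : int) (s : forall i, gsec (C i) d),
      (forall i j (W : opens M) (hi : W `<=` C i) (hj : W `<=` C j),
         gres hi d (s i) = gres hj d (s j)) ->
      exists t : gsec U d, forall i, gres (hC i) d t = s i }.

Arguments gres {R M} g {U V} h {d}.

Record galg_sheaf (R : realType) (M : topologicalType) := GAlgSheaf {
  galg_gsheaf :> gsheaf R M;
  gone : forall U : opens M, galg_gsheaf U 0;
  gmul : forall (U : opens M) (d e f : int), d + e = f ->
    galg_gsheaf U d -> galg_gsheaf U e -> galg_gsheaf U f;
  gmul_linearl : forall (U : opens M) (d e f : int) (h : d + e = f)
      (c : R) (a a' : galg_gsheaf U d) (b : galg_gsheaf U e),
    gmul h (c *: a + a') b = c *: gmul h a b + gmul h a' b;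
  gmul_linearr : forall (U : opens M) (d e f : int) (h : d + e = f)
      (c : R) (a : galg_gsheaf U d) (b b' : galg_gsheaf U e),
    gmul h a (c *: b + b') = c *: gmul h a b + gmul h a b';
  gmulA : forall (U : opens M) (d1 d2 d3 d12 d23 d : int)
      (h12 : d1 + d2 = d12) (h23 : d2 + d3 = d23)
      (hl : d12 + d3 = d) (hr : d1 + d23 = d)
      (a : galg_gsheaf U d1) (b : galg_gsheaf U d2) (c : galg_gsheaf U d3),
    gmul hl (gmul h12 a b) c = gmul hr a (gmul h23 b c);
  gmul1 : forall (U : opens M) (d : int) (h : 0 + d = d)
      (a : galg_gsheaf U d), gmul h (gone U) a = a;
  gmulC : forall (U : opens M) (d e f : int) (h : d + e = f) (h' : e + d = f)
      (a : galg_gsheaf U d) (b : galg_gsheaf U e),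
    gmul h a b = (-1) ^ (d * e) *: gmul h' b a;
  gres_one : forall (U V : opens M) (h : V `<=` U),
    gres galg_gsheaf h (gone U) = gone V;
  gres_mul : forall (U V : opens M) (hVU : V `<=` U) (d e f : int)
      (h : d + e = f) (a : galg_gsheaf U d) (b : galg_gsheaf U e),
    gres galg_gsheaf hVU (gmul h a b) =
    gmul h (gres galg_gsheaf hVU a) (gres galg_gsheaf hVU b) }.

Arguments gone {R M} g U.
Arguments gmul {R M} g {U d e f} h a b.

Record gmod_sheaf (R : realType) (M : topologicalType) (A : galg_sheaf R M) :=
  GModSheaf {
  gmod_gsheaf :> gsheaf R M;
  gact : forall (U : opens M) (d e f : int), d + e = f ->
    A U d -> gmod_gsheaf U e -> gmod_gsheaf U f;
  gact_linearl : forall (U : opens M) (d e f : int) (h : d + e = f)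
      (c : R) (a a' : A U d) (s : gmod_gsheaf U e),
    gact h (c *: a + a') s = c *: gact h a s + gact h a' s;
  gact_linearr : forall (U : opens M) (d e f : int) (h : d + e = f)
      (c : R) (a : A U d) (s s' : gmod_gsheaf U e),
    gact h a (c *: s + s') = c *: gact h a s + gact h a s';
  gactA : forall (U : opens M) (d1 d2 d3 d12 d23 d : int)
      (h12 : d1 + d2 = d12) (h23 : d2 + d3 = d23)
      (hl : d12 + d3 = d) (hr : d1 + d23 = d)
      (a : A U d1) (b : A U d2) (s : gmod_gsheaf U d3),
    gact hl (gmul A h12 a b) s = gact hr a (gact h23 b s);
  gact1 : forall (U : opens M) (d : int) (h : 0 + d = d)
      (s : gmod_gsheaf U d), gact h (gone A U) s = s;
  gres_act : forall (U V : opens M) (hVU : V `<=` U) (d e f : int)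
      (h : d + e = f) (a : A U d) (s : gmod_gsheaf U e),
    gres gmod_gsheaf hVU (gact h a s) =
    gact h (gres A hVU a) (gres gmod_gsheaf hVU s) }.

Arguments gact {R M A} g {U d e f} h a s.

(** * Locality of the stalks *)

(* A homogeneous ideal of the stalk at [x], given by the homogeneous sections
   over neighbourhoods of [x] whose germ lies in the ideal. The values of such
   a family on opens that do not contain [x] are irrelevant. *)
Record stalk_ideal (R : realType) (M : topologicalType) (A : galg_sheaf R M)
    (x : M) (I : forall (U : opens M) (d : int), A U d -> Prop) : Prop :=
  StalkIdeal {
  stalk_ideal_germ : forall (U V : opens M) (h : V `<=` U) (d : int)
      (s : A U d), oset V x -> (I V d (gres A h s) <-> I U d s);
  stalk_ideal0 : forall (U : opens M) (d : int), oset U x -> I U d 0;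
  stalk_idealD : forall (U : opens M) (d : int) (s t : A U d), oset U x ->
    I U d s -> I U d t -> I U d (s + t);
  stalk_idealM : forall (U : opens M) (d e f : int) (h : d + e = f)
      (s : A U d) (t : A U e), oset U x -> I U e t -> I U f (gmul A h s t) }.

Definition stalk_ideal_sub (R : realType) (M : topologicalType)
    (A : galg_sheaf R M) (x : M)
    (I J : forall (U : opens M) (d : int), A U d -> Prop) : Prop :=
  forall (U : opens M) (d : int) (s : A U d), oset U x -> I U d s -> J U d s.

Definition proper_stalk_ideal (R : realType) (M : topologicalType)
    (A : galg_sheaf R M) (x : M)
    (I : forall (U : opens M) (d : int), A U d -> Prop) : Prop :=
  stalk_ideal x I /\ ~ I (whole M) 0 (gone A (whole M)).

Definition maximal_stalk_ideal (R : realType) (M : topologicalType)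
    (A : galg_sheaf R M) (x : M)
    (I : forall (U : opens M) (d : int), A U d -> Prop) : Prop :=
  proper_stalk_ideal x I /\
  forall J : forall (U : opens M) (d : int), A U d -> Prop,
    proper_stalk_ideal x J -> stalk_ideal_sub x I J -> stalk_ideal_sub x J I.

Definition local_stalk (R : realType) (M : topologicalType)
    (A : galg_sheaf R M) (x : M) : Prop :=
  exists I : forall (U : opens M) (d : int), A U d -> Prop,
    maximal_stalk_ideal x I /\
    forall J : forall (U : opens M) (d : int), A U d -> Prop,
      maximal_stalk_ideal x J -> stalk_ideal_sub x I J /\ stalk_ideal_sub x J I.

(** * The local model *)

Fixpoint Ck_on (R : realType) (n : nat) (k : nat) (V : set 'rV[R]_n)
    (f : 'rV[R]_n -> R) : Prop :=
  (forall y, V y -> {for y, continuous f}) /\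
  if k is k'.+1 then
    forall i : 'I_n,
      (forall y, V y -> derivable f y (delta_mx 0 i)) /\
      Ck_on k' V ('D_(delta_mx 0 i) f)
  else True.

Definition smooth_on (R : realType) (n : nat) (V : set 'rV[R]_n)
    (f : 'rV[R]_n -> R) : Prop :=
  forall k : nat, Ck_on k V f.

Section Model.
Variables (R : realType) (n N : nat) (w : 'I_N -> int).

(* [c p y] is the value at [y] of the coefficient of the monomial
   xi_0 ^ (p 0) * ... * xi_(N-1) ^ (p (N-1)), where xi_i has degree [w i]. *)
Definition gseries := ('I_N -> nat) -> 'rV[R]_n -> R.

(* Variables of odd degree square to zero. *)
Definition admissible (p : 'I_N -> nat) : bool :=
  [forall i, odd `|w i|%N ==> (p i <= 1)%N].

Definition mono_deg (p : 'I_N -> nat) : int := \sum_i w i *+ p i.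

(* The power series of degree [d] with coefficients smooth on [V]. Functions on
   [V] are represented by functions on the whole space that vanish off [V]. *)
Definition model_sections (V : set 'rV[R]_n) (d : int) : set gseries :=
  [set c | forall p : 'I_N -> nat,
     [/\ smooth_on V (c p), forall y, ~ V y -> c p y = 0
       & ~ (admissible p /\ mono_deg p = d) -> forall y, c p y = 0]].

(* The sign s with xi^a xi^b = s xi^(a + b): a power of xi_j coming from xi^b is
   moved to the left of all xi_i of xi^a with j < i. *)
Definition mono_sign (a b : 'I_N -> nat) : R :=
  (-1) ^+ (\sum_(i < N) \sum_(j < N | (j < i)%N)
             a i * b j * (`|w i| * `|w j|))%N.

Definition model_mul (f g : gseries) : gseries := fun p y =>
  if admissible p then
    \sum_(a : {dffun forall i : 'I_N, 'I_(p i).+1})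
      mono_sign (fun i => a i) (fun i => p i - a i)%N *
      f (fun i => nat_of_ord (a i)) y * g (fun i => p i - a i)%N y
  else 0.

Definition model_one (V : set 'rV[R]_n) : gseries := fun p y =>
  if `[< V y >] && [forall i, p i == 0%N] then 1 else 0.

End Model.

(** * Graded manifolds *)

(* An isomorphism of the restriction of [A] to [U] with the model over an open
   subset [chart_cod] of R^n. *)
Record chart (R : realType) (M : topologicalType) (A : galg_sheaf R M)
    (U : opens M) := Chart {
  chart_dim : nat;
  chart_nvar : nat;
  chart_deg : 'I_chart_nvar -> int;
  chart_deg_neq0 : forall i, chart_deg i != 0;
  chart_cod : set 'rV[R]_chart_dim;
  chart_cod_open : open chart_cod;
  chart_map : M -> 'rV[R]_chart_dim;
  chart_inv : 'rV[R]_chart_dim -> M;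
  chart_map_cod : forall y, oset U y -> chart_cod (chart_map y);
  chart_inv_dom : forall z, chart_cod z -> oset U (chart_inv z);
  chart_mapK : forall y, oset U y -> chart_inv (chart_map y) = y;
  chart_invK : forall z, chart_cod z -> chart_map (chart_inv z) = z;
  chart_map_cont : forall y, oset U y -> {for y, continuous chart_map};
  chart_inv_cont : forall z, chart_cod z -> {for z, continuous chart_inv};
  chart_fun : forall (W : opens M) (d : int),
    A W d -> gseries R chart_dim chart_nvar;
  chart_fun_bij : forall (W : opens M) (d : int), W `<=` U ->
    set_bij [set: A W d] (model_sections chart_deg (chart_map @` W) d)
      (@chart_fun W d);
  chart_fun_linear : forall (W : opens M) (d : int), W `<=` U ->
    forall (c : R) (a b : A W d) p y,
      chart_fun (c *: a + b) p y = c * chart_fun a p y + chart_fun b p y;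
  chart_fun_one : forall W : opens M, W `<=` U ->
    chart_fun (gone A W) = model_one (chart_map @` W);
  chart_fun_mul : forall (W : opens M) (d e f : int) (h : d + e = f),
    W `<=` U -> forall (a : A W d) (b : A W e),
      chart_fun (gmul A h a b) =
      model_mul chart_deg (chart_fun a) (chart_fun b);
  chart_fun_res : forall (W W' : opens M) (h : W' `<=` W) (d : int),
    W `<=` U -> forall (a : A W d) p y, (chart_map @` W') y ->
      chart_fun (gres A h a) p y = chart_fun a p y }.

Record gmanifold (R : realType) := GManifold {
  gm_space :> topologicalType;
  gm_fun : galg_sheaf R gm_space;
  gm_second_countable : @second_countable gm_space;
  gm_hausdorff : hausdorff_space gm_space;
  gm_local_stalk : forall x : gm_space, local_stalk gm_fun x;
  gm_chart : forall x : gm_space,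
    exists U : opens gm_space, oset U x /\ inhabited (chart gm_fun U) }.

(** * Graded vector bundles *)

Definition is_frame (R : realType) (M : topologicalType) (A : galg_sheaf R M)
    (E : gmod_sheaf A) (r : int -> nat) (U : opens M) (I : finType)
    (deg : I -> int) (Phi : forall i : I, E U (deg i)) : Prop :=
  (forall j : int, #|[set i | deg i == j]%SET| = r j) /\
  forall (V : opens M) (h : V `<=` U) (d : int) (psi : E V d),
    exists! c : forall i : I, A V (d - deg i),
      psi = \sum_i gact E (subrK (deg i) d) (c i) (gres E h (Phi i)).

Record gvbundle (R : realType) (M : gmanifold R) := GVBundle {
  gvb_sections :> gmod_sheaf (gm_fun M);
  gvb_rank : {fsfun int -> nat with 0%N};
  gvb_total_rank : nat := (\sum_(j <- finsupp gvb_rank) gvb_rank j)%N;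
  gvb_frame : forall x : M, exists U : opens M, oset U x /\
    exists (deg : 'I_gvb_total_rank -> int)
           (Phi : forall i, gvb_sections U (deg i)),
      is_frame gvb_rank Phi }.

(* A global section of degree [k] of the dual bundle. *)
Record dual_section (R : realType) (M : gmanifold R) (E : gvbundle M)
    (k : int) := DualSection {
  dual_fun : forall (U : opens M) (d f : int), k + d = f ->
    E U d -> gm_fun M U f;
  dual_linear : forall (U : opens M) (d f : int) (h : k + d = f)
      (c : R) (s t : E U d),
    dual_fun h (c *: s + t) = c *: dual_fun h s + dual_fun h t;
  dual_res : forall (U V : opens M) (hVU : V `<=` U) (d f : int)
      (h : k + d = f) (s : E U d),
    dual_fun h (gres E hVU s) = gres (gm_fun M) hVU (dual_fun h s);
  dual_act : forall (U : opens M) (d e de f f' : int) (hact : d + e = de)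
      (h : k + de = f) (h' : k + e = f') (hmul : d + f' = f)
      (a : gm_fun M U d) (s : E U e),
    dual_fun h (gact E hact a s) =
    (-1) ^ (k * d) *: gmul (gm_fun M) hmul a (dual_fun h' s) }.

Arguments dual_fun {R M E k} d0 U {d f} h s.

(** * Fiber-wise metrics *)

Record fiber_metric (R : realType) (M : gmanifold R) (E : gvbundle M)
    (l : int) := FiberMetric {
  pairing : forall d e f : int, d + e + l = f ->
    E (whole M) d -> E (whole M) e -> gm_fun M (whole M) f;
  pairing_linearl : forall (d e f : int) (h : d + e + l = f)
      (c : R) (s s' : E (whole M) d) (t : E (whole M) e),
    pairing h (c *: s + s') t = c *: pairing h s t + pairing h s' t;
  pairing_linearr : forall (d e f : int) (h : d + e + l = f)
      (c : R) (s : E (whole M) d) (t t' : E (whole M) e),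
    pairing h s (c *: t + t') = c *: pairing h s t + pairing h s t';
  pairing_sym : forall (d e f : int) (h : d + e + l = f) (h' : e + d + l = f)
      (s : E (whole M) d) (t : E (whole M) e),
    pairing h s t = (-1) ^ ((d + l) * (e + l)) *: pairing h' t s;
  pairing_act : forall (d e a ae f f' : int) (hact : a + e = ae)
      (h : d + ae + l = f) (h' : d + e + l = f') (hmul : a + f' = f)
      (s : E (whole M) d) (u : gm_fun M (whole M) a) (t : E (whole M) e),
    pairing h s (gact E hact u t) =
    (-1) ^ (a * (d + l)) *: gmul (gm_fun M) hmul u (pairing h' s t);
  pairing_iso : exists gE : forall d : int,
      E (whole M) d -> dual_section E (d + l),
    (forall (d e f : int) (h : d + l + e = f) (h' : d + e + l = f)
        (s : E (whole M) d) (t : E (whole M) e),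
      dual_fun (gE d s) (whole M) h t = (-1) ^ (l * (d + l)) *: pairing h' s t)
    /\ forall d : int, bijective (gE d) }.

Arguments pairing {R M E l} f0 {d e f} h s t.

(* The restriction of the metric to sections over [U]: [v] is the value on
   [s, t] when, around each point of [U], it agrees with the value of the metric
   on global sections that coincide there with [s] and [t]. *)
Definition pairing_on (R : realType) (M : gmanifold R) (E : gvbundle M)
    (l : int) (g : fiber_metric E l) (U : opens M) (d e f : int)
    (h : d + e + l = f) (s : E U d) (t : E U e) (v : gm_fun M U f) : Prop :=
  forall y : M, oset U y -> exists (V : opens M) (hV : V `<=` U)
      (S : E (whole M) d) (T : E (whole M) e),
    [/\ oset V y, gres E (@sub_whole M V) S = gres E hV s,
        gres E (@sub_whole M V) T = gres E hV t
      & gres (gm_fun M) hV v =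
        gres (gm_fun M) (@sub_whole M V) (pairing g h S T)].

Definition pairs_to_zero (R : realType) (M : gmanifold R) (E : gvbundle M)
    (l : int) (g : fiber_metric E l) (U : opens M) (d e : int)
    (s : E U d) (t : E U e) : Prop :=
  forall (f : int) (h : d + e + l = f), pairing_on g h s t 0.

(* The value on [s, t] is the constant function [c], of degree 0. *)
Definition pairs_to_const (R : realType) (M : gmanifold R) (E : gvbundle M)
    (l : int) (g : fiber_metric E l) (U : opens M) (d e : int)
    (s : E U d) (t : E U e) (c : R) : Prop :=
  exists h : d + e + l = 0, pairing_on g h s t (c *: gone (gm_fun M) U).

Definition minkowski_mx (R : realType) (n p : nat) : 'M[R]_n :=
  diag_mx (\row_(i < n) if (i < p)%N then 1 else -1).

(** * Juxtaposition of families of homogeneous sections *)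

Definition cat_deg (I J : Type) (d : I -> int) (e : J -> int) (s : I + J) : int :=
  match s with inl i => d i | inr j => e j end.

Definition cat_fam (R : realType) (M : topologicalType) (E : gsheaf R M)
    (U : opens M) (I J : Type) (d : I -> int) (e : J -> int)
    (s : forall i, E U (d i)) (t : forall j, E U (e j)) (ij : I + J) :
    E U (cat_deg d e ij) :=
  match ij with inl i => s i | inr j => t j end.

(* Main.v *)
(* The germs at [x] form a graded module [E_x] over a graded algebra [A_x] with
   a pairing, where the value at [x] is an algebra morphism [A_x -> R] killing
   all non-zero degrees. Degree 0 elements of [A_x] with non-zero (positive)
   value are invertible (have square roots) by Hensel's lemma in the power series
   model. Bump functions extend local sections and cut off the dual frame, so
   that germs of global sections see all of [E_x] and the isomorphism with the
   dual bundle makes the real Gram matrix of the values at [x] invertible for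
   every generating family of the size of the rank.

   A graded Gram-Schmidt process then splits off, one after the other, pairs of
   isotropic vectors with product 1 and, in the degree that is paired with
   itself, vectors of square 1 or -1 if the pairing is symmetric there. The
   vectors [s] and [t] of a pair are made isotropic in turn, by adding to each a
   multiple of the other one. The result generates over a whole neighbourhood of
   [x], and its coefficients are recovered by pairing, so that it is a frame. *)
Require Import Defs.
From HB Require Import structures.
From mathcomp Require Import all_boot all_order all_algebra.
From mathcomp Require Import finmap.
From mathcomp Require Import all_classical all_reals all_analysis.
From mathcomp Require Import ring lra zify.

Set Implicit Arguments.
Unset Strict Implicit.
Unset Printing Implicit Defensive.

Import Order.TTheory GRing.Theory Num.Theory.
Import numFieldNormedType.Exports.

Local Open Scope classical_set_scope.
Local Open Scope ring_scope.

(** * Smooth functions *)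

(** Inverses and square roots exist only on neighbourhoods that shrink with each use. Germs hide
    this: the finitely many relations reached in the stalk are spread out to a single neighbourhood
    at the end. The elimination handles generating families instead of frames. Every replacement
    keeps the degree of the replaced vector, so the graded rank is never recounted, and linear
    independence is read off from the final Gram matrix. A product with non-zero value at the point
    has degree 0 and is a unit, so only degrees with d + e + l = 0 can be paired by elimination. The
    two cases of the theorem come from the solutions of 2 d + l = 0. There is none for odd l. For l
    = - 2 k it is d = k, where graded symmetry has the sign (-1) ^ (k + l) = (-1) ^ k: for odd k the
    pairing is antisymmetric there and everything splits into hyperbolic pairs; for even k it is
    symmetric, and diagonalizing it leaves the signs of the signature. In any other degree the
    square of a vector has non-zero degree and vanishes at the point, which is what makes the
    isotropy equation solvable. *)

Section SmoothFunctions.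
Variable R : realType.

(** Reduction to one real variable, where the chain rule behind [is_derive_compR] applies. *)
Lemma is_derive_line (V W : normedModType R) (f : V -> W) (x v : V) (df : W) :
  is_derive x v f df <-> is_derive (0 : R) 1 (fun h : R => f (h *: v + x)) df.
Proof.
have E : 'D_v f x = 'D_1 (fun h : R => f (h *: v + x)) 0.
  rewrite /derive; set g1 := fun h => _; set g2 := fun h => _.
  suff -> : g1 = g2 by [].
  by rewrite funeqE /g1 /g2 => h /=; rewrite addr0 scale0r add0r [_%:A]mulr1.
split=> -[dvf <-]; apply: DeriveDef => //.
  by move/derivable1P: dvf.
by apply/derivable1P.
Qed.

Lemma is_derive_compR (V : normedModType R) (phi : R -> R) (f : V -> R)
    (x v : V) (a b : R) :
  is_derive (f x) 1 phi a -> is_derive x v f b ->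
  is_derive x v (phi \o f) (a * b).
Proof.
move=> dphi /is_derive_line df; apply/is_derive_line.
apply: (@is_derive1_comp _ phi (fun h : R => f (h *: v + x))) => //.
by rewrite scale0r add0r.
Qed.

Variable n : nat.
Implicit Types (V : set 'rV[R]_n) (f g : 'rV[R]_n -> R).

Lemma Ck_onW k V f : Ck_on k.+1 V f -> Ck_on k V f.
Proof.
elim: k f => [|k IH] f [cf df]; split=> // i.
by have [? ?] := df i; split=> //; exact: IH.
Qed.

(** Derivatives at a point of [V] depend only on nearby values, so openness lets agreement on [V]
    pass to all derivatives. *)
Lemma Ck_on_ext k V f g : open V -> (forall y, V y -> f y = g y) ->
  Ck_on k V f -> Ck_on k V g.
Proof.
move=> oV; elim: k f g => [|k IH] f g fg [cf df].
all: have nfg : forall y, V y -> \near y, f y = g y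
  by move=> y Vy; apply: filterS (open_nbhs_nbhs (conj oV Vy)).
all: have cg : forall y, V y -> {for y, continuous g}
  by move=> y Vy; have := cf _ Vy; rewrite /prop_for /continuous_at (fg _ Vy);
     apply: cvg_trans; exact: (near_eq_cvg (nfg y Vy)).
  by split.
split=> // i; have [dfi Ci] := df i; split.
  by move=> y Vy; apply: near_eq_derivable (dfi _ Vy); exact: nfg.
by apply: IH Ci => y Vy; apply: near_eq_derive; exact: nfg.
Qed.

Lemma Ck_on_sub k V W f : W `<=` V -> Ck_on k V f -> Ck_on k W f.
Proof.
move=> WV; elim: k f => [|k IH] f [cf df]; split=> //.
- by move=> y /WV; exact: cf.
- by move=> y /WV; exact: cf.
- move=> i; have [dfi /IH ?] := df i; split=> //.
  by move=> y /WV; exact: dfi.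
Qed.

Lemma Ck_on_cst k V (c : R) : Ck_on k V (fun=> c).
Proof.
elim: k c => [|k IH] c; split=> //; try by move=> y _; exact: cst_continuous.
move=> i; split; first by move=> y _; exact: derivable_cst.
suff -> : 'D_(delta_mx 0 i) (fun=> c) = (fun=> 0) by exact: IH.
by move=> m; rewrite funeqE => y; exact: derive_cst.
Qed.

Lemma Ck_onD k V f g : open V -> Ck_on k V f -> Ck_on k V g ->
  Ck_on k V (fun y => f y + g y).
Proof.
move=> oV; elim: k f g => [|k IH] f g [cf df] [cg dg].
  by split=> // y Vy; apply: (@continuousD _ _ _ f g); [exact: cf|exact: cg].
split=> [y Vy|i].
  by apply: (@continuousD _ _ _ f g); [exact: cf|exact: cg].
have [dfi Cfi] := df i; have [dgi Cgi] := dg i; split=> [y Vy|].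
  by apply: (@derivableD _ _ _ f g); [exact: dfi|exact: dgi].
apply: Ck_on_ext (IH _ _ Cfi Cgi) => // y Vy.
by rewrite -[RHS]/('D__ (f + g) y) deriveD //; [exact: dfi|exact: dgi].
Qed.

Lemma Ck_onM k V f g : open V -> Ck_on k V f -> Ck_on k V g ->
  Ck_on k V (fun y => f y * g y).
Proof.
move=> oV; elim: k f g => [|k IH] f g Cf Cg.
  split=> // y Vy; apply: (@continuousM _ _ f g).
    by case: Cf => cf _; exact: cf.
  by case: Cg => cg _; exact: cg.
have [Cf' Cg'] := (Ck_onW Cf, Ck_onW Cg).
case: Cf Cg => cf df [cg dg]; split=> [y Vy|i].
  by apply: (@continuousM _ _ f g); [exact: cf|exact: cg].
have [dfi Cfi] := df i; have [dgi Cgi] := dg i; split=> [y Vy|].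
  by apply: (@derivableM _ _ f g); [exact: dfi|exact: dgi].
apply: Ck_on_ext (Ck_onD oV (IH _ _ Cf' Cgi) (IH _ _ Cg' Cfi)) => // y Vy.
rewrite -[RHS]/('D__ (f * g) y) deriveM //; [exact: dfi|exact: dgi].
Qed.

Lemma smooth_on_ext V f g : open V -> (forall y, V y -> f y = g y) ->
  smooth_on V f -> smooth_on V g.
Proof. by move=> oV fg Sf k; exact: Ck_on_ext (Sf k). Qed.

Lemma smooth_on_sub V W f : W `<=` V -> smooth_on V f -> smooth_on W f.
Proof. by move=> WV Sf k; exact: Ck_on_sub (Sf k). Qed.

Lemma smooth_on_cst V (c : R) : smooth_on V (fun=> c).
Proof. by move=> k; exact: Ck_on_cst. Qed.

Lemma smooth_onD V f g : open V -> smooth_on V f -> smooth_on V g ->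
  smooth_on V (fun y => f y + g y).
Proof. by move=> oV Sf Sg k; exact: Ck_onD. Qed.

Lemma smooth_onM V f g : open V -> smooth_on V f -> smooth_on V g ->
  smooth_on V (fun y => f y * g y).
Proof. by move=> oV Sf Sg k; exact: Ck_onM. Qed.

Lemma smooth_onB V f g : open V -> smooth_on V f -> smooth_on V g ->
  smooth_on V (fun y => f y - g y).
Proof.
move=> oV Sf Sg; apply: (@smooth_on_ext _ (fun y => f y + (-1) * g y)) => //.
  by move=> y _; rewrite mulN1r.
by apply: smooth_onD => //; apply: smooth_onM => //; exact: smooth_on_cst.
Qed.

Lemma smooth_on_sum V (I : Type) (s : seq I) (P : pred I)
    (F : I -> 'rV[R]_n -> R) :
  open V -> (forall i, P i -> smooth_on V (F i)) ->
  smooth_on V (fun y => \sum_(i <- s | P i) F i y).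
Proof.
move=> oV SF; elim: s => [|i s IH].
  apply: (smooth_on_ext _ _ (smooth_on_cst V 0)) => // y _.
  by rewrite big_nil.
case Pi : (P i); last first.
  by apply: (smooth_on_ext _ _ IH) => // y _; rewrite big_cons Pi.
apply: (smooth_on_ext _ _ (smooth_onD oV (SF _ Pi) IH)) => // y _.
by rewrite big_cons Pi.
Qed.

Lemma smooth_on_continuous V f y : smooth_on V f -> V y ->
  {for y, continuous f}.
Proof. by move=> Sf Vy; have [cf _] := Sf 0%N; exact: cf. Qed.

Lemma smooth_on_coord V (i : 'I_n) : smooth_on V (fun y => y 0 i).
Proof.
case=> [|k]; split; try by move=> y _; exact: coord_continuous.
  by [].
move=> j.
have D (y : 'rV[R]_n) : is_derive y (delta_mx 0 j) (fun y : 'rV[R]_n => y 0 i)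
    ((i == j)%:R : R).
  apply/is_derive_line.
  set c : R := (i == j)%:R.
  have -> : (fun h : R => (h *: delta_mx 0 j + y : 'rV[R]_n) 0 i) =
            (@id R * cst c) + cst (y 0 i).
    by rewrite funeqE => h /=; rewrite !mxE eqxx.
  apply: is_derive_eq (is_deriveD (is_deriveM (is_derive_id (0 : R) 1)
    (is_derive_cst c (0 : R) 1)) (is_derive_cst (y 0 i) (0 : R) 1)) _.
  by rewrite scaler0 add0r addr0 [_%:A]mulr1.
split=> [y _|]; first by case: (D y).
suff -> : 'D_(delta_mx 0 j) (fun y : 'rV[R]_n => y 0 i) =
          (fun=> (i == j)%:R) by exact: Ck_on_cst.
by rewrite funeqE => y; case: (D y).
Qed.

(* Covers the powers [t^-m], the half-integer powers [t^(1/2 - m)] and the flat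
   functions [t^-m exp (-1/t)], whose derivatives all have this shape. *)
Lemma smooth_on_comp_family (phi : nat -> R -> R) (O : set R)
    (a b : nat -> R) V f :
  (forall m t, O t ->
     is_derive t 1 (phi m) (a m * phi m.+1 t + b m * phi m.+2 t)) ->
  open V -> (forall y, V y -> O (f y)) -> smooth_on V f ->
  forall m, smooth_on V (fun y => phi m (f y)).
Proof.
move=> dphi oV fO Sf m k; elim: k m => [|k IH] m.
all: have cont y (Vy : V y) : {for y, continuous (fun y => phi m (f y))}
  by apply: continuous_comp; [exact: smooth_on_continuous Sf Vy|];
     apply/differentiable_continuous/derivable1_diffP;
     case: (dphi m _ (fO _ Vy)).
  by split.
split=> // i; have [_ /(_ i) [dfi Cfi]] := Sf k.+1.
have D y (Vy : V y) := is_derive_compR (dphi m _ (fO _ Vy))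
  (derivableP (dfi _ Vy)).
split=> [y /D []//|].
have C := Ck_onM oV (Ck_onD oV (Ck_onM oV (Ck_on_cst k V (a m)) (IH m.+1))
  (Ck_onM oV (Ck_on_cst k V (b m)) (IH m.+2))) Cfi.
by apply: Ck_on_ext C => // y /D [_ <-].
Qed.

Lemma is_derive_exprN m (t : R) : t != 0 ->
  is_derive t 1 (fun t => t ^- m) (- m%:R * t ^- m.+1).
Proof.
move=> t0; have tm0 k : t ^+ k != 0 by rewrite expf_eq0 (negbTE t0) andbF.
have D : is_derive t 1 (@GRing.exp R ^~ m) ('D_1 (@GRing.exp R ^~ m) t).
  by apply: DeriveDef => //; exact: exprn_derivable.
apply: is_derive_eq (@is_deriveV _ (@GRing.exp R ^~ m) t _ _ (tm0 m) D) _.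
rewrite exp_derive /GRing.scale /=.
case: m tm0 {D} => [|m] tm0; first by rewrite !mul0r mulr0 oppr0 mul0r.
by rewrite !exprS /= mulr1; field; rewrite t0 tm0.
Qed.

Lemma smooth_onV V f : open V -> (forall y, V y -> f y != 0) ->
  smooth_on V f -> smooth_on V (fun y => (f y)^-1).
Proof.
move=> oV f0 Sf.
pose phi m (t : R) : R := t ^- m.
apply: (@smooth_on_ext _ (fun y => phi 1 (f y))) => //.
apply: (@smooth_on_comp_family phi [set t | t != 0] (fun m => - m%:R)
  (fun=> 0)) => // m t t0.
apply: is_derive_eq (is_derive_exprN m t0) _.
by rewrite /phi mul0r addr0.
Qed.

Lemma smooth_on_sqrt V f : open V -> (forall y, V y -> 0 < f y) ->
  smooth_on V f -> smooth_on V (fun y => Num.sqrt (f y)).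
Proof.
move=> oV f0 Sf.
pose phi m (t : R) : R := Num.sqrt t * t ^- m.
apply: (@smooth_on_ext _ (fun y => phi 0 (f y))) => //.
  by move=> y _; rewrite /phi expr0 invr1 mulr1.
apply: (@smooth_on_comp_family phi [set t | 0 < t]
  (fun m => 2^-1 - m%:R) (fun=> 0)) => // m t t0.
have tn0 : t != 0 by rewrite gt_eqF.
have tm0 : t ^+ m != 0 by rewrite expf_eq0 (negbTE tn0) andbF.
have D := is_deriveM (is_derive1_sqrt t0) (is_derive_exprN m tn0).
apply: is_derive_eq D _.
rewrite mul0r addr0 /phi /GRing.scale /=.
have s0 : Num.sqrt t != 0 by rewrite sqrtr_eq0 -ltNge.
have sE : (2 * Num.sqrt t)^-1 = Num.sqrt t / (2 * t).
  by rewrite -{3}(sqr_sqrtr (ltW t0)); field.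
by rewrite sE !exprS; field; rewrite tn0 tm0.
Qed.

End SmoothFunctions.

(** * Flat functions and bump functions on R^n *)

Section FlatFunction.
Variable R : realType.

Definition flat (m : nat) (t : R) : R :=
  if 0 < t then t ^- m * expR (- t^-1) else 0.

Lemma flat_eq0 m t : t <= 0 -> flat m t = 0.
Proof. by rewrite /flat leNgt; case: ifP. Qed.

Lemma flat_ge0 m t : 0 <= flat m t.
Proof.
rewrite /flat; case: ifP => // t0.
by rewrite mulr_ge0 ?expR_ge0 // invr_ge0 exprn_ge0 // ltW.
Qed.

(** Makes [flat m.+1] the difference quotient of [flat m] at 0. *)
Lemma flatS m t : flat m t = flat m.+1 t * t.
Proof.
rewrite /flat; case: ifPn => [t0|_]; last by rewrite mul0r.
have tn0 : t != 0 by rewrite gt_eqF.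
have tm0 : t ^+ m != 0 by rewrite expf_eq0 (negbTE tn0) andbF.
by rewrite exprS; field; rewrite tn0 tm0.
Qed.

(** With [N = m + 1] and [u = 1 / t], raising [u / N <= exp (u / N)] to the power [N] bounds [u ^ N]
    by [N ^ N * exp u]. The bound gives continuity at 0. *)
Lemma flat_le m t : `|flat m t| <= m.+1%:R ^+ m.+1 * `|t|.
Proof.
rewrite ger0_norm ?flat_ge0 // /flat; case: ifPn => [t0|_]; last first.
  by rewrite mulr_ge0 // exprn_ge0.
rewrite gtr0_norm //; set N : R := m.+1%:R.
have N0 : 0 < N by rewrite ltr0n.
have u0 : 0 < t^-1 by rewrite invr_gt0.
have h : (t^-1 / N) ^+ m.+1 <= expR t^-1.
  have -> : expR t^-1 = expR (t^-1 / N) ^+ m.+1.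
    by rewrite -expRM_natl -/N; congr expR; field; rewrite !gt_eqF.
  apply: lerXn2r; rewrite ?nnegrE ?expR_ge0 ?divr_ge0 ?(ltW u0) ?(ltW N0) //.
  by apply: le_trans (expR_ge1Dx _); rewrite lerDr.
rewrite expRN ler_pdivrMr ?expR_gt0 //.
have Nm0 : N ^+ m.+1 != 0 by rewrite expf_eq0 gt_eqF.
have tn0 : t != 0 by rewrite gt_eqF.
have tm0 : t ^+ m != 0 by rewrite expf_eq0 (negbTE tn0) andbF.
have -> : t ^- m = N ^+ m.+1 * t * (t^-1 / N) ^+ m.+1.
  rewrite expr_div_n exprVn [t ^+ m.+1]exprS; set x := N ^+ _ in Nm0 *.
  by field; rewrite Nm0 tm0 tn0.
by rewrite ler_wpM2l // mulr_ge0 ?exprn_ge0 // ltW.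
Qed.

Lemma is_derive_flat (m : nat) (t : R) :
  is_derive t 1 (flat m) (- m%:R * flat m.+1 t + 1 * flat m.+2 t).
Proof.
have [t0|t0|->] := ltgtP t 0.
- apply: (@near_eq_is_derive _ _ _ (cst 0)).
    near=> s; rewrite /= flat_eq0 // ltW //.
    by near: s; exact: lt_nbhsl.
  by apply: is_derive_eq; rewrite !flat_eq0 ?ltW // !mulr0 addr0.
- have tn0 : t != 0 by rewrite gt_eqF.
  apply: (@near_eq_is_derive _ _ _
    ((fun t => t ^- m) * (expR \o (fun t => - (t^-1 : R))))).
    near=> s; rewrite /flat ifT //.
    by near: s; exact: lt_nbhsr.
  have D1 := @is_deriveV _ id t 1 1 tn0 (is_derive_id t 1).
  have D2 := is_deriveM (is_derive_exprN m tn0)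
    (is_derive1_comp (is_derive_expR _) (is_deriveN D1)).
  apply: is_derive_eq D2 _.
  have tm0 : t ^+ m != 0 by rewrite expf_eq0 (negbTE tn0) andbF.
  rewrite /flat t0 /GRing.scale /= !exprS expr0.
  by field; rewrite tn0 tm0.
(* At 0, Caratheodory's criterion with slope function [flat m.+1], continuous there by the linear
   bound [flat_le]. *)
- apply/is_derive1_caratheodory; exists (flat m.+1); split.
  + by move=> s; rewrite [flat m 0]flat_eq0 // !subr0 flatS.
  + rewrite /continuous_at /prop_for; apply/cvgrPdist_le => e e0.
    pose C : R := m.+2%:R ^+ m.+2; have C0 : 0 < C by rewrite exprn_gt0.
    near=> s; rewrite [flat _ 0]flat_eq0 // sub0r normrN.
    apply: (le_trans (flat_le _ _)).
    rewrite -/C.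
    rewrite mulrC -ler_pdivlMr //.
    near: s; exact: (@nbhs0_le _ R _ (divr_gt0 e0 C0)).
  + by rewrite !flat_eq0 // !mulr0 addr0.
Unshelve. all: by end_near. Qed.

Lemma smooth_on_flat n (V : set 'rV[R]_n) f : open V -> smooth_on V f ->
  smooth_on V (fun y => flat 0 (f y)).
Proof.
move=> oV Sf; apply: (@smooth_on_comp_family _ _ flat setT (fun m => - m%:R)
  (fun=> 1)) => // m t _; exact: is_derive_flat.
Qed.

Lemma bump_rV n (O : set 'rV[R]_n) (c : 'rV[R]_n) : open O -> O c ->
  exists (chi : 'rV[R]_n -> R) (W K : set 'rV[R]_n),
    [/\ smooth_on setT chi, open W, W c & compact K] /\
    [/\ W `<=` K, K `<=` O, forall y, W y -> chi y = 1
      & forall y, ~ K y -> chi y = 0].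
Proof.
move=> oO Oc.
have /nbhs_ballP[e /= e0 eO] : nbhs c O by exact: open_nbhs_nbhs.
pose q (y : 'rV[R]_n) := \sum_i (y 0 i - c 0 i) * (y 0 i - c 0 i).
(* Half the radius, so that the closed set [q <= r] lies in the open ball of radius [e]; [q_norm]
   compares [q] with the max norm that defines the ball. *)
pose r := (e / 2) ^+ 2.
have r0 : 0 < r by rewrite exprn_gt0 // divr_gt0.
have Sq : smooth_on setT q.
  have oT := @openT 'rV[R]_n.
  apply: smooth_on_sum => // i _; have Si := smooth_onB oT
    (smooth_on_coord setT i) (smooth_on_cst setT (c 0 i)).
  exact: smooth_onM.
have cq : continuous q by move=> y; exact: smooth_on_continuous Sq _.
have q_norm y s : 0 <= s -> q y <= s ^+ 2 -> `|y - c| <= s.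
  move=> s0 qs; rewrite [leLHS]/Num.norm /= mx_normrE; apply: bigmax_le => // -[i j] _.
  rewrite /= ord1 !mxE -(ler_pXn2r (n := 2)) ?nnegrE //.
  rewrite real_normK ?num_real //; apply: le_trans qs.
  rewrite /q (bigD1 j) //= -expr2 lerDl; apply: sumr_ge0 => k _.
  by rewrite -expr2 sqr_ge0.
pose b1 y := flat 0 (r - q y); pose b2 y := flat 0 (q y - r / 2).
have Sb1 : smooth_on setT b1.
  by apply: (smooth_on_flat openT); apply: (smooth_onB openT _ Sq); exact: smooth_on_cst.
have Sb2 : smooth_on setT b2.
  by apply: (smooth_on_flat openT); apply: (smooth_onB openT Sq); exact: smooth_on_cst.
have flat_gt0 t : 0 < t -> 0 < flat 0 t.
  by move=> t0; rewrite /flat t0 expr0 invr1 mul1r expR_gt0.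
have b_gt0 y : 0 < b1 y + b2 y.
  have [h|h] := ltP (q y) r.
    by rewrite ltr_wpDr ?flat_ge0 // flat_gt0 // subr_gt0.
  by rewrite ltr_wpDl ?flat_ge0 // flat_gt0 //; lra.
exists (fun y => b1 y * (b1 y + b2 y)^-1).
exists (q @^-1` [set t | t < r / 2]), (q @^-1` [set t | t <= r]).
have qc : q c = 0 by apply: big1 => i _; rewrite subrr mulr0.
split; split.
- apply: (smooth_onM openT Sb1); apply: (smooth_onV openT _ (smooth_onD openT Sb1 Sb2)).
  by move=> y _; rewrite gt_eqF.
- by apply: open_comp => [y _|]; [exact: cq|exact: open_lt].
- by rewrite /= qc divr_gt0.
- apply: bounded_closed_compact; last first.
    by apply: closed_comp => [y _|]; [exact: cq|exact: closed_le].
  exists (`|c| + e / 2); split=> [|A hA y /= /q_norm h]; first exact: num_real.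
  apply: le_trans (ltW hA); rewrite -(subrK c y) addrC.
  by apply: le_trans (ler_normD _ _) _; rewrite lerD2l h // divr_ge0 // ltW.
- by move=> y /= h; rewrite (le_trans (ltW h)) // ler_pdivrMr // ler_peMr ?ler1n // ltW.
- move=> y /= /q_norm h; apply: eO; rewrite -ball_normE /= distrC.
  by apply: le_lt_trans (h _) _; lra.
- move=> y /= h; have -> : b2 y = 0 by rewrite /b2 flat_eq0 // subr_le0 ltW.
  by rewrite addr0 divff // gt_eqF // flat_gt0 //; lra.
- move=> y /= /negP; rewrite -ltNge => h.
  have -> : b1 y = 0 by rewrite /b1 flat_eq0 // subr_le0 ltW.
  by rewrite mul0r.
Qed.

End FlatFunction.

(** * Hensel's lemma in the local model *)

Section ModelHensel.
Variables (R : realType) (n N : nat) (w : 'I_N -> int).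
Implicit Types (p : 'I_N -> nat) (f g : gseries R n N) (y : 'rV[R]_n).

Definition no_mono : 'I_N -> nat := fun=> 0%N.

Let size_mono p : nat := (\sum_i p i)%N.

Let lowest p : {dffun forall i : 'I_N, 'I_(p i).+1} := [ffun i => ord0].
Let highest p : {dffun forall i : 'I_N, 'I_(p i).+1} := [ffun i => ord_max].

Let term f g p y (a : {dffun forall i : 'I_N, 'I_(p i).+1}) : R :=
  mono_sign R w (fun i => a i) (fun i => p i - a i)%N *
  f (fun i => nat_of_ord (a i)) y * g (fun i => p i - a i)%N y.

(** The part of the coefficient of xi^p in a product that comes from proper factorizations of the
    monomial. It involves only coefficients of smaller total exponent, which makes the recursion
    possible. *)
Let middle f g p y : R :=
  \sum_(a : {dffun forall i : 'I_N, 'I_(p i).+1} |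
    (a != lowest p) && (a != highest p)) term f g y a.

Lemma no_monoP p : reflect (p = no_mono) [forall i, p i == 0%N].
Proof.
apply: (iffP forallP) => [h|-> //].
by rewrite funeqE => i; apply/eqP.
Qed.

Lemma admissible_no_mono : admissible w no_mono.
Proof. by apply/forallP => i; rewrite implybT. Qed.

Lemma mono_deg_no_mono : mono_deg w no_mono = 0.
Proof. by rewrite /mono_deg big1 // => i _; rewrite mulr0n. Qed.

Lemma mono_sign0l p : mono_sign R w no_mono p = 1.
Proof.
by rewrite /mono_sign big1 // => i _; rewrite big1 // => j _; rewrite !mul0n.
Qed.

Lemma mono_sign0r p : mono_sign R w p no_mono = 1.
Proof.
rewrite /mono_sign big1 // => i _; rewrite big1 // => j _.
by rewrite muln0 mul0n.
Qed.

Let lowest_mono p : (fun i => nat_of_ord (lowest p i)) = no_mono.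
Proof. by rewrite funeqE => i; rewrite ffunE. Qed.

Let colowest_mono p : (fun i => p i - lowest p i)%N = p.
Proof. by rewrite funeqE => i; rewrite ffunE subn0. Qed.

Let highest_mono p : (fun i => nat_of_ord (highest p i)) = p.
Proof. by rewrite funeqE => i; rewrite ffunE. Qed.

Let cohighest_mono p : (fun i => p i - highest p i)%N = no_mono.
Proof. by rewrite funeqE => i; rewrite ffunE subnn. Qed.

Lemma model_mul0 f g y :
  model_mul w f g no_mono y = f no_mono y * g no_mono y.
Proof.
rewrite /model_mul admissible_no_mono (bigD1 (lowest no_mono)) //= big1.
  by rewrite lowest_mono colowest_mono mono_sign0l mul1r addr0.
move=> a /eqP[]; apply/ffunP => i; rewrite ffunE.
by apply: val_inj; case: (a i) => -[].
Qed.

Let model_mul_split f g p y : admissible w p -> p <> no_mono ->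
  model_mul w f g p y =
  f no_mono y * g p y + f p y * g no_mono y + middle f g p y.
Proof.
move=> ap p0; rewrite /model_mul ap (bigD1 (lowest p)) //=.
rewrite (bigD1 (highest p)) /=; last first.
  apply/eqP => h; apply: p0.
  by rewrite -(highest_mono p) h lowest_mono.
rewrite lowest_mono colowest_mono highest_mono cohighest_mono.
by rewrite mono_sign0l mono_sign0r !mul1r addrA.
Qed.

Let size_middle p (a : {dffun forall i : 'I_N, 'I_(p i).+1}) :
  a != lowest p -> a != highest p ->
  (size_mono (fun i => a i) < size_mono p)%N /\
  (size_mono (fun i => p i - a i) < size_mono p)%N.
Proof.
move=> al ah.
have le i : (a i <= p i)%N by rewrite -ltnS.
have E : (size_mono (fun i => a i) + size_mono (fun i => p i - a i) =
          size_mono p)%N.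
  by rewrite -big_split; apply: eq_bigr => i _ /=; rewrite subnKC.
suff : (0 < size_mono (fun i => a i))%N /\
       (0 < size_mono (fun i => p i - a i))%N by lia.
split; rewrite lt0n sum_nat_eq0.
- apply: contra al => /forallP h; apply/eqP/ffunP => i; rewrite ffunE.
  by apply: val_inj => /=; apply/eqP; exact: h.
- apply: contra ah => /forallP h; apply/eqP/ffunP => i; rewrite ffunE.
  apply: val_inj => /=; apply/eqP; rewrite eqn_leq le /=.
  by rewrite -subn_eq0; exact: h.
Qed.

Let eq_middle f f' g g' p :
  (forall a, (size_mono a < size_mono p)%N -> f a = f' a) ->
  (forall a, (size_mono a < size_mono p)%N -> g a = g' a) ->
  middle f g p = middle f' g' p.
Proof.
move=> ff' gg'; rewrite funeqE => y; apply: eq_bigr => a /andP[al ah].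
by have [h1 h2] := size_middle al ah; rewrite /term ff' // gg'.
Qed.

Variable V : set 'rV[R]_n.
Hypothesis oV : open V.

(** The condition imposed by [model_sections w V 0] on the coefficient of a single monomial. *)
Let good (p : 'I_N -> nat) (c : 'rV[R]_n -> R) :=
  [/\ smooth_on V c, forall y, ~ V y -> c y = 0
    & ~ (admissible w p /\ mono_deg w p = 0) -> forall y, c y = 0].

Let smooth_middle f g p :
  (forall a, good a (f a)) -> (forall a, good a (g a)) ->
  smooth_on V (middle f g p).
Proof.
move=> gf gg; apply: (smooth_on_sum _ oV) => a _.
have [Sf _ _] := gf (fun i => nat_of_ord (a i)).
have [Sg _ _] := gg (fun i => p i - a i)%N.
apply: (smooth_onM oV) Sg; apply: (smooth_onM oV) Sf.
exact: smooth_on_cst.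
Qed.

Let middle_out f g p y : (forall a, good a (f a)) -> ~ V y ->
  middle f g p y = 0.
Proof.
move=> gf Vy; apply: big1 => a _.
have [_ f0 _] := gf (fun i => nat_of_ord (a i)).
by rewrite /term f0 // mulr0 mul0r.
Qed.

Let middle_deg f g p y :
  (forall a, good a (f a)) -> (forall a, good a (g a)) ->
  mono_deg w p <> 0 -> middle f g p y = 0.
Proof.
move=> gf gg dp; apply: big1 => a _.
have [_ _ f0] := gf (fun i => nat_of_ord (a i)).
have [_ _ g0] := gg (fun i => p i - a i)%N.
have [/eqP da|da] := boolP (mono_deg w (fun i => nat_of_ord (a i)) == 0).
  rewrite /term g0 ?mulr0 // => -[_ db]; apply: dp.
  suff <- : mono_deg w (fun i => nat_of_ord (a i)) +
      mono_deg w (fun i => p i - a i)%N = mono_deg w p by rewrite da db.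
  rewrite -big_split; apply: eq_bigr => i _ /=.
  by rewrite -mulrnDr subnKC // -ltnS.
by rewrite /term f0 ?mulr0 ?mul0r // => -[_ /eqP]; rewrite (negbTE da).
Qed.

(* Hensel's lemma: the coefficients of the solution are computed one after the
   other, by recursion on the total exponent of the monomial. *)
Lemma model_hensel (e : R) (b c : gseries R n N) (s0 : 'rV[R]_n -> R) :
  model_sections w V 0 b -> model_sections w V 0 c ->
  smooth_on V s0 -> (forall y, ~ V y -> s0 y = 0) ->
  (forall y, e * (s0 y * s0 y) + b no_mono y * s0 y = c no_mono y) ->
  (forall y, V y -> 2 * e * s0 y + b no_mono y != 0) ->
  exists s : gseries R n N, [/\ model_sections w V 0 s, s no_mono = s0
    & forall p y, e * model_mul w s s p y + model_mul w b s p y = c p y].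
Proof.
move=> gb gc Ss s0V es0 ds0.
pose D y := 2 * e * s0 y + b no_mono y.
have SD : smooth_on V D.
  have [Sb _ _] := gb no_mono.
  by apply: (smooth_onD oV) Sb; apply: (smooth_onM oV) Ss; exact: smooth_on_cst.
(* In the coefficient of xi^p of [e s^2 + b s = c] the unknown [s p] occurs linearly, with factor
   [D], the derivative of the left side at [s0]; all the rest is known from smaller monomials. A
   fixed point of [T] is a solution. *)
pose T (s : gseries R n N) : gseries R n N := fun p y =>
  if `[< p = no_mono >] then s0 y
  else if admissible w p then
    (c p y - e * middle s s p y - (b p y * s0 y + middle b s p y)) * (D y)^-1
  else 0.
have T0 s : T s no_mono = s0 by rewrite funeqE => y; rewrite /T; case: asboolP.
have goodT s : (forall p, good p (s p)) -> forall p, good p (T s p).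
  move=> gs p; have [->|p0] := pselect (p = no_mono).
    rewrite T0; split=> // h; case: h.
    by rewrite admissible_no_mono mono_deg_no_mono.
  have [ap|ap] := boolP (admissible w p); last first.
    have -> : T s p = fun=> 0.
      by rewrite funeqE => y; rewrite /T; case: asboolP => // _; rewrite (negbTE ap).
    by split=> //; exact: smooth_on_cst.
  have -> : T s p = fun y => (c p y - e * middle s s p y -
      (b p y * s0 y + middle b s p y)) * (D y)^-1.
    by rewrite funeqE => y; rewrite /T; case: asboolP => // _; rewrite ap.
  have [[Sb b0 b1] [Sc c0 c1]] := (gb p, gc p).
  split.
  - apply: (smooth_onM oV); last exact: smooth_onV.
    apply: (smooth_onB oV).
      apply: (smooth_onB oV) => //; apply: (smooth_onM oV).
        exact: smooth_on_cst.
      exact: smooth_middle.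
    by apply: (smooth_onD oV); [exact: smooth_onM|exact: smooth_middle].
  - move=> y Vy; rewrite c0 // b0 // !middle_out //.
    by rewrite !(mulr0, mul0r, subr0, addr0).
  - move=> h y; have dp : mono_deg w p <> 0 by move=> dp; apply: h.
    rewrite c1 // b1 // !middle_deg //.
    by rewrite !(mulr0, mul0r, subr0, addr0).
pose S k := iter k T (fun _ _ => 0).
have goodS k p : good p (S k p).
  elim: k p => [|k IH] p; last exact: goodT.
  by split=> //; exact: smooth_on_cst.
have eqT s s' p : (forall a, (size_mono a < size_mono p)%N -> s a = s' a) ->
    T s p = T s' p.
  by move=> ss'; rewrite funeqE => y; rewrite /T (@eq_middle s s' s s')
    // (@eq_middle b b s s').
have stab k j p : (size_mono p < k)%N -> (size_mono p < j)%N -> S k p = S j p.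
  elim: k j p => // k IH [//|j] p pk pj; apply: eqT => a ap.
  by apply: IH; [exact: leq_trans ap pk|exact: leq_trans ap pj].
(* By [stab] the coefficient at [p] no longer changes from iteration [size_mono p + 1] on, so this
   is a fixed point of [T]. *)
pose s : gseries R n N := fun p => S (size_mono p).+1 p.
have sT p : s p = T s p.
  by apply: eqT => a ap; exact: stab.
exists s; split; [by move=> p; exact: goodS|by rewrite sT T0|].
move=> p y; have [->|p0] := pselect (p = no_mono).
  by rewrite !model_mul0 sT T0 es0.
have [ap|ap] := boolP (admissible w p); last first.
  rewrite /model_mul (negbTE ap) !mulr0 addr0.
  by have [_ _ ->] := gc p => // -[h _]; rewrite h in ap.
rewrite !model_mul_split // (sT no_mono) T0.
have [Vy|Vy] := pselect (V y); last first.
  have gs a : good a (s a) by exact: goodS.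
  have [_ b0 _] := gb p; have [_ b00 _] := gb no_mono.
  have [_ c0 _] := gc p.
  rewrite c0 // b0 // b00 // s0V // !middle_out //.
  by rewrite !(mulr0, mul0r, addr0).
rewrite (sT p) {1 2 3}/T; case: asboolP => // _; rewrite ap.
have := ds0 _ Vy; rewrite -/(D y) => Dy.
have -> : b no_mono y = D y - 2 * e * s0 y by rewrite /D addrC addKr.
set m1 := middle s s p y; set m2 := middle b s p y.
by field.
Qed.

End ModelHensel.

(** * Graded algebras and modules *)

Section Sign.
Variable R : realFieldType.

Lemma signzD (m n : int) : (-1) ^ (m + n) = (-1) ^ m * (-1) ^ n :> R.
Proof. by rewrite expfzDr // oppr_eq0 oner_eq0. Qed.

Lemma signzM (m n : int) : (-1) ^ m = 1 :> R -> (-1) ^ (m * n) = 1 :> R.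
Proof. by move=> m1; rewrite -exprz_exp m1 exp1rz. Qed.

Lemma signz_odd (m : int) : (-1) ^ m = (-1) ^+ odd `|m|%N :> R.
Proof.
case: m => m; first by rewrite -exprnP signr_odd.
by rewrite NegzE abszN absz_nat -exprnN signr_odd -signr_odd invr_sign signr_odd.
Qed.

Lemma signz_cases (m : int) : (-1) ^ m = 1 :> R \/ (-1) ^ m = -1 :> R.
Proof. by rewrite signz_odd; case: odd; [right|left]. Qed.

Lemma signzz (m : int) : (-1) ^ m * (-1) ^ m = 1 :> R.
Proof. by case: (signz_cases m) => ->; rewrite ?mulrNN mulr1. Qed.

Lemma signz_sqr (m : int) : (-1) ^ (m * m) = (-1) ^ m :> R.
Proof. by rewrite !signz_odd abszM oddM andbb. Qed.

Lemma signz_double (m : int) : (-1) ^ (m + m) = 1 :> R.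
Proof. by rewrite signzD signzz. Qed.

End Sign.

Record gralg (R : realType) := GrAlg {
  ga_sort :> int -> lmodType R;
  ga1 : ga_sort 0;
  gaM : forall d e f : int, d + e = f -> ga_sort d -> ga_sort e -> ga_sort f;
  gaM_linearl : forall (d e f : int) (h : d + e = f) (c : R)
    (a a' : ga_sort d) (b : ga_sort e),
    gaM h (c *: a + a') b = c *: gaM h a b + gaM h a' b;
  gaM_linearr : forall (d e f : int) (h : d + e = f) (c : R)
    (a : ga_sort d) (b b' : ga_sort e),
    gaM h a (c *: b + b') = c *: gaM h a b + gaM h a b';
  gaMA : forall (d1 d2 d3 d12 d23 d : int) (h12 : d1 + d2 = d12)
    (h23 : d2 + d3 = d23) (hl : d12 + d3 = d) (hr : d1 + d23 = d)
    (a : ga_sort d1) (b : ga_sort d2) (c : ga_sort d3),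
    gaM hl (gaM h12 a b) c = gaM hr a (gaM h23 b c);
  ga1M : forall (d : int) (h : 0 + d = d) (a : ga_sort d), gaM h ga1 a = a;
  gaMC : forall (d e f : int) (h : d + e = f) (h' : e + d = f)
    (a : ga_sort d) (b : ga_sort e),
    gaM h a b = (-1) ^ (d * e) *: gaM h' b a }.

Record grmod (R : realType) (A : gralg R) := GrMod {
  gm_sort :> int -> lmodType R;
  gmA : forall d e f : int, d + e = f -> A d -> gm_sort e -> gm_sort f;
  gmA_linearl : forall (d e f : int) (h : d + e = f) (c : R)
    (a a' : A d) (s : gm_sort e),
    gmA h (c *: a + a') s = c *: gmA h a s + gmA h a' s;
  gmA_linearr : forall (d e f : int) (h : d + e = f) (c : R)
    (a : A d) (s s' : gm_sort e),
    gmA h a (c *: s + s') = c *: gmA h a s + gmA h a s';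
  gmAA : forall (d1 d2 d3 d12 d23 d : int) (h12 : d1 + d2 = d12)
    (h23 : d2 + d3 = d23) (hl : d12 + d3 = d) (hr : d1 + d23 = d)
    (a : A d1) (b : A d2) (s : gm_sort d3),
    gmA hl (gaM h12 a b) s = gmA hr a (gmA h23 b s);
  gm1A : forall (d : int) (h : 0 + d = d) (s : gm_sort d), gmA h (ga1 A) s = s }.

Arguments gaM {R} g {d e f} h a b.
Arguments gmA {R A} g {d e f} h a s.

Section GradedAlgebra.
Variables (R : realType) (A : gralg R).

Lemma gaMDl d e f (h : d + e = f) (a a' : A d) (b : A e) :
  gaM A h (a + a') b = gaM A h a b + gaM A h a' b.
Proof. by rewrite -[a]scale1r gaM_linearl !scale1r. Qed.

Lemma gaMDr d e f (h : d + e = f) (a : A d) (b b' : A e) :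
  gaM A h a (b + b') = gaM A h a b + gaM A h a b'.
Proof. by rewrite -[b]scale1r gaM_linearr !scale1r. Qed.

Lemma gaM0l d e f (h : d + e = f) (b : A e) : gaM A h (0 : A d) b = 0.
Proof.
by have := gaMDl h 0 0 b; rewrite addr0 => /esym/eqP; rewrite -subr_eq0 addrK => /eqP.
Qed.

Lemma gaM0r d e f (h : d + e = f) (a : A d) : gaM A h a (0 : A e) = 0.
Proof.
by have := gaMDr h a 0 0; rewrite addr0 => /esym/eqP; rewrite -subr_eq0 addrK => /eqP.
Qed.

Lemma gaMZl d e f (h : d + e = f) c (a : A d) (b : A e) :
  gaM A h (c *: a) b = c *: gaM A h a b.
Proof. by have := gaM_linearl h c a 0 b; rewrite gaM0l !addr0. Qed.

Lemma gaMZr d e f (h : d + e = f) c (a : A d) (b : A e) :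
  gaM A h a (c *: b) = c *: gaM A h a b.
Proof. by have := gaM_linearr h c a b 0; rewrite gaM0r !addr0. Qed.

Lemma gaM1 d (h : d + 0 = d) (a : A d) : gaM A h a (ga1 A) = a.
Proof. by rewrite (gaMC h (add0r d)) mulr0 expr0z scale1r ga1M. Qed.

Variable E : grmod A.

Lemma gmADl d e f (h : d + e = f) (a a' : A d) (s : E e) :
  gmA E h (a + a') s = gmA E h a s + gmA E h a' s.
Proof. by rewrite -[a]scale1r gmA_linearl !scale1r. Qed.

Lemma gmADr d e f (h : d + e = f) (a : A d) (s s' : E e) :
  gmA E h a (s + s') = gmA E h a s + gmA E h a s'.
Proof. by rewrite -[s]scale1r gmA_linearr !scale1r. Qed.

Lemma gmA0l d e f (h : d + e = f) (s : E e) : gmA E h (0 : A d) s = 0.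
Proof.
by have := gmADl h 0 0 s; rewrite addr0 => /esym/eqP; rewrite -subr_eq0 addrK => /eqP.
Qed.

Lemma gmA0r d e f (h : d + e = f) (a : A d) : gmA E h a (0 : E e) = 0.
Proof.
by have := gmADr h a 0 0; rewrite addr0 => /esym/eqP; rewrite -subr_eq0 addrK => /eqP.
Qed.

Lemma gmAZl d e f (h : d + e = f) c (a : A d) (s : E e) :
  gmA E h (c *: a) s = c *: gmA E h a s.
Proof. by have := gmA_linearl h c a 0 s; rewrite gmA0l !addr0. Qed.

Lemma gmA_sumr d e f (h : d + e = f) (a : A d) (I : Type) (r : seq I)
    (P : pred I) (F : I -> E e) :
  gmA E h a (\sum_(i <- r | P i) F i) = \sum_(i <- r | P i) gmA E h a (F i).
Proof.
by apply: (big_morph (fun s => gmA E h a s)) => [s t|]; rewrite ?gmADr ?gmA0r.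
Qed.

Record submod_closed (X : forall d : int, E d -> Prop) : Prop := SubmodClosed {
  submod0 : forall d, X d 0;
  submodD : forall d (s t : E d), X d s -> X d t -> X d (s + t);
  submodA : forall d e f (h : d + e = f) (a : A d) (s : E e),
    X e s -> X f (gmA E h a s) }.

(** Phrased through all graded submodules, so that changing a family only requires tracking
    memberships; explicit coefficients are recovered by [generatesP]. *)
Definition generates (I : finType) (deg : I -> int)
    (F : forall i, E (deg i)) : Prop :=
  forall X : (forall d : int, E d -> Prop), submod_closed X ->
    (forall i, X (deg i) (F i)) -> forall d (s : E d), X d s.

Section Closed.
Variables (X : forall d : int, E d -> Prop) (clX : submod_closed X).

Lemma submodZ d c (s : E d) : X s -> X (c *: s).
Proof.
move=> Xs; have := submodA clX (add0r d) (c *: ga1 A) Xs.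
by rewrite gmAZl gm1A.
Qed.

Lemma submodN d (s : E d) : X s -> X (- s).
Proof. by rewrite -scaleN1r; exact: submodZ. Qed.

Lemma submodB d (s t : E d) : X s -> X t -> X (s - t).
Proof. by move=> Xs Xt; apply: (submodD clX) => //; exact: submodN. Qed.

Lemma submod_sum d (I : Type) (r : seq I) (P : pred I) (F : I -> E d) :
  (forall i, P i -> X (F i)) -> X (\sum_(i <- r | P i) F i).
Proof.
by move=> XF; apply: (big_ind (fun s : E d => X s)) => //;
  [exact: submod0|exact: submodD].
Qed.

End Closed.

Definition combination (I : finType) (deg : I -> int)
    (F : forall i, E (deg i)) d (s : E d) : Prop :=
  exists c : forall i, A (d - deg i),
    s = \sum_i gmA E (subrK (deg i) d) (c i) (F i).

(** Moves a coefficient between two provably equal degrees. The copy is characterized by its action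
    and by its product with 1, so that no cast appears in the statement. *)
Lemma gmA_cast d d' e f (h : d + e = f) (h' : d' + e = f) (a : A d) :
  exists a' : A d', (forall s : E e, gmA E h a s = gmA E h' a' s) /\
    forall k : 0 + d' = d, gaM A k (ga1 A) a' = a.
Proof.
have dd : d = d' by apply: (addIr e); rewrite h h'.
case: d' / dd h' => h'; exists a; split=> [s|k]; last exact: ga1M.
by rewrite (eq_irrelevance h h').
Qed.

Lemma combination_closed (I : finType) (deg : I -> int)
  (F : forall i, E (deg i)) : submod_closed (combination F).
Proof.
split.
- move=> d; exists (fun i => 0).
  by rewrite big1 // => i _; rewrite gmA0l.
- move=> d _ _ [c ->] [c' ->]; exists (fun i => c i + c' i).
  by rewrite -big_split; apply: eq_bigr => i _; rewrite gmADl.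
- move=> d e f h a _ [c ->].
  have H i : d + (e - deg i) = f - deg i by rewrite addrA h.
  exists (fun i => gaM A (H i) a (c i)).
  rewrite gmA_sumr; apply: eq_bigr => i _.
  by rewrite (gmAA (H i) (subrK (deg i) e) (subrK (deg i) f) h).
Qed.

(** Kronecker coordinates. As [c i] lives in degree [deg i - deg i] and not in degree 0, that it
    equals 1 is expressed by a multiplication by 1. *)
Lemma coordinates_gen (I : finType) (deg : I -> int)
    (F : forall i, E (deg i)) i :
  exists c : forall j, A (deg i - deg j),
    [/\ F i = \sum_j gmA E (subrK (deg j) (deg i)) (c j) (F j),
        forall j, j != i -> c j = 0
      & forall k : 0 + (deg i - deg i) = 0, gaM A k (ga1 A) (c i) = ga1 A].
Proof.
have h0 : 0 + deg i = deg i by rewrite add0r.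
have [a [Ha Ha1]] := gmA_cast h0 (subrK (deg i) (deg i)) (ga1 A).
pose c j : A (deg i - deg j) :=
  if j =P i is ReflectT ji then
    ecast k (A (deg i - deg k)) (esym ji) a
  else 0.
have ci : c i = a by rewrite /c; case: eqP => // ii; rewrite (eq_irrelevance ii erefl).
have c0 j : j != i -> c j = 0 by rewrite /c; case: eqP.
exists c; rewrite ci; split=> //.
rewrite (bigD1 i) //= big1 => [|j ji]; last by rewrite c0 // gmA0l.
by rewrite addr0 ci -Ha gm1A.
Qed.

Lemma combination_gen (I : finType) (deg : I -> int)
  (F : forall i, E (deg i)) i : combination F (F i).
Proof. by have [c [Fi _ _]] := coordinates_gen F i; exists c. Qed.

Lemma generatesP (I : finType) (deg : I -> int) (F : forall i, E (deg i)) :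
  generates F -> forall d (s : E d), combination F s.
Proof.
move=> genF; apply: genF (combination_closed F) _ => i.
exact: combination_gen.
Qed.

End GradedAlgebra.

(** * Gram-Schmidt in a stalk *)

(* Models the stalk of a quadratic graded vector bundle at a point; [q_ev] is
   the value at that point. *)
Record quad (R : realType) (l : int) := Quad {
  q_alg :> gralg R;
  q_mod : grmod q_alg;
  q_ev : forall d : int, q_alg d -> R;
  q_ev_linear : forall (d : int) (c : R) (a b : q_alg d),
    q_ev (c *: a + b) = c * q_ev a + q_ev b;
  q_ev1 : q_ev (ga1 q_alg) = 1;
  q_evM : forall (d e f : int) (h : d + e = f) (a : q_alg d) (b : q_alg e),
    q_ev (gaM q_alg h a b) = q_ev a * q_ev b;
  q_ev_deg : forall (d : int) (a : q_alg d), d != 0 -> q_ev a = 0;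
  q_inv : forall (h : 0 + 0 = 0) (a : q_alg 0), q_ev a != 0 ->
    exists b : q_alg 0, gaM q_alg h b a = ga1 q_alg;
  q_sqrt : forall (h : 0 + 0 = 0) (a : q_alg 0), 0 < q_ev a ->
    exists b : q_alg 0, gaM q_alg h b b = a /\ 0 < q_ev b;
  q_pr : forall d e f : int, d + e + l = f -> q_mod d -> q_mod e -> q_alg f;
  q_pr_linear : forall (d e f : int) (h : d + e + l = f) (c : R)
    (s : q_mod d) (t t' : q_mod e),
    q_pr h s (c *: t + t') = c *: q_pr h s t + q_pr h s t';
  q_pr_sym : forall (d e f : int) (h : d + e + l = f) (h' : e + d + l = f)
    (s : q_mod d) (t : q_mod e),
    q_pr h s t = (-1) ^ ((d + l) * (e + l)) *: q_pr h' t s;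
  q_pr_act : forall (d e a ae f f' : int) (hact : a + e = ae)
    (h : d + ae + l = f) (h' : d + e + l = f') (hmul : a + f' = f)
    (s : q_mod d) (u : q_alg a) (t : q_mod e),
    q_pr h s (gmA q_mod hact u t) =
    (-1) ^ (a * (d + l)) *: gaM q_alg hmul u (q_pr h' s t) }.

Arguments q_ev {R l q d} a.
Arguments q_pr {R l} q {d e f} h s t.

(** The degree 0 part as a type of its own, to carry a commutative ring structure, so that
    identities proved in any such ring apply to it. *)
Definition qdeg0 (R : realType) (l : int) (Q : quad R l) : Type := Q 0.

Section DegreeZero.
Variables (R : realType) (l : int) (Q : quad R l).

Lemma q_evD d (a b : Q d) : q_ev (a + b) = q_ev a + q_ev b.
Proof. by rewrite -[a]scale1r q_ev_linear scale1r mul1r. Qed.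

Lemma q_ev0 d : q_ev (0 : Q d) = 0.
Proof.
by have := q_evD (0 : Q d) 0; rewrite addr0 => /esym/eqP;
   rewrite -subr_eq0 addrK => /eqP.
Qed.

Lemma q_evZ d c (a : Q d) : q_ev (c *: a) = c * q_ev a.
Proof. by have := q_ev_linear c a 0; rewrite q_ev0 !addr0. Qed.

Lemma q_evN d (a : Q d) : q_ev (- a) = - q_ev a.
Proof. by rewrite -scaleN1r q_evZ mulN1r. Qed.

HB.instance Definition _ := GRing.Lmodule.on (qdeg0 Q).

Let mul0 (a b : qdeg0 Q) : qdeg0 Q := gaM Q (addr0 0) a b.

Fact qdeg0_mulA : associative mul0.
Proof. by move=> a b c; rewrite /mul0 (gaMA (addr0 0) (addr0 0) _ (addr0 0)). Qed.

Fact qdeg0_mulC : commutative mul0.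
Proof. by move=> a b; rewrite /mul0 (gaMC (addr0 0) (addr0 0)) mulr0 expr0z scale1r. Qed.

Fact qdeg0_mul1 : left_id (ga1 Q : qdeg0 Q) mul0.
Proof. by move=> a; rewrite /mul0 ga1M. Qed.

Fact qdeg0_mulDl : left_distributive mul0 +%R.
Proof. by move=> a b c; exact: gaMDl. Qed.

Fact qdeg0_one_neq0 : (ga1 Q : qdeg0 Q) != 0.
Proof.
apply/eqP => h; have := q_ev1 Q; rewrite [ga1 Q]h q_ev0 => /eqP.
by rewrite eq_sym oner_eq0.
Qed.

HB.instance Definition _ := GRing.Zmodule_isComNzRing.Build (qdeg0 Q)
  qdeg0_mulA qdeg0_mulC qdeg0_mul1 qdeg0_mulDl qdeg0_one_neq0.

Lemma qdeg0_mulE (h : 0 + 0 = 0) (a b : Q 0) :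
  gaM Q h a b = (a : qdeg0 Q) * (b : qdeg0 Q).
Proof. by rewrite (eq_irrelevance h (addr0 0)). Qed.

End DegreeZero.

(** The root of [1 + 2 u + c u^2 = 0] is written [u = - 1 / (1 + w)] with [w^2 = 1 - c]. Unlike
    [(w - 1) / c], this makes sense when [c] is not invertible. *)
Lemma isotropize_coef (K : comNzRingType) (v w c : K) :
  w * w = 1 - c -> v * (1 + w) = 1 ->
  1 + - v + (- v + - v * (- v * c)) = 0.
Proof.
move=> ww vw; have -> : c = 1 - w * w by rewrite ww; ring.
have vwE : v * w = 1 - v by rewrite -[1]vw; ring.
transitivity (1 - v - v + v * v - (v * w) * (v * w)); first by ring.
by rewrite vwE; ring.
Qed.

Lemma mulrMM_eq1 (K : comNzRingType) (v r : K) :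
  v * r = 1 -> v * (v * (r * r)) = 1.
Proof. by move=> vr; transitivity ((v * r) * (v * r)); [ring|rewrite vr mulr1]. Qed.

Section GramSchmidt.
Variables (R : realType) (l : int) (Q : quad R l).
Local Notation E := (q_mod Q).
Local Notation sg m := ((-1) ^ m : R).

Lemma q_prDr d e f (h : d + e + l = f) (s : E d) (t t' : E e) :
  q_pr Q h s (t + t') = q_pr Q h s t + q_pr Q h s t'.
Proof. by rewrite -[t]scale1r q_pr_linear !scale1r. Qed.

Lemma q_pr0r d e f (h : d + e + l = f) (s : E d) : q_pr Q h s (0 : E e) = 0.
Proof.
by have := q_prDr h s 0 0; rewrite addr0 => /esym/eqP;
   rewrite -subr_eq0 addrK => /eqP.
Qed.

Fact swap_deg d e f : d + e + l = f -> e + d + l = f.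
Proof. by rewrite [e + d]addrC. Qed.

Lemma q_prDl d e f (h : d + e + l = f) (s s' : E d) (t : E e) :
  q_pr Q h (s + s') t = q_pr Q h s t + q_pr Q h s' t.
Proof. by rewrite !(q_pr_sym h (swap_deg h)) q_prDr scalerDr. Qed.

Lemma q_pr0l d e f (h : d + e + l = f) (t : E e) : q_pr Q h (0 : E d) t = 0.
Proof. by rewrite (q_pr_sym h (swap_deg h)) q_pr0r scaler0. Qed.

(** Two applications of graded symmetry and the sign rule of the second argument have an even total
    exponent, so no sign is left in the first argument. *)
Lemma q_pr_actl d e a ad f f' (hact : a + d = ad) (h : ad + e + l = f)
    (h' : d + e + l = f') (hmul : a + f' = f) (u : Q a) (s : E d) (t : E e) :
  q_pr Q h (gmA E hact u s) t = gaM Q hmul u (q_pr Q h' s t).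
Proof.
rewrite (q_pr_sym h (swap_deg h)) (q_pr_act hact _ (swap_deg h') hmul).
rewrite [in LHS](q_pr_sym (swap_deg h') h') gaMZr !scalerA -!signzD.
have -> : (ad + l) * (e + l) + a * (e + l) + (e + l) * (d + l) =
  (a + d + l) * (e + l) + (a + d + l) * (e + l) by rewrite -hact; ring.
by rewrite signz_double scale1r.
Qed.

Lemma q_prZl d e f (h : d + e + l = f) c (s : E d) (t : E e) :
  q_pr Q h (c *: s) t = c *: q_pr Q h s t.
Proof.
rewrite !(q_pr_sym h (swap_deg h)) !scalerA.
have := q_pr_linear (swap_deg h) c t s 0; rewrite q_pr0r !addr0 => ->.
by rewrite scalerA mulrC.
Qed.

Definition orth d e (s : E d) (t : E e) : Prop :=
  forall f (h : d + e + l = f), q_pr Q h s t = 0.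

Definition pairs_val d e (s : E d) (t : E e) (c : R) : Prop :=
  exists h : d + e + l = 0, q_pr Q h s t = c *: ga1 Q.

Definition evp d e (s : E d) (t : E e) : R := q_ev (q_pr Q erefl s t).

Lemma evpE d e f (h : d + e + l = f) (s : E d) (t : E e) :
  evp s t = q_ev (q_pr Q h s t).
Proof. by case: f / h. Qed.

Lemma orth_sym d e (s : E d) (t : E e) : orth s t -> orth t s.
Proof. by move=> st f h; rewrite (q_pr_sym h (swap_deg h)) st scaler0. Qed.

Lemma orth_closed e (t : E e) : submod_closed (fun d (s : E d) => orth s t).
Proof.
split.
- by move=> d f h; rewrite q_pr0l.
- by move=> d s s' st s't f h; rewrite q_prDl st s't addr0.
- move=> d e' f h a s st g h'.
  have hm : d + (e' + e + l) = g by rewrite -h' -h !addrA.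
  by rewrite (q_pr_actl h h' erefl hm a) st gaM0r.
Qed.

Lemma evp_sym d e (s : E d) (t : E e) : evp s t != 0 -> evp t s != 0.
Proof.
rewrite /evp (q_pr_sym erefl (swap_deg erefl)) q_evZ.
rewrite mulf_eq0 negb_or => /andP[_].
by rewrite -evpE.
Qed.

Lemma evp_deg d e (s : E d) (t : E e) : evp s t != 0 -> d + e + l = 0.
Proof.
by move=> h; apply/eqP; apply: contraNT h => h; rewrite /evp q_ev_deg.
Qed.

Lemma evp_orth d e (s : E d) (t : E e) : orth s t -> evp s t = 0.
Proof. by move=> h; rewrite /evp h q_ev0. Qed.

Lemma evpDl d e (s s' : E d) (t : E e) : evp (s + s') t = evp s t + evp s' t.
Proof. by rewrite /evp q_prDl q_evD. Qed.

Lemma evpDr d e (s : E d) (t t' : E e) : evp s (t + t') = evp s t + evp s t'.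
Proof. by rewrite /evp q_prDr q_evD. Qed.

Lemma evp0l d e (t : E e) : evp (0 : E d) t = 0.
Proof. by rewrite /evp q_pr0l q_ev0. Qed.

Lemma evp0r d e (s : E d) : evp s (0 : E e) = 0.
Proof. by rewrite /evp q_pr0r q_ev0. Qed.

Lemma evp_actl d e a ad (h : a + d = ad) (u : Q a) (s : E d) (t : E e) :
  evp (gmA E h u s) t = q_ev u * evp s t.
Proof.
have hm : a + (d + e + l) = ad + e + l by rewrite -h !addrA.
by rewrite /evp (q_pr_actl h erefl erefl hm u) q_evM.
Qed.

(* The sign of [q_pr_act] disappears, as [q_ev u <> 0] forces [a = 0]. *)
Lemma evp_actr d e a ae (h : a + e = ae) (s : E d) (u : Q a) (t : E e) :
  evp s (gmA E h u t) = q_ev u * evp s t.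
Proof.
have hm : a + (d + e + l) = d + ae + l by rewrite -h; ring.
rewrite /evp (q_pr_act h erefl erefl hm) q_evZ q_evM.
have [a0|a0] := eqVneq a 0; first by rewrite {1}a0 mul0r expr0z mul1r.
by rewrite (q_ev_deg u a0) !(mul0r, mulr0).
Qed.

(** Graded symmetry reads [<s, s> = - <s, s>] here, as [(d + l) ^ 2] and [d + l] have the same
    parity. *)
Lemma odd_self_orth d (s : E d) : sg (d + l) = -1 -> orth s s.
Proof.
move=> sd f h; have := q_pr_sym h h s s; rewrite signz_sqr sd scaleN1r.
move/eqP; rewrite -subr_eq0 opprK -mulr2n -scaler_nat scaler_eq0.
by rewrite pnatr_eq0 => /eqP.
Qed.

Lemma evp_self_sign d (s : E d) : evp s s != 0 -> sg (d + l) = 1.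
Proof.
have [//|sd] := signz_cases R (d + l).
by rewrite (evp_orth (odd_self_orth s sd)) eqxx.
Qed.

Lemma unit_scale_closed d (h : 0 + d = d) (u v : Q 0) (t : E d)
    (X : forall d, E d -> Prop) : submod_closed X ->
  gaM Q (addr0 0) v u = ga1 Q -> X d t <-> X d (gmA E h u t).
Proof.
move=> clX vu; split=> Xt; first exact: (submodA clX).
rewrite -[t](gm1A h) -vu (gmAA _ h h h).
exact: (submodA clX).
Qed.

Lemma normalize_pairing d e (s : E d) (t : E e) : evp s t != 0 ->
  exists u : Q 0, [/\ q_ev u != 0, pairs_val s (gmA E (add0r e) u t) 1
    & forall X, submod_closed X -> X e t <-> X e (gmA E (add0r e) u t)].
Proof.
move=> st; have h := evp_deg st.
have a0 : q_ev (q_pr Q h s t) != 0 by rewrite -evpE.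
have [u ua] := q_inv (addr0 0) a0; exists u; split.
- by apply: contraTneq (oner_neq0 R) => u0; rewrite -(q_ev1 Q) -ua q_evM u0 mul0r eqxx.
- exists h; rewrite (q_pr_act _ h h (addr0 0)) mul0r expr0z scale1r scale1r.
  by rewrite ua.
- move=> X clX; apply: (unit_scale_closed _ _ clX (v := q_pr Q h s t)).
  by rewrite qdeg0_mulE mulrC; rewrite qdeg0_mulE in ua.
Qed.

(* With [a = <s, s>], [b = <t, t>] and [<s, t> = 1], the vector [s + al t] is
   isotropic if [a + 2 al + al ^ 2 b = 0], which [al = - a / (1 + sqrt (1 - a b))]
   solves. The square root exists since [a b] vanishes at the point. *)
Lemma isotropize d e (s : E d) (t : E e) :
  evp s t != 0 -> (d = e -> sg (d + l) = -1) ->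
  exists s' : E d, [/\ orth s' s', evp s' t != 0
    & forall X, submod_closed X -> X e t -> (X d s <-> X d s')].
Proof.
move=> st de; have [sd|sd] := signz_cases R (d + l); last first.
  by exists s; split=> //; exact: odd_self_orth.
have {}de : d <> e.
  by move/de; rewrite sd => ?; lra.
have [u0 [u0n [h tt1] clt]] := normalize_pairing st.
set t1 := gmA E _ u0 t in tt1 clt; rewrite scale1r in tt1.
pose a := q_pr Q (erefl (d + d + l)) s s.
pose b := q_pr Q (erefl (e + e + l)) t1 t1.
(* Since [d + e + l = 0] and [d <> e], the square [a] has non-zero degree and vanishes at the
   point. *)
have dn0 : d + d + l != 0 by apply/eqP => d0; apply: de; lia.
have hc : (d + d + l) + (e + e + l) = 0 by lia.
pose c : qdeg0 Q := gaM Q hc a b.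
have ev_c : q_ev (c : Q 0) = 0 by rewrite q_evM (q_ev_deg a dn0) mul0r.
have [|w [ww w0]] := q_sqrt (addr0 0) (a := (1 - c : qdeg0 Q)).
  by rewrite q_evD q_evN ev_c subr0 q_ev1.
have [|v vw] := q_inv (addr0 0) (a := (1 + (w : qdeg0 Q))).
  by rewrite q_evD q_ev1 gt_eqF // addr_gt0.
rewrite !qdeg0_mulE in ww vw.
(* For [al = u a] the isotropy equation is [1 + 2 u + c u^2] times [a], so it suffices to solve a
   quadratic equation in degree 0. *)
pose u : qdeg0 Q := - (v : qdeg0 Q).
have uc0 : 1 + u + (u + u * (u * c)) = 0 by exact: (@isotropize_coef (qdeg0 Q) v w c ww vw).
pose al := gaM Q (add0r _) (u : Q 0) a.
have hal : (d + d + l) + e = d by lia.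
have al_ev : q_ev al = 0 by rewrite q_ev_deg.
have hm : d + d + l + 0 = d + d + l by rewrite addr0.
have h' := swap_deg h.
have t1s : q_pr Q h' t1 s = ga1 Q.
  by rewrite (q_pr_sym h' h) tt1 mulrC signzM // scale1r.
have pr1 : q_pr Q erefl (gmA E hal al t1) s = al.
  by rewrite (q_pr_actl hal erefl h' hm) t1s gaM1.
exists (s + gmA E hal al t1); split.
- move=> f; case: f /.
  rewrite q_prDl !q_prDr pr1 [q_pr Q _ s (gmA _ _ _ _)](q_pr_sym _ erefl).
  rewrite pr1 signz_sqr sd scale1r.
  rewrite (q_pr_actl hal erefl h' hm) (q_pr_sym h' h) mulrC signzM // scale1r.
  rewrite (q_pr_actl hal h erefl hc) (gaMA (add0r _) hc hc (addr0 0)).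
  rewrite -/c -/b -/a [in X in gaM Q hm _ X]qdeg0_mulE.
  rewrite (gaMA (add0r _) hm hm (add0r _)) (gaMC hm (add0r _)) mulr0 expr0z.
  rewrite scale1r -(gaMA (addr0 0) (add0r _) (add0r _) (add0r _)) qdeg0_mulE.
  rewrite -{1}[a](ga1M (add0r _)) /al -!gaMDl.
  by rewrite -[RHS](gaM0l (add0r (d + d + l)) a); congr gaM; exact: uc0.
- have : evp (s + gmA E hal al t1) t1 = 1.
    by rewrite evpDl evp_actl al_ev mul0r addr0 (evpE h) tt1 q_ev1.
  rewrite evp_actr => st1; apply: contraTneq (oner_neq0 R) => st0.
  by rewrite -st1 st0 mulr0 eqxx.
- move=> X clX /(clt X clX).1 Xt1.
  have Xa : X d (gmA E hal al t1) by exact: (submodA clX).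
  split=> Xs; first exact: (submodD clX).
  by rewrite -[s](addrK (gmA E hal al t1)); exact: (submodB clX).
Qed.

(** Once [s'] is isotropic, adding a multiple of it to [t] cannot spoil it. The last clause says
    that the old and the new pair lie in the same graded submodules: read forwards it transports
    orthogonality to other vectors, read backwards it preserves generation. *)
Lemma hyperbolic_pair d e (s : E d) (t : E e) :
  evp s t != 0 -> (d = e -> sg (d + l) = -1) ->
  exists (s' : E d) (t' : E e),
    [/\ orth s' s', orth t' t', pairs_val s' t' 1
      & forall X, submod_closed X -> (X d s /\ X e t <-> X d s' /\ X e t')].
Proof.
move=> st de.
have [s' [ss s't cls]] := isotropize st de.
have [|t1 [tt t1s clt]] := isotropize (evp_sym s't) _.
  by move=> ed; rewrite ed; apply: de.
have [u [un stu clu]] := normalize_pairing (evp_sym t1s).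
exists s', (gmA E (add0r e) u t1); split=> //.
  have cl1 := submodA (orth_closed t1) (add0r e) u tt.
  exact: (submodA (orth_closed _) (add0r e) u (orth_sym cl1)).
move=> X clX; have [[h1 h1'] [h2 h2']] := (clu X clX, clu X clX).
split=> -[Xs Xt].
  have Xs' := (cls X clX Xt).1 Xs.
  by split=> //; apply: h1; apply: (clt X clX Xs').1.
have Xt' := (clt X clX Xs).2 (h1' Xt).
by split=> //; apply: (cls X clX Xt').2.
Qed.

Lemma normalize_diagonal d (s : E d) : evp s s != 0 ->
  exists (s' : E d) (c : R), [/\ c = 1 \/ c = -1, pairs_val s' s' c
    & forall X, submod_closed X -> (X d s <-> X d s')].
Proof.
move=> ss; have h := evp_deg ss.
pose a : Q 0 := q_pr Q h s s.
have a0 : q_ev a != 0 by rewrite -evpE.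
(* The sign of [<s, s>] at the point; after multiplication by it a square root [r] exists, and [s]
   is divided by [r]. *)
pose c : R := if 0 < q_ev a then 1 else -1.
have cc : c * c = 1 by rewrite /c; case: ifP; rewrite ?mulrNN mulr1.
have [|r [rr r0]] := q_sqrt (addr0 0) (a := c *: a).
  rewrite q_evZ /c; case: ifPn => [|h0]; first by rewrite mul1r.
  by rewrite mulN1r oppr_gt0 lt_neqAle a0 leNgt.
have [|v vr] := q_inv (addr0 0) (a := r); first by rewrite gt_eqF.
exists (gmA E (add0r d) v s), c; split.
- by rewrite /c; case: ifP; [left|right].
- exists h; rewrite (q_pr_actl _ h h (addr0 0)) (q_pr_act _ h h (addr0 0)).
  rewrite mul0r expr0z scale1r -/a.
  have -> : a = c *: gaM Q (addr0 0) r r by rewrite rr scalerA cc scale1r.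
  rewrite !gaMZr; congr (_ *: _).
  rewrite !qdeg0_mulE; rewrite qdeg0_mulE in vr.
  exact: (@mulrMM_eq1 (qdeg0 Q) v r vr).
- move=> X clX; apply: (unit_scale_closed _ _ clX (v := r)).
  by rewrite qdeg0_mulE mulrC; rewrite qdeg0_mulE in vr.
Qed.

End GramSchmidt.

(** * Normal form of a generating family *)

Section Normalization.
Variables (R : realType) (l : int) (Q : quad R l).
Local Notation E := (q_mod Q).
Local Notation sg m := ((-1) ^ m : R).
Local Notation orth := (@orth R l Q _ _).
Local Notation evp := (@evp R l Q _ _).

Lemma q_pr_suml d e f (h : d + e + l = f) (I : Type) (r : seq I) (P : pred I)
    (G : I -> E d) (t : E e) :
  q_pr Q h (\sum_(i <- r | P i) G i) t = \sum_(i <- r | P i) q_pr Q h (G i) t.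
Proof.
by apply: (big_morph (fun s => q_pr Q h s t)) => [s s'|];
  rewrite ?q_prDl ?q_pr0l.
Qed.

Lemma q_prBl d e f (h : d + e + l = f) (s s' : E d) (t : E e) :
  q_pr Q h (s - s') t = q_pr Q h s t - q_pr Q h s' t.
Proof. by rewrite q_prDl -scaleN1r q_prZl scaleN1r. Qed.

Lemma evp_suml d e (I : Type) (r : seq I) (P : pred I)
    (G : I -> E d) (t : E e) :
  evp (\sum_(i <- r | P i) G i) t = \sum_(i <- r | P i) evp (G i) t.
Proof.
by apply: (big_morph (fun s => evp s t)) => [s s'|];
  rewrite ?evpDl ?evp0l.
Qed.

Lemma evp_sumr d e (I : Type) (r : seq I) (P : pred I)
    (s : E d) (G : I -> E e) :
  evp s (\sum_(i <- r | P i) G i) = \sum_(i <- r | P i) evp s (G i).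
Proof.
by apply: (big_morph (fun t => evp s t)) => [t t'|];
  rewrite ?evpDr ?evp0r.
Qed.

Variables (n : nat) (deg : 'I_n -> int).
Implicit Types (F : forall i, E (deg i)) (S : {set 'I_n}) (sigma : 'I_n -> 'I_n).

(* If [Phi] has a dual family [T], then [1 = s B q^T] for the real Gram matrix
   [B] of any generating family, where [s] and [q] are the values of the
   coordinates of [T] and [Phi]; hence [B] is invertible. *)
Lemma generating_nondegenerate (Phi : forall i, E (deg i)) F :
  (forall i, exists (d : int) (T : E d), forall j, evp T (Phi j) = (i == j)%:R) ->
  generates F -> forall i, exists j, evp (F i) (F j) != 0.
Proof.
move=> nd /generatesP genF i.
pose qc j := sval (cid (genF _ (Phi j))).
have qcP j : Phi j = \sum_k gmA E (subrK (deg k) (deg j)) (qc j k) (F k).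
  by rewrite /qc; case: cid.
pose q := \matrix_(k, j) q_ev (qc j k).
pose B := \matrix_(a, b) evp (F a) (F b).
have sP a : exists s : 'rV[R]_n, s *m (B *m q) = \row_j (a == j)%:R.
  have [d [T TP]] := nd a; have [c cP] := genF _ T.
  exists (\row_m q_ev (c m)); apply/rowP => j.
  rewrite [RHS]mxE -TP cP evp_suml mxE; apply: eq_bigr => m _.
  rewrite evp_actl mxE; congr (_ * _).
  rewrite mxE qcP evp_sumr; apply: eq_bigr => b _.
  by rewrite evp_actr !mxE mulrC.
pose s := \matrix_a sval (cid (sP a)).
have sBq : s *m (B *m q) = 1%:M.
  apply/row_matrixP => a; rewrite row_mul rowK; case: cid => /= v ->.
  by apply/rowP => j; rewrite !mxE.
apply: contrapT => /forallNP h.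
have Bi : row i B = 0.
  by apply/rowP => j; rewrite !mxE; apply/eqP/negPn/negP; exact: h.
have := mulmx1C sBq; move/(congr1 (row i)).
rewrite row_mul row_mul Bi !mul0mx => /rowP/(_ i).
by rewrite !mxE eqxx => /eqP; rewrite eq_sym oner_eq0.
Qed.

(* By [gram_fixed], in the degree that is paired with itself [sigma] has only
   fixed points if the pairing is symmetric there, and none if it is
   antisymmetric. *)
Record gram S sigma F : Prop := Gram {
  gram_invol : forall i, i \in S -> sigma i \in S /\ sigma (sigma i) = i;
  gram_orth : forall i j, i \in S -> j \in S -> j != sigma i ->
    orth (F i) (F j);
  gram_pairs : forall i, i \in S -> exists c : R,
    (c = 1 \/ c = -1) /\ pairs_val (F i) (F (sigma i)) c;
  gram_fixed : forall i, i \in S -> deg i = deg (sigma i) ->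
    (sigma i = i <-> sg (deg i + l) = 1) }.

Definition splits S F : Prop :=
  forall i j, i \in S -> j \notin S -> orth (F i) (F j).

(** The component along [F t] is detected by its partner [F (sigma t)], and its coefficient is
    [c <s, F (sigma t)>] because [c] is its own inverse. Quantifying over [j = sigma t] lets the
    second clause be used at [t = sigma j] without transport along [sigma (sigma j) = j]. *)
Lemma projection_component S sigma F t d (s : E d) :
  gram S sigma F -> t \in S ->
  exists y : E d, [/\ forall j, j \in S -> j != sigma t -> orth y (F j),
    forall j, j = sigma t -> forall f (h : d + deg j + l = f),
      q_pr Q h y (F j) = q_pr Q h s (F j)
    & forall X, submod_closed X -> X _ (F t) -> X _ y].
Proof.
move=> [_ go gp _] tS; have [c [cc [h tc]]] := gp t tS.
have h1 : d + deg (sigma t) + l = d - deg t by lia.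
exists (gmA E (subrK (deg t) d) (c *: q_pr Q h1 s (F (sigma t))) (F t)); split.
- move=> j jS jt.
  exact: (submodA (orth_closed (F j)) (subrK (deg t) d)) (go _ _ tS jS jt).
- move=> j -> f hf; have hm : d - deg t + 0 = f by lia.
  rewrite (q_pr_actl _ _ h hm) tc gaMZr gaMZl scalerA.
  have -> : c * c = 1 by case: cc => ->; rewrite ?mulrNN mulr1.
  rewrite scale1r.
  have ff : d - deg t = f by rewrite -hm addr0.
  case: f / ff hf hm => hf hm; rewrite gaM1.
  by rewrite (eq_irrelevance h1 hf).
- move=> X clX Xt; exact: (submodA clX).
Qed.

Lemma orthogonalize S sigma F : gram S sigma F -> generates F ->
  exists F', [/\ gram S sigma F', generates F' & splits S F'].
Proof.
move=> gF genF.
have H m : exists v : E (deg m), (forall j, j \in S -> orth v (F j)) /\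
    forall X, submod_closed X -> (forall t, t \in S -> X _ (F t)) ->
      (X _ v -> X _ (F m)).
  have yP t : exists y : E (deg m), t \in S ->
    [/\ forall j, j \in S -> j != sigma t -> orth y (F j),
    forall j, j = sigma t -> forall f (h : deg m + deg j + l = f),
      q_pr Q h y (F j) = q_pr Q h (F m) (F j)
    & forall X, submod_closed X -> X _ (F t) -> X _ y].
    have [tS|tS] := boolP (t \in S); last by exists 0.
    by have [y yP] := projection_component (F m) gF tS; exists y.
  pose y t := sval (cid (yP t)).
  have yP' t (tS : t \in S) := svalP (cid (yP t)) tS.
  exists (F m - \sum_(t in S) y t); split=> [j jS f h|X clX XS Xv].
    have [sjS sjj] := gram_invol gF jS.
    (* Against [F j] only the component along [F (sigma j)] contributes, and it cancels
       [<F m, F j>]. *)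
    rewrite q_prBl q_pr_suml (bigD1 (sigma j)) //= big1 => [|t /andP[tS tj]].
      have [_ H _] := yP' _ sjS.
      by rewrite H // addr0 subrr.
    have [H _ _] := yP' _ tS; apply: H => //.
    by apply: contra tj => /eqP ->; have [_ ->] := gram_invol gF tS.
  rewrite -[F m](subrK (\sum_(t in S) y t)); apply: (submodD clX) => //.
  apply: (submod_sum clX) => t tS; have [_ _ H] := yP' _ tS.
  by apply: H => //; exact: XS.
pose F' m : E (deg m) := if m \in S then F m else sval (cid (H m)).
have F'S m : m \in S -> F' m = F m by rewrite /F' => ->.
exists F'; split.
- split; first exact: (gram_invol gF).
  + by move=> i j iS jS; rewrite !F'S //; exact: (gram_orth gF).
  + move=> i iS; have [siS _] := gram_invol gF iS.
    by rewrite !F'S //; exact: (gram_pairs gF).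
  + exact: (gram_fixed gF).
- move=> X clX XF'; apply: genF => // m.
  have XS t (tS : t \in S) : X _ (F t) by rewrite -F'S.
  have [mS|mS] := boolP (m \in S); first exact: XS.
  have := XF' m; rewrite /F' (negbTE mS); case: cid => v /= [_ vX].
  exact: vX.
- move=> i j iS jS; rewrite F'S // /F' (negbTE jS); case: cid => v /= [vo _].
  by apply: orth_sym; exact: vo.
Qed.

Lemma gram_ext S sigma F F' : (forall i, i \in S -> F' i = F i) ->
  gram S sigma F -> gram S sigma F'.
Proof.
move=> FF' gF; split; first exact: (gram_invol gF).
- by move=> i j iS jS; rewrite !FF' //; exact: (gram_orth gF).
- move=> i iS; have [siS _] := gram_invol gF iS.
  by rewrite !FF' //; exact: (gram_pairs gF).
- exact: (gram_fixed gF).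
Qed.

Lemma pairs_val_sym d e (s : E d) (t : E e) (c : R) : c = 1 \/ c = -1 ->
  pairs_val s t c -> exists c', (c' = 1 \/ c' = -1) /\ pairs_val t s c'.
Proof.
move=> cc [h st]; exists (sg ((e + l) * (d + l)) * c); split.
  by case: (signz_cases R ((e + l) * (d + l))) => ->; case: cc => ->;
    rewrite ?mulrNN ?mulN1r ?mul1r; auto.
by exists (swap_deg h); rewrite (q_pr_sym _ h) st scalerA.
Qed.

(** The new index becomes a fixed point of the involution, as [gram_fixed] demands: a vector whose
    square is non-zero at the point sits in a degree where the pairing is symmetric. *)
Lemma diagonal_step S sigma F i :
  gram S sigma F -> generates F -> splits S F -> i \notin S ->
  evp (F i) (F i) != 0 ->
  exists sigma' F', gram (i |: S) sigma' F' /\ generates F'.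
Proof.
move=> gF genF sF iS Fii; have [s [c [cc sc cls]]] := normalize_diagonal Fii.
pose F' : forall j, E (deg j) := @eqtype.dfwith _ _ F i s.
have F'i : F' i = s by exact: dfwith_in.
have F'o j : j != i -> F' j = F j by move=> ji; rewrite /F' dfwith_out // eq_sym.
have F'S j : j \in S -> F' j = F j.
  by move=> jS; apply: F'o; apply: contraTneq jS => ->.
have oi j : j \in S -> orth s (F j).
  by move=> jS; apply: (cls _ (orth_closed (F j))).1; apply: orth_sym; exact: sF.
exists (fun j => if j == i then i else sigma j), F'; split; last first.
  move=> X clX XF'; apply: genF => // j.
  have [->|ji] := eqVneq j i; first by apply: (cls X clX).2; rewrite -F'i.
  by rewrite -F'o.
split.
- move=> j; rewrite in_setU1; have [-> _|ji /= jS] := eqVneq j i.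
    by rewrite eqxx setU11.
  have [sjS sjj] := gram_invol gF jS; rewrite in_setU1 sjS orbT.
  by rewrite ifN //; apply: contraTneq sjS => ->.
- move=> a b /setU1P[->|aS] /setU1P[->|bS].
  + by rewrite /= !eqxx.
  + rewrite /= ?eqxx => _; rewrite F'i F'S //; exact: oi.
  + rewrite /= ?eqxx => _; rewrite F'i F'S //; apply: orth_sym; exact: oi.
  + rewrite /= ifN; last by apply: contraTneq aS => ->.
    by move=> ba; rewrite !F'S //; exact: (gram_orth gF).
- move=> j; rewrite in_setU1; have [-> _|ji /= jS] := eqVneq j i.
    by exists c; rewrite ?eqxx !F'i.
  by have [sjS _] := gram_invol gF jS; rewrite !F'S //; exact: (gram_pairs gF).
- move=> j /setU1P[-> _|jS].
    by rewrite eqxx (evp_self_sign Fii).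
  by rewrite ifN; [exact: (gram_fixed gF)|apply: contraTneq jS => ->].
Qed.

(** The involution is extended by exchanging [i] and [j]. The condition on degrees rules out the
    symmetric self-paired degree, where a two-element orbit would contradict [gram_fixed]. *)
Lemma hyperbolic_step S sigma F i j :
  gram S sigma F -> generates F -> splits S F -> i \notin S -> j \notin S ->
  i != j -> evp (F i) (F j) != 0 -> (deg i = deg j -> sg (deg i + l) = -1) ->
  exists sigma' F', gram (i |: (j |: S)) sigma' F' /\ generates F'.
Proof.
move=> gF genF sF iS jS ij Fij dij.
have [s [t [ss tt st clst]]] := hyperbolic_pair Fij dij.
pose F' : forall k, E (deg k) := @eqtype.dfwith _ _ (@eqtype.dfwith _ _ F j t) i s.
have F'i : F' i = s by exact: dfwith_in.
have F'j : F' j = t by rewrite /F' dfwith_out // dfwith_in.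
have F'o k : k != i -> k != j -> F' k = F k.
  by move=> ki kj; rewrite /F' !dfwith_out // eq_sym.
have F'S k : k \in S -> F' k = F k.
  by move=> kS; apply: F'o; apply: contraTneq kS => ->.
have oij k : k \in S -> orth s (F k) /\ orth t (F k).
  move=> kS; apply: (clst _ (orth_closed (F k))).1.
  by split; apply: orth_sym; exact: sF.
have oi k : k \in S -> orth s (F k) by case/oij.
have oj k : k \in S -> orth t (F k) by case/oij.
pose sigma' k := if k == i then j else if k == j then i else sigma k.
have s'i : sigma' i = j by rewrite /sigma' eqxx.
have s'j : sigma' j = i by rewrite /sigma' eqxx eq_sym (negbTE ij).
have s'S k : k \in S -> sigma' k = sigma k.
  by move=> kS; rewrite /sigma' !ifN //; apply: contraTneq kS => ->.
have memS' k : k \in i |: (j |: S) -> [\/ k = i, k = j | k \in S].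
  by rewrite !in_setU1 => /or3P[/eqP|/eqP|]; [constructor 1|constructor 2|constructor 3].
exists sigma', F'; split; last first.
  move=> X clX XF'; apply: genF => // k.
  have [Xi Xj] : X _ (F i) /\ X _ (F j).
    by apply: (clst X clX).2; rewrite -F'i -F'j.
  have [->//|ki] := eqVneq k i; have [->//|kj] := eqVneq k j.
  by rewrite -F'o.
split.
- move=> k /memS'[->|->|kS].
  + by rewrite s'i s'j !in_setU1 eqxx orbT.
  + by rewrite s'j s'i !in_setU1 eqxx.
  + have [skS skk] := gram_invol gF kS.
    by rewrite s'S // s'S // !in_setU1 skS !orbT.
- move=> a b /memS'[->|->|aS] /memS'[->|->|bS].
  + by rewrite F'i.
  + by rewrite s'i eqxx.
  + by rewrite F'i F'S // => _; exact: oi.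
  + by rewrite s'j eqxx.
  + by rewrite F'j.
  + by rewrite F'j F'S // => _; exact: oj.
  + by rewrite F'i F'S // => _; apply: orth_sym; exact: oi.
  + by rewrite F'j F'S // => _; apply: orth_sym; exact: oj.
  + by rewrite s'S // !F'S // => ba; exact: (gram_orth gF).
- move=> k /memS'[->|->|kS].
  + by exists 1; split; [left|rewrite s'i F'i F'j].
  + by rewrite s'j F'i F'j; apply: pairs_val_sym st; left.
  + have [skS _] := gram_invol gF kS.
    by rewrite s'S // !F'S //; exact: (gram_pairs gF).
- have odd_ne (a : int) : sg a = -1 -> sg a <> 1 by move=> -> ?; lra.
  move=> k /memS'[->|->|kS].
  + rewrite s'i => /dij/odd_ne h; split=> // ji.
    by rewrite ji eqxx in ij.
  + rewrite s'j => ji; have /odd_ne h : sg (deg j + l) = -1 by rewrite ji; exact: dij.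
    by split=> // ij'; rewrite ij' eqxx in ij.
  + by rewrite s'S //; exact: (gram_fixed gF).
Qed.

(** The square of [F i + F j] has value [2 <F i, F j>] at the point. Acting with 1 moves [F j] to
    the degree of [F i], which is equal to its own only by hypothesis. *)
Lemma polarize F i j : deg i = deg j -> sg (deg i + l) = 1 ->
  evp (F i) (F i) = 0 -> evp (F j) (F j) = 0 -> evp (F i) (F j) != 0 ->
  exists v : E (deg i), evp v v != 0 /\
    forall X, submod_closed X -> X _ (F j) -> (X _ (F i) <-> X _ v).
Proof.
move=> dij sd Fii Fjj Fij; have h : 0 + deg j = deg i by rewrite add0r.
exists (F i + gmA E h (ga1 Q) (F j)); split.
  have Fji : evp (F j) (F i) = evp (F i) (F j).
    rewrite /evp (q_pr_sym erefl (swap_deg erefl)) q_evZ -evpE.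
    have -> : sg ((deg j + l) * (deg i + l)) = 1 by rewrite mulrC signzM.
    by rewrite mul1r.
  rewrite !(evpDl, evpDr) !(evp_actl, evp_actr) q_ev1 !mul1r Fii Fjj Fji.
  by rewrite add0r addr0 -mulr2n mulrn_eq0.
move=> X clX Xj; have Xa := submodA clX h (ga1 Q) Xj.
split=> Xi; first exact: (submodD clX).
by rewrite -[F i](addrK (gmA E h (ga1 Q) (F j))); exact: (submodB clX).
Qed.

Lemma normal_form (Phi F0 : forall i, E (deg i)) :
  (forall i, exists (d : int) (T : E d), forall j, evp T (Phi j) = (i == j)%:R) ->
  generates F0 ->
  exists sigma F, gram [set: 'I_n] sigma F /\ generates F.
Proof.
move=> nd gen0.
suff [S [sigma [F [gF genF /eqP ST]]]] : exists S sigma F,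
    [/\ gram S sigma F, generates F & S == [set: 'I_n]%SET].
  by exists sigma, F; rewrite -ST.
have : exists S sigma F, gram S sigma F /\ generates F.
  by exists finset.set0, id, F0; split=> //; split=> [i|i j|i|i]; rewrite finset.in_set0.
(* Induction on the number of vectors not yet normalized. *)
case=> S; move: {2}(#|~: S|)%N (leqnn #|~: S|) => m.
elim: m S => [|m IH] S Sm [sigma [F [gF genF]]].
  exists S, sigma, F; split=> //.
  by move: Sm; rewrite leqn0 cards_eq0 => /eqP h; rewrite -[S]finset.setCK h finset.setC0.
have [ST|ST] := boolP (S == [set: 'I_n]%SET); first by exists S, sigma, F.
have [i iS] : exists i, i \notin S.
  apply: contrapT => /forallNP h; case/eqP: ST; apply/setP => i.
  by rewrite finset.in_setT; apply/negPn/negP; exact: h.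
have {F gF genF} [F [gF genF sF]] := orthogonalize gF genF.
have step a S' : a \notin S -> a \in S' -> S \subset S' ->
    (exists sigma' F', gram S' sigma' F' /\ generates F') ->
    exists S sigma F, [/\ gram S sigma F, generates F & S == [set: 'I_n]%SET].
  move=> aS aS' SS'; apply: IH.
  rewrite -ltnS; apply: leq_trans Sm; apply: proper_card; apply/properP.
  by split; [rewrite finset.setCS|exists a; rewrite finset.in_setC ?aS'].
(* Non-zero squares are split off first; when none is left, all remaining vectors have square 0 at
   the point. *)
have [[a [aS Faa]]|noD] := pselect (exists a, a \notin S /\ evp (F a) (F a) != 0).
  apply: (step a (a |: S)) (diagonal_step gF genF sF aS Faa) => //.
    by rewrite setU11.
  exact: finset.subsetUr.
have {}noD a : a \notin S -> evp (F a) (F a) = 0.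
  by move=> aS; apply/eqP/negPn/negP => Faa; apply: noD; exists a.
(* A partner for [i]: it lies outside [S], whose vectors are orthogonal to [F i], and it is not [i],
   whose square has value 0. *)
have [j Fij] := generating_nondegenerate nd genF i.
have jS : j \notin S.
  apply: contraTN (evp_sym Fij) => jS.
  by rewrite negbK evp_orth //; exact: sF.
have ij : i != j by apply: contraTneq Fij => <-; rewrite noD // eqxx.
have [hd|/not_implyP[dij sd]] := pselect (deg i = deg j -> sg (deg i + l) = -1).
  apply: (step i (i |: (j |: S))) (hyperbolic_step gF genF sF iS jS ij Fij hd) => //.
    by rewrite setU11.
  by rewrite finset.setUA; exact: finset.subsetUr.
(* Both vectors have the symmetric self-paired degree, where a hyperbolic pair is not allowed;
   polarization creates a non-zero square instead. *)
have {}sd : sg (deg i + l) = 1 by case: (signz_cases R (deg i + l)) sd.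
have [v [vv clv]] := polarize dij sd (noD _ iS) (noD _ jS) Fij.
pose F' : forall k, E (deg k) := @eqtype.dfwith _ _ F i v.
have F'i : F' i = v by exact: dfwith_in.
have F'o k : k != i -> F' k = F k by move=> ki; rewrite /F' dfwith_out // eq_sym.
have F'S k : k \in S -> F' k = F k.
  by move=> kS; apply: F'o; apply: contraTneq kS => ->.
apply: (step i (i |: S)) => //; [by rewrite setU11|exact: finset.subsetUr|].
apply: (@diagonal_step S sigma F').
- exact: gram_ext gF.
- move=> X clX XF'; apply: genF => // k.
  have Xj : X _ (F j) by rewrite -F'o // eq_sym.
  have [->|ki] := eqVneq k i; last by rewrite -F'o.
  by apply: (clv X clX Xj).2; rewrite -F'i.
- move=> a b aS bS; rewrite F'S //; have [->|bi] := eqVneq b i; last first.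
    by rewrite F'o //; exact: sF.
  rewrite F'i; apply: orth_sym.
  apply: (clv _ (orth_closed (F a)) _).1; apply: orth_sym; exact: sF.
- by [].
- by rewrite F'i.
Qed.

End Normalization.

(** * Gluing, charts and bump functions *)

Section Sheaves.
Variables (R : realType) (M : topologicalType).
Implicit Types (U V W : opens M).

Definition capO U V : opens M := Opens (openI (@oset_open _ U) (@oset_open _ V)).

Lemma capOl U V : capO U V `<=` U. Proof. by move=> y []. Qed.
Lemma capOr U V : capO U V `<=` V. Proof. by move=> y []. Qed.

Lemma capO_sub U V W : W `<=` U -> W `<=` V -> W `<=` capO U V.
Proof. by move=> h k y Wy; split; [exact: h|exact: k]. Qed.

Variable G : gsheaf R M.

Lemma gres_irr U V (h h' : V `<=` U) d (s : G U d) : gres G h s = gres G h' s.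
Proof. by rewrite (Prop_irrelevance h h'). Qed.

Lemma gresE U V W (h1 : V `<=` U) (h2 : W `<=` V) (h3 : W `<=` U) d (s : G U d) :
  gres G h2 (gres G h1 s) = gres G h3 s.
Proof. exact: gres_comp. Qed.

Lemma gres_eq_sub U V W W' (hV : V `<=` U) (hV' : V `<=` W)
    (h : W' `<=` V) (hU : W' `<=` U) (hW : W' `<=` W) d (s : G U d) (t : G W d) :
  gres G hV s = gres G hV' t -> gres G hU s = gres G hW t.
Proof.
by move=> e; rewrite -(gresE hV h hU) e (gresE hV' h hW).
Qed.

Definition two_opens U V (b : bool) : opens M := if b then U else V.

Lemma sep2 U V W (hU : U `<=` W) (hV : V `<=` W) d (s t : G W d) :
  W `<=` U `|` V -> gres G hU s = gres G hU t -> gres G hV s = gres G hV t ->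
  s = t.
Proof.
move=> cov eU eV.
have hC b : two_opens U V b `<=` W by case: b.
apply: (@gsheaf_sep _ _ G bool (two_opens U V) W hC).
  by move=> y /cov[Uy|Vy]; [exists true|exists false].
by case; rewrite ?(gres_irr (hC true) hU) ?(gres_irr (hC false) hV).
Qed.

Lemma glue2 U V W (hU : U `<=` W) (hV : V `<=` W) d (s : G U d) (t : G V d) :
  W `<=` U `|` V -> gres G (@capOl U V) s = gres G (@capOr U V) t ->
  exists r : G W d, gres G hU r = s /\ gres G hV r = t.
Proof.
move=> cov e.
have hC b : two_opens U V b `<=` W by case: b.
pose f (b : bool) : G (two_opens U V b) d :=
  match b with true => s | false => t end.
have [|[] [] W' hi hj|r rP] :=
    @gsheaf_glue _ _ G bool (two_opens U V) W hC _ d f.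
- by move=> y /cov[Uy|Vy]; [exists true|exists false].
- exact: gres_irr.
- exact: (gres_eq_sub (capO_sub hi hj) _ _ e).
- apply/esym; exact: (gres_eq_sub (capO_sub hj hi) _ _ e).
- exact: gres_irr.
- exists r; rewrite (gres_irr hU (hC true)) (gres_irr hV (hC false)).
  by split; [exact: (rP true)|exact: (rP false)].
Qed.

End Sheaves.

Section SectionModules.
Variables (R : realType) (M : topologicalType) (A : galg_sheaf R M).

Definition sec_alg (U : opens M) : gralg R :=
  @GrAlg R (A U) (gone A U) (fun d e f h => gmul A h)
    (@gmul_linearl R M A U) (@gmul_linearr R M A U) (@gmulA R M A U)
    (@gmul1 R M A U) (@gmulC R M A U).

Definition sec_mod (E : gmod_sheaf A) (U : opens M) : grmod (sec_alg U) :=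
  @GrMod R (sec_alg U) (E U) (fun d e f h => gact E h)
    (@gact_linearl R M A E U) (@gact_linearr R M A E U) (@gactA R M A E U)
    (@gact1 R M A E U).

(** Lets results on sections of modules, such as [extend_section], apply to functions. *)
Definition self_mod : gmod_sheaf A :=
  @GModSheaf R M A A (fun U d e f h => gmul A h)
    (@gmul_linearl R M A) (@gmul_linearr R M A) (@gmulA R M A)
    (@gmul1 R M A) (@gres_mul R M A).

End SectionModules.

Section Charts.
Variables (R : realType) (M : topologicalType) (A : galg_sheaf R M).
Variables (U0 : opens M) (ch : chart A U0).
Implicit Types (V W : opens M).

Local Notation phi := (chart_map ch).
Local Notation psi := (@chart_inv _ _ _ _ ch).
Local Notation model W d := (model_sections (@chart_deg _ _ _ _ ch) (phi @` W) d).

Lemma chart_image_open W : W `<=` U0 -> open (phi @` W).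
Proof.
move=> WU.
have -> : phi @` W = @chart_cod _ _ _ _ ch `&` psi @^-1` (oset W).
  apply/seteqP; split=> [z [y Wy <-]|z [cz Wz]].
    split; first exact: chart_map_cod (WU _ Wy).
    by rewrite /= chart_mapK //; exact: WU.
  by exists (psi z) => //; exact: chart_invK.
rewrite openE => z [cz Wz]; apply: filterI.
  exact: (open_nbhs_nbhs (conj (@chart_cod_open _ _ _ _ ch) cz)).
apply: (@chart_inv_cont _ _ _ _ ch _ cz).
exact: (open_nbhs_nbhs (conj (@oset_open _ W) Wz)).
Qed.

Lemma chart_preimage_open W (O : set 'rV[R]_(chart_dim ch)) : W `<=` U0 ->
  open O -> open (W `&` phi @^-1` O).
Proof.
move=> WU oO; rewrite openE => y [Wy Oy]; apply: filterI.
  exact: (open_nbhs_nbhs (conj (@oset_open _ W) Wy)).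
apply: (@chart_map_cont _ _ _ _ ch _ (WU _ Wy)); exact: (open_nbhs_nbhs (conj oO Oy)).
Qed.

Lemma chart_fun_mem W d (a : A W d) : W `<=` U0 -> model W d (@chart_fun _ _ _ _ ch _ _ a).
Proof. by move=> WU; have [f _ _] := @chart_fun_bij _ _ _ _ ch W d WU; exact: f. Qed.

Lemma chart_fun_surj W d f : W `<=` U0 -> model W d f ->
  exists a : A W d, @chart_fun _ _ _ _ ch _ _ a = f.
Proof.
move=> WU fW; have [_ _ s] := @chart_fun_bij _ _ _ _ ch W d WU.
by have [a _ <-] := s _ fW; exists a.
Qed.

Lemma chart_fun_inj W d (a b : A W d) : W `<=` U0 ->
  (forall p z, (phi @` W) z -> @chart_fun _ _ _ _ ch _ _ a p z = @chart_fun _ _ _ _ ch _ _ b p z) ->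
  a = b.
Proof.
move=> WU ab; have [_ i _] := @chart_fun_bij _ _ _ _ ch W d WU.
apply: i; rewrite ?inE //; rewrite funeqE => p; rewrite funeqE => z.
have [Wz|Wz] := pselect ((phi @` W) z); first exact: ab.
have [_ a0 _] := chart_fun_mem a WU p; have [_ b0 _] := chart_fun_mem b WU p.
by rewrite a0 // b0.
Qed.

Lemma chart_fun0 W d p z : W `<=` U0 -> @chart_fun _ _ _ _ ch _ _ (0 : A W d) p z = 0.
Proof.
move=> WU; have := @chart_fun_linear _ _ _ _ ch W d WU 1 (0 : A W d) 0 p z.
by rewrite scaler0 addr0 mul1r => /esym/eqP; rewrite -subr_eq0 addrK => /eqP.
Qed.

Lemma chart_fun_one1 W z : W `<=` U0 -> (phi @` W) z ->
  @chart_fun _ _ _ _ ch _ _ (gone A W) (@no_mono _) z = 1.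
Proof.
move=> WU Wz; rewrite chart_fun_one // /model_one.
by case: asboolP => // _ /=; case: forallP => // -[].
Qed.

End Charts.

Section Bumps.
Variables (R : realType) (M : gmanifold R) (x : M).
Local Notation A := (gm_fun M).

(** A bump function of the chart, glued with 0. Instead of a support, the statement has an open set
    [K'] that covers the space together with [U] and on which [chi] is 0, the form in which gluing
    uses it. *)
Lemma bump_function (U : opens M) : oset U x ->
  exists (V K' : opens M) (chi : A (whole M) 0),
    [/\ oset V x, V `<=` U & setT `<=` U `|` K'] /\
    (gres A (@sub_whole M V) chi = gone A V /\
     gres A (@sub_whole M K') chi = 0).
Proof.
move=> Ux; have [U0 [U0x [ch]]] := gm_chart x.
pose U1 := capO U U0; have U1U0 : U1 `<=` U0 := @capOr _ U U0.
have U1x : oset U1 x by split.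
pose phi := chart_map ch; pose psi := @chart_inv _ _ _ _ ch.
pose O := phi @` U1; have oO : open O by exact: chart_image_open.
have [|chi0 [W [K [[Schi oW Wx cK] [WK KO chi1 chi0K]]]]] := @bump_rV _ _ O (phi x) oO.
  by exists x.
(* The bump function as a power series: it is the coefficient of the monomial 1, and all other
   coefficients are 0. *)
pose c : gseries R (chart_dim ch) (chart_nvar ch) := fun p z =>
  if `[< p = @no_mono _ /\ O z >] then chi0 z else 0.
have cmod : model_sections (@chart_deg _ _ _ _ ch) O 0 c.
  move=> p; split.
  - have [->|p0] := pselect (p = @no_mono _).
      apply: (@smooth_on_ext _ _ _ chi0 _ oO).
        by move=> z Oz; rewrite /c; case: asboolP => // -[].
      exact: smooth_on_sub Schi.
    apply: (@smooth_on_ext _ _ _ (fun=> 0) _ oO).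
      by move=> z Oz; rewrite /c; case: asboolP => // -[].
    exact: smooth_on_cst.
  - by move=> z Oz; rewrite /c; case: asboolP => // -[].
  - move=> h z; rewrite /c; case: asboolP => // -[p0 _]; case: h.
    by rewrite p0 admissible_no_mono mono_deg_no_mono.
have [a aE] := chart_fun_surj U1U0 cmod.
(* A compact subset of a Hausdorff space is closed, so its complement can serve as [K']. *)
have psiK : closed (psi @` K).
  apply: compact_closed; first exact: gm_hausdorff.
  apply: continuous_compact cK; apply: continuous_in_subspaceT => z.
  rewrite inE => /KO [y U1y <-]; apply: (@chart_inv_cont _ _ _ _ ch).
  by apply: chart_map_cod; exact: U1U0.
pose K' : opens M := Opens (closed_openC psiK).
have KU y : (psi @` K) y -> oset U1 y.
  move=> [z /KO [t U1t <-] <-].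
  by rewrite /psi /phi chart_mapK //; exact: U1U0.
have [||r [rU rK]] := @glue2 _ _ A U1 K' (whole M) (@sub_whole _ _) (@sub_whole _ _) 0 a 0.
- move=> y _; have [Ky|Ky] := pselect ((psi @` K) y); last by right.
  by left; exact: KU.
- rewrite raddf0; apply: (chart_fun_inj (ch := ch)).
    by move=> y [/U1U0].
  move=> p z Wz; have [y [U1y K'y] yz] := Wz.
  rewrite chart_fun_res // aE chart_fun0; last by move=> t [/U1U0].
  rewrite /c; case: asboolP => // _; apply: chi0K => Kz; apply: K'y.
  by exists z => //; rewrite -yz /psi chart_mapK //; exact: U1U0.
pose V : opens M := Opens (chart_preimage_open (ch := ch) U1U0 oW).
have VU1 : V `<=` U1 by move=> y [].
exists V, K', r; split; split.
- by split.
- by move=> y /VU1[].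
- move=> y _; have [Uy|Uy] := pselect (oset U y); first by left.
  by right=> /KU[].
- rewrite -(gresE (@sub_whole _ U1) VU1) rU.
  apply: (chart_fun_inj (ch := ch)); first by move=> y /VU1/U1U0.
  move=> p z Vz; rewrite chart_fun_res // aE chart_fun_one; last by move=> y /VU1/U1U0.
  rewrite /model_one; case: asboolP => // _ /=.
  have [y [U1y Wy] yz] := Vz; have Oz : O z by exists y.
  rewrite /c; case: no_monoP => p0; case: asboolP => //; last by case.
    by move=> _; apply: chi1; rewrite -yz.
  by move=> h; case: h.
- exact: rK.
Qed.

(** The product of [s] with a bump function, glued with 0, agrees with [s] where the bump function
    is 1. *)
Lemma extend_section (E : gmod_sheaf A) (U : opens M) d (s : E U d) :
  oset U x -> exists (S : E (whole M) d) (V : opens M) (hV : V `<=` U),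
    oset V x /\ gres E (@sub_whole M V) S = gres E hV s.
Proof.
move=> Ux; have [V [K' [chi [[Vx VU cov] [chiV chiK]]]]] := bump_function Ux.
have [||S [SU _]] := @glue2 _ _ E U K' (whole M) (@sub_whole _ _) (@sub_whole _ _) d
  (gact E (add0r d) (gres A (@sub_whole _ U) chi) s) 0.
- exact: cov.
- rewrite gres_act raddf0 (gresE _ _ (@sub_whole _ _)).
  rewrite -(gresE (@sub_whole _ K') (@capOr _ U K')) chiK raddf0.
  exact: (gmA0l (E := sec_mod E (capO U K'))).
exists S, V, VU; split=> //.
rewrite -(gresE (@sub_whole _ U) VU) SU gres_act (gresE _ _ (@sub_whole _ V)).
by rewrite chiV gact1.
Qed.

End Bumps.

(** * Stalks *)

Section LmodQuotient.
Variables (R : nzRingType) (V : lmodType R).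

Record subm := Subm {
  subm_set :> V -> Prop;
  subm_closed : forall c a b, subm_set a -> subm_set b -> subm_set (c *: a + b);
  subm0 : subm_set 0 }.

Variable N : subm.

Lemma submZ c a : N a -> N (c *: a).
Proof. by move=> Na; rewrite -[_ *: _]addr0; apply: subm_closed => //; exact: subm0. Qed.

Lemma submD a b : N a -> N b -> N (a + b).
Proof. by move=> Na Nb; rewrite -[a]scale1r; exact: subm_closed. Qed.

(** Choosing one representative for each class realizes the quotient as the subtype of chosen
    vectors. *)
Definition lq_canon (v : V) : V := choose (fun u => `[< N (u - v) >]) v.

Lemma lq_canonP v : N (lq_canon v - v).
Proof.
apply/asboolP; rewrite /lq_canon.
apply: (@chooseP _ (fun u => `[< N (u - v) >]) v).
by apply/asboolP; rewrite subrr; exact: subm0.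
Qed.

Lemma lq_canon_eq a b : N (a - b) -> lq_canon a = lq_canon b.
Proof.
move=> ab; have h c d (cd : N (c - d)) u : N (u - c) -> N (u - d).
  by move=> uc; rewrite -[u](subrK c) -addrA; exact: submD.
have ba : N (b - a) by rewrite -opprB -scaleN1r; exact: submZ.
rewrite /lq_canon; have -> : (fun u => `[< N (u - a) >]) = (fun u => `[< N (u - b) >]).
  by rewrite funeqE => u; apply: asbool_equiv_eq; split; exact: h.
by apply: choose_id; apply/asboolP; rewrite ?subrr //; exact: subm0.
Qed.

Definition lquot : Type := {v : V | lq_canon v == v}.
HB.instance Definition _ := Choice.copy lquot {v : V | lq_canon v == v}.

Lemma lq_canonK v : lq_canon (lq_canon v) == lq_canon v.
Proof. by apply/eqP/lq_canon_eq; exact: lq_canonP. Qed.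

Definition lpi (v : V) : lquot := exist _ (lq_canon v) (lq_canonK v).
Definition lrepr (q : lquot) : V := sval q.

Lemma lreprK q : lpi (lrepr q) = q.
Proof. by apply: val_inj => /=; apply/eqP; case: q. Qed.

Lemma lpi_eq a b : lpi a = lpi b <-> N (a - b).
Proof.
split=> [/(congr1 lrepr) /= e|ab]; last first.
  by apply: val_inj => /=; exact: lq_canon_eq.
have := submD (submZ (-1) (lq_canonP a)) (lq_canonP b).
by rewrite e scaleN1r opprB addrA subrK.
Qed.

Lemma lreprP a : N (lrepr (lpi a) - a).
Proof. exact: lq_canonP. Qed.

Let add p q := lpi (lrepr p + lrepr q).
Let opp p := lpi (- lrepr p).
Let scale c p := lpi (c *: lrepr p).

Let lpi_add a b : add (lpi a) (lpi b) = lpi (a + b).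
Proof. by apply/lpi_eq; rewrite opprD addrACA; apply: submD; exact: lreprP. Qed.

Let lpi_opp a : opp (lpi a) = lpi (- a).
Proof.
apply/lpi_eq; have := submZ (-1) (lreprP a).
by rewrite scaleN1r opprB opprK addrC.
Qed.

Let lpi_scale c a : scale c (lpi a) = lpi (c *: a).
Proof. by apply/lpi_eq; rewrite -scalerBr; apply: submZ; exact: lreprP. Qed.

Fact lquot_addA : associative add.
Proof.
by move=> p q r; rewrite -[p]lreprK -[q]lreprK -[r]lreprK !lpi_add addrA.
Qed.

Fact lquot_addC : commutative add.
Proof. by move=> p q; rewrite -[p]lreprK -[q]lreprK !lpi_add addrC. Qed.

Fact lquot_add0 : left_id (lpi 0) add.
Proof. by move=> p; rewrite -[p]lreprK lpi_add add0r. Qed.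

Fact lquot_addN : left_inverse (lpi 0) opp add.
Proof. by move=> p; rewrite -[p]lreprK lpi_opp lpi_add addNr. Qed.

HB.instance Definition _ := GRing.isZmodule.Build lquot
  lquot_addA lquot_addC lquot_add0 lquot_addN.

Lemma lpiD a b : lpi (a + b) = lpi a + lpi b.
Proof. by rewrite -lpi_add. Qed.

Fact lquot_scaleA c d p : scale c (scale d p) = scale (c * d) p.
Proof. by rewrite -[p]lreprK !lpi_scale scalerA. Qed.

Fact lquot_scale1 : left_id 1 scale.
Proof. by move=> p; rewrite -[p]lreprK lpi_scale scale1r. Qed.

Fact lquot_scaleDr : right_distributive scale +%R.
Proof.
by move=> c p q; rewrite -[p]lreprK -[q]lreprK -lpiD !lpi_scale -lpiD scalerDr.
Qed.

Fact lquot_scaleDl p : {morph scale^~ p : a b / a + b}.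
Proof. by move=> c d; rewrite -[p]lreprK !lpi_scale -lpiD scalerDl. Qed.

HB.instance Definition _ := GRing.Zmodule_isLmodule.Build R lquot
  lquot_scaleA lquot_scale1 lquot_scaleDr lquot_scaleDl.

Lemma lpiZ c a : lpi (c *: a) = c *: lpi a.
Proof. by rewrite -lpi_scale. Qed.

End LmodQuotient.

Section Germs.
Variables (R : realType) (M : topologicalType) (x : M) (G : gsheaf R M).

(* Germs of global sections are all germs, thanks to [extend_section]. *)
Definition same_germ d (s t : G (whole M) d) : Prop :=
  exists V : opens M,
    oset V x /\ gres G (@sub_whole M V) s = gres G (@sub_whole M V) t.

Fact null_germ_closed d c (a b : G (whole M) d) :
  same_germ a 0 -> same_germ b 0 -> same_germ (c *: a + b) 0.
Proof.
move=> [V [Vx a0]] [W [Wx b0]]; exists (capO V W); split=> //.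
have ha := gres_eq_sub (@capOl _ V W) (@sub_whole _ _) (@sub_whole _ _) a0.
have hb := gres_eq_sub (@capOr _ V W) (@sub_whole _ _) (@sub_whole _ _) b0.
by rewrite linearP ha hb !raddf0 ?scaler0 addr0.
Qed.

Fact null_germ0 d : same_germ (0 : G (whole M) d) 0.
Proof. by exists (whole M). Qed.

Definition null_germ d : subm (G (whole M) d) :=
  Subm (@null_germ_closed d) (null_germ0 d).

Definition stalk (d : int) : lmodType R := lquot (null_germ d).

Definition germ d (s : G (whole M) d) : stalk d := lpi (null_germ d) s.

Lemma germ_eq d (s t : G (whole M) d) : germ s = germ t <-> same_germ s t.
Proof.
split=> [/lpi_eq[V [Vx]]|[V [Vx e]]].
  rewrite raddf0 linearB => /eqP; rewrite subr_eq0 => /eqP e.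
  by exists V.
by apply/lpi_eq; exists V; split=> //; rewrite linearB e subrr raddf0.
Qed.

Lemma germ_repr d (a : stalk d) : germ (lrepr a) = a.
Proof. exact: lreprK. Qed.

Lemma same_germ_repr d (s : G (whole M) d) : same_germ (lrepr (germ s)) s.
Proof. by apply/germ_eq; exact: germ_repr. Qed.

Lemma germD d (s t : G (whole M) d) : germ (s + t) = germ s + germ t.
Proof. exact: lpiD. Qed.

Lemma germZ d c (s : G (whole M) d) : germ (c *: s) = c *: germ s.
Proof. exact: lpiZ. Qed.

Lemma germ_linear d c (s t : G (whole M) d) :
  germ (c *: s + t) = c *: germ s + germ t.
Proof. by rewrite germD germZ. Qed.

Lemma germ_sum d (I : Type) (r : seq I) (P : pred I) (F : I -> G (whole M) d) :
  germ (\sum_(i <- r | P i) F i) = \sum_(i <- r | P i) germ (F i).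
Proof.
apply: (big_morph (@germ d)) => [s t|]; first exact: germD.
by [].
Qed.

Lemma finite_nbhd (I : finType) (P : I -> opens M -> Prop) :
  (forall i (V W : opens M), W `<=` V -> P i V -> P i W) ->
  (forall i, exists V : opens M, oset V x /\ P i V) ->
  exists V : opens M, oset V x /\ forall i, P i V.
Proof.
move=> mono H.
suff [V [Vx HV]] : exists V : opens M, oset V x /\ forall i, i \in enum I -> P i V.
  by exists V; split=> // i; apply: HV; rewrite mem_enum.
elim: (enum I) => [|i s [V [Vx HV]]]; first by exists (whole M).
have [W [Wx PW]] := H i; exists (capO V W); split=> // j.
rewrite inE => /predU1P[->|js]; first exact: mono (@capOr _ V W) PW.
exact: mono (@capOl _ V W) (HV _ js).
Qed.

End Germs.

Section StalkAlgebra.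
Variables (R : realType) (M : topologicalType) (x : M) (A : galg_sheaf R M).

Lemma same_germ_mul d e f (h : d + e = f) (a a' : A (whole M) d)
    (b b' : A (whole M) e) : same_germ x a a' -> same_germ x b b' ->
  same_germ x (gmul A h a b) (gmul A h a' b').
Proof.
move=> [V [Vx ea]] [W [Wx eb]]; exists (capO V W); split=> //.
have ha := gres_eq_sub (@capOl _ V W) (@sub_whole _ _) (@sub_whole _ _) ea.
have hb := gres_eq_sub (@capOr _ V W) (@sub_whole _ _) (@sub_whole _ _) eb.
by rewrite !gres_mul ha hb.
Qed.

Definition stalk_mul d e f (h : d + e = f) (a : stalk x A d) (b : stalk x A e) :
  stalk x A f := germ x (gmul A h (lrepr a) (lrepr b)).

Lemma stalk_mulE d e f (h : d + e = f) a b :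
  stalk_mul h (germ x a) (germ x b) = germ x (gmul A h a b).
Proof. by apply/germ_eq/same_germ_mul; exact: same_germ_repr. Qed.

Fact stalk_mul_linearl d e f (h : d + e = f) (c : R) (a a' : stalk x A d)
    (b : stalk x A e) :
  stalk_mul h (c *: a + a') b = c *: stalk_mul h a b + stalk_mul h a' b.
Proof.
rewrite -[a]germ_repr -[a']germ_repr -[b]germ_repr -germ_linear !stalk_mulE.
by rewrite gmul_linearl germ_linear.
Qed.

Fact stalk_mul_linearr d e f (h : d + e = f) (c : R) (a : stalk x A d)
    (b b' : stalk x A e) :
  stalk_mul h a (c *: b + b') = c *: stalk_mul h a b + stalk_mul h a b'.
Proof.
rewrite -[a]germ_repr -[b]germ_repr -[b']germ_repr -germ_linear !stalk_mulE.
by rewrite gmul_linearr germ_linear.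
Qed.

Fact stalk_mulA (d1 d2 d3 d12 d23 d : int) (h12 : d1 + d2 = d12)
    (h23 : d2 + d3 = d23) (hl : d12 + d3 = d) (hr : d1 + d23 = d)
    (a : stalk x A d1) (b : stalk x A d2) (c : stalk x A d3) :
  stalk_mul hl (stalk_mul h12 a b) c = stalk_mul hr a (stalk_mul h23 b c).
Proof.
rewrite -[a]germ_repr -[b]germ_repr -[c]germ_repr !stalk_mulE.
by rewrite (gmulA h12 h23 hl hr).
Qed.

Fact stalk_mul1 d (h : 0 + d = d) (a : stalk x A d) :
  stalk_mul h (germ x (gone A (whole M))) a = a.
Proof. by rewrite -[a in LHS]germ_repr stalk_mulE gmul1 germ_repr. Qed.

Fact stalk_mulC d e f (h : d + e = f) (h' : e + d = f) (a : stalk x A d)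
    (b : stalk x A e) :
  stalk_mul h a b = (-1) ^ (d * e) *: stalk_mul h' b a.
Proof.
rewrite -[a]germ_repr -[b]germ_repr !stalk_mulE -germZ; congr germ.
exact: gmulC.
Qed.

Definition stalk_alg : gralg R :=
  GrAlg stalk_mul_linearl stalk_mul_linearr stalk_mulA stalk_mul1 stalk_mulC.

Variable E : gmod_sheaf A.

Lemma same_germ_act d e f (h : d + e = f) (a a' : A (whole M) d)
    (s s' : E (whole M) e) : same_germ x a a' -> same_germ x s s' ->
  same_germ x (gact E h a s) (gact E h a' s').
Proof.
move=> [V [Vx ea]] [W [Wx eb]]; exists (capO V W); split=> //.
have ha := gres_eq_sub (@capOl _ V W) (@sub_whole _ _) (@sub_whole _ _) ea.
have hb := gres_eq_sub (@capOr _ V W) (@sub_whole _ _) (@sub_whole _ _) eb.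
by rewrite !gres_act ha hb.
Qed.

Definition stalk_act d e f (h : d + e = f) (a : stalk x A d) (s : stalk x E e) :
  stalk x E f := germ x (gact E h (lrepr a) (lrepr s)).

Lemma stalk_actE d e f (h : d + e = f) a s :
  stalk_act h (germ x a) (germ x s) = germ x (gact E h a s).
Proof. by apply/germ_eq/same_germ_act; exact: same_germ_repr. Qed.

Fact stalk_act_linearl d e f (h : d + e = f) (c : R) (a a' : stalk x A d)
    (b : stalk x E e) :
  stalk_act h (c *: a + a') b = c *: stalk_act h a b + stalk_act h a' b.
Proof.
rewrite -[a]germ_repr -[a']germ_repr -[b]germ_repr -germ_linear !stalk_actE.
by rewrite gact_linearl germ_linear.
Qed.

Fact stalk_act_linearr d e f (h : d + e = f) (c : R) (a : stalk x A d)
    (b b' : stalk x E e) :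
  stalk_act h a (c *: b + b') = c *: stalk_act h a b + stalk_act h a b'.
Proof.
rewrite -[a]germ_repr -[b]germ_repr -[b']germ_repr -germ_linear !stalk_actE.
by rewrite gact_linearr germ_linear.
Qed.

Fact stalk_actA (d1 d2 d3 d12 d23 d : int) (h12 : d1 + d2 = d12)
    (h23 : d2 + d3 = d23) (hl : d12 + d3 = d) (hr : d1 + d23 = d)
    (a : stalk x A d1) (b : stalk x A d2) (c : stalk x E d3) :
  stalk_act hl (stalk_mul h12 a b) c = stalk_act hr a (stalk_act h23 b c).
Proof.
rewrite -[a]germ_repr -[b]germ_repr -[c]germ_repr !(stalk_mulE, stalk_actE).
by rewrite (gactA h12 h23 hl hr).
Qed.

Fact stalk_act1 d (h : 0 + d = d) (a : stalk x E d) :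
  stalk_act h (germ x (gone A (whole M))) a = a.
Proof. by rewrite -[a in LHS]germ_repr stalk_actE gact1 germ_repr. Qed.

Definition stalk_mod : grmod stalk_alg :=
  @GrMod R stalk_alg (stalk x E) stalk_act stalk_act_linearl stalk_act_linearr
    stalk_actA stalk_act1.

End StalkAlgebra.

(** * Values at the point and the quadratic module of germs *)

Section StalkValues.
Variables (R : realType) (M : gmanifold R) (x : M) (U0 : opens M).
Local Notation A := (gm_fun M).
Variables (ch : chart A U0) (U0x : oset U0 x).
Implicit Types (V W : opens M).

Local Notation phi := (chart_map ch).
Local Notation cfun := (@chart_fun _ _ _ _ ch _ _).
Local Notation body a z := (cfun a (@no_mono _) z).

Definition value d (a : A (whole M) d) : R :=
  body (gres A (@sub_whole M U0) a) (phi x).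

Lemma value_local V d (a : A (whole M) d) : V `<=` U0 -> oset V x ->
  value a = body (gres A (@sub_whole M V) a) (phi x).
Proof.
move=> VU Vx; rewrite /value -(gresE (@sub_whole _ U0) VU).
by rewrite (chart_fun_res VU (@subset_refl _ U0)) //; exact: imageP.
Qed.

Lemma value_germ d (a b : A (whole M) d) : same_germ x a b -> value a = value b.
Proof.
move=> [V [Vx ab]].
have VU : oset (capO V U0) x by split.
rewrite !(value_local _ (@capOr _ V U0) VU).
congr (body _ _); exact: (gres_eq_sub (@capOl _ V U0) _ _ ab).
Qed.

Lemma value_linear d c (a b : A (whole M) d) :
  value (c *: a + b) = c * value a + value b.
Proof. by rewrite /value linearP (chart_fun_linear (@subset_refl _ U0)). Qed.

Lemma value_one : value (gone A (whole M)) = 1.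
Proof.
by rewrite /value gres_one chart_fun_one1 //; exact: imageP.
Qed.

Lemma value_mul d e f (h : d + e = f) (a : A (whole M) d) (b : A (whole M) e) :
  value (gmul A h a b) = value a * value b.
Proof. by rewrite /value gres_mul (chart_fun_mul _ _ (@subset_refl _ U0)) model_mul0. Qed.

Lemma value_deg d (a : A (whole M) d) : d != 0 -> value a = 0.
Proof.
move=> d0; have UU : U0 `<=` U0 by [].
have [_ _ h] := chart_fun_mem (ch := ch) (gres A (@sub_whole M U0) a) UU (@no_mono _).
apply: h; rewrite mono_deg_no_mono => -[_ h]; by rewrite -h eqxx in d0.
Qed.

Lemma chart_body_smooth W d (a : A W d) : W `<=` U0 ->
  smooth_on (phi @` W) (cfun a (@no_mono _)).
Proof. by move=> WU; have [] := chart_fun_mem (ch := ch) a WU (@no_mono _). Qed.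

(** One equation serves two purposes: [e = 0] and [c = 1] give an inverse of [b], while [e = 1] and
    [b = 0] give a square root of [c]. In both cases [s0] is the solution on bodies. *)
Lemma section_hensel V (e : R) (b c : A V 0) (h : 0 + 0 = 0) (s0 : 'rV[R]_(chart_dim ch) -> R) :
  V `<=` U0 -> smooth_on (phi @` V) s0 ->
  (forall z, (phi @` V) z -> e * (s0 z * s0 z) + body b z * s0 z = body c z) ->
  (forall z, (phi @` V) z -> 2 * e * s0 z + body b z != 0) ->
  exists s : A V 0, (forall z, (phi @` V) z -> body s z = s0 z) /\
    e *: gmul A h s s + gmul A h b s = c.
Proof.
move=> VU Ss es ds; have oV := chart_image_open (ch := ch) VU.
(* Sections of the model are represented by functions that vanish off the image of [V], so [s0] is
   truncated. *)
pose s1 z := if `[< (phi @` V) z >] then s0 z else 0.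
have s1E z : (phi @` V) z -> s1 z = s0 z by rewrite /s1; case: asboolP.
have s1N z : ~ (phi @` V) z -> s1 z = 0 by rewrite /s1; case: asboolP.
have out d (a : A V d) p z : ~ (phi @` V) z -> cfun a p z = 0.
  by move=> Vz; have [_ H _] := chart_fun_mem (ch := ch) a VU p; exact: H.
have [||||s [smod sE sP]] := @model_hensel _ _ _ (@chart_deg _ _ _ _ ch) _ oV
  e (cfun b) (cfun c) s1 (chart_fun_mem (ch := ch) b VU) (chart_fun_mem (ch := ch) c VU).
- by apply: smooth_on_ext Ss => // z Vz; rewrite s1E.
- exact: s1N.
- move=> z; have [Vz|Vz] := pselect ((phi @` V) z); first by rewrite s1E // es.
  by rewrite s1N // !out // !mulr0 addr0.
- by move=> z Vz; rewrite s1E // ds.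
have [a aE] := chart_fun_surj (ch := ch) VU smod.
exists a; split=> [z Vz|]; first by rewrite aE sE s1E.
apply: (chart_fun_inj (ch := ch)) => // p z _.
by rewrite chart_fun_linear // !chart_fun_mul // aE sP.
Qed.

(** Bodies are continuous, so an open condition on the value at [x] persists nearby; there the
    pointwise inverse or square root of the body is smooth. *)
Lemma body_nbhd d (a : A (whole M) d) (P : set R) : open P -> P (value a) ->
  exists V, [/\ oset V x, V `<=` U0
    & forall z, (phi @` V) z -> P (body (gres A (@sub_whole M V) a) z)].
Proof.
move=> oP Pa; have UU : U0 `<=` U0 by [].
pose f z := body (gres A (@sub_whole M U0) a) z.
pose O := (phi @` U0) `&` f @^-1` P.
have oO : open O.
  rewrite openE => z [Uz Pz]; apply: filterI.
    exact: (open_nbhs_nbhs (conj (chart_image_open (ch := ch) UU) Uz)).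
  apply: (smooth_on_continuous (chart_body_smooth _ UU) Uz).
  exact: (open_nbhs_nbhs (conj oP Pz)).
pose V : opens M := Opens (chart_preimage_open (ch := ch) UU oO).
have VU : V `<=` U0 by move=> y [].
have Ox : oset V x.
  by split.
exists V; split=> //.
move=> z Vz; rewrite -(gresE (@sub_whole _ U0) VU) chart_fun_res //.
by have [y [_ [_ Py]] <-] := Vz.
Qed.

Lemma germ_inverse (h : 0 + 0 = 0) (a : A (whole M) 0) : value a != 0 ->
  exists b : A (whole M) 0, same_germ x (gmul A h b a) (gone A (whole M)).
Proof.
move=> a0; have [V [Vx VU aV]] := body_nbhd (@open_neq _ 0) a0.
pose aV' := gres A (@sub_whole M V) a.
have oV := chart_image_open (ch := ch) VU.
have [|||s [_ sP]] := @section_hensel V 0 aV' (gone A V) h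
   (fun z => (body aV' z)^-1) VU.
- by apply: smooth_onV oV aV _; exact: chart_body_smooth.
- by move=> z Vz; rewrite mul0r add0r divff ?aV // chart_fun_one1.
- by move=> z Vz; rewrite mulr0 mul0r add0r; exact: aV.
have [b [W [WV [Wx bW]]]] := @extend_section _ _ x (self_mod A) _ _ s Vx.
exists b, W; split=> //; rewrite gres_mul gres_one [gres _ _ b]bW.
rewrite scale0r add0r in sP.
rewrite -(gresE (@sub_whole _ V) WV (@sub_whole _ W) a) -(gres_mul WV) gmulC mulr0 expr0z scale1r.
by rewrite -/aV' sP gres_one.
Qed.

Lemma germ_sqrt (h : 0 + 0 = 0) (a : A (whole M) 0) : 0 < value a ->
  exists b : A (whole M) 0, same_germ x (gmul A h b b) a /\ 0 < value b.
Proof.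
move=> a0; have [V [Vx VU aV]] := body_nbhd (@open_gt _ 0) a0.
pose aV' := gres A (@sub_whole M V) a.
have oV := chart_image_open (ch := ch) VU.
have [|||s [sE sP]] := @section_hensel V 1 0 aV' h
   (fun z => Num.sqrt (body aV' z)) VU.
- by apply: smooth_on_sqrt oV aV _; exact: chart_body_smooth.
- move=> z Vz; rewrite chart_fun0 // mul0r addr0 mul1r -expr2 sqr_sqrtr //.
  by apply: ltW; exact: aV.
- move=> z Vz; rewrite chart_fun0 // addr0 mulr1 mulf_neq0 //.
  by rewrite gt_eqF // sqrtr_gt0; exact: aV.
have [b [W [WV [Wx bW]]]] := @extend_section _ _ x (self_mod A) _ _ s Vx.
exists b; split.
  exists W; split=> //; rewrite gres_mul [gres _ _ b]bW.
  rewrite -(gres_mul WV) -(gresE (@sub_whole _ V) WV (@sub_whole _ W) a) -/aV' -sP.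
  have s0 : gmul A h (0 : A V 0) s = 0.
    exact: (gmA0l (E := sec_mod (self_mod A) V)).
  by rewrite scale1r s0 addr0.
have WU : W `<=` U0 by move=> y /WV/VU.
have Wphi : (phi @` W) (phi x) by exists x.
rewrite (value_local _ WU Wx) [gres _ _ b]bW (chart_fun_res WV VU _ _ Wphi).
by rewrite sE ?sqrtr_gt0; [apply: aV|]; exists x.
Qed.

Variables (E : gvbundle M) (l : int) (g : fiber_metric E l).

Lemma pairing_gE : exists gE : forall d : int, E (whole M) d -> dual_section E (d + l),
  (forall (d e f : int) (h : d + l + e = f) (h' : d + e + l = f)
        (s : E (whole M) d) (t : E (whole M) e),
      pairing g h' s t = (-1) ^ (l * (d + l)) *: dual_fun (gE d s) (whole M) h t)
    /\ forall d : int, bijective (gE d).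
Proof.
have [gE [gP gB]] := pairing_iso g; exists gE; split=> // d e f h h' s t.
by rewrite (gP _ _ _ h h') scalerA signzz scale1r.
Qed.

(** The metric is given on global sections, and its locality comes from [g_E]: up to a sign,
    [<s, .>] is a dual section and hence commutes with restrictions. *)
Lemma pairing_localr V d e f (h : d + e + l = f) (s : E (whole M) d)
    (t t' : E (whole M) e) :
  gres E (@sub_whole M V) t = gres E (@sub_whole M V) t' ->
  gres A (@sub_whole M V) (pairing g h s t) =
  gres A (@sub_whole M V) (pairing g h s t').
Proof.
move=> tt'; have [gE [gP _]] := pairing_gE.
have h' : d + l + e = f by rewrite -h addrAC.
by rewrite !(gP _ _ _ h') !linearZ -!dual_res tt'.
Qed.

Lemma pairing_local V d e f (h : d + e + l = f) (s s' : E (whole M) d)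
    (t t' : E (whole M) e) :
  gres E (@sub_whole M V) s = gres E (@sub_whole M V) s' ->
  gres E (@sub_whole M V) t = gres E (@sub_whole M V) t' ->
  gres A (@sub_whole M V) (pairing g h s t) =
  gres A (@sub_whole M V) (pairing g h s' t').
Proof.
move=> ss' tt'; rewrite (pairing_localr h s tt').
rewrite !(pairing_sym g h (swap_deg h)) !linearZ.
by congr (_ *: _); exact: pairing_localr.
Qed.

Lemma same_germ_pairing d e f (h : d + e + l = f) (s s' : E (whole M) d)
    (t t' : E (whole M) e) : same_germ x s s' -> same_germ x t t' ->
  same_germ x (pairing g h s t) (pairing g h s' t').
Proof.
move=> [V [Vx es]] [W [Wx et]]; exists (capO V W); split=> //.
apply: pairing_local.
  exact: (gres_eq_sub (@capOl _ V W) _ _ es).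
exact: (gres_eq_sub (@capOr _ V W) _ _ et).
Qed.

Local Notation SA := (stalk_alg x A).
Local Notation SE := (stalk_mod x E).

Definition stalk_pr d e f (h : d + e + l = f) (s : SE d) (t : SE e) : SA f :=
  germ x (pairing g h (lrepr s) (lrepr t)).

Lemma stalk_prE d e f (h : d + e + l = f) s t :
  stalk_pr h (germ x s) (germ x t) = germ x (pairing g h s t).
Proof. by apply/germ_eq/same_germ_pairing; exact: same_germ_repr. Qed.

Definition stalk_value d (a : SA d) : R := value (lrepr a).

Lemma stalk_valueE d (a : A (whole M) d) : stalk_value (germ x a) = value a.
Proof. by apply: value_germ; exact: same_germ_repr. Qed.

Fact stalk_value_linear d (c : R) (a b : SA d) :
  stalk_value (c *: a + b) = c * stalk_value a + stalk_value b.
Proof.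
rewrite -[a]germ_repr -[b]germ_repr -germ_linear !stalk_valueE.
exact: value_linear.
Qed.

Fact stalk_value1 : stalk_value (ga1 SA) = 1.
Proof. by rewrite stalk_valueE value_one. Qed.

Fact stalk_valueM d e f (h : d + e = f) (a : SA d) (b : SA e) :
  stalk_value (gaM SA h a b) = stalk_value a * stalk_value b.
Proof.
rewrite -[a]germ_repr -[b]germ_repr [gaM _ _ _ _]stalk_mulE !stalk_valueE.
exact: value_mul.
Qed.

Fact stalk_value_deg d (a : SA d) : d != 0 -> stalk_value a = 0.
Proof. exact: value_deg. Qed.

Fact stalk_inv (h : 0 + 0 = 0) (a : SA 0) : stalk_value a != 0 ->
  exists b : SA 0, gaM SA h b a = ga1 SA.
Proof.
rewrite -[a]germ_repr stalk_valueE => /(germ_inverse h)[b ba].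
by exists (germ x b); rewrite [gaM _ _ _ _]stalk_mulE; apply/germ_eq.
Qed.

Fact stalk_sqrt (h : 0 + 0 = 0) (a : SA 0) : 0 < stalk_value a ->
  exists b : SA 0, gaM SA h b b = a /\ 0 < stalk_value b.
Proof.
rewrite -[a]germ_repr stalk_valueE => /(germ_sqrt h)[b [bb b0]].
exists (germ x b); rewrite [gaM _ _ _ _]stalk_mulE stalk_valueE.
by split=> //; apply/germ_eq.
Qed.

Fact stalk_pr_linear d e f (h : d + e + l = f) (c : R) (s : SE d) (t t' : SE e) :
  stalk_pr h s (c *: t + t') = c *: stalk_pr h s t + stalk_pr h s t'.
Proof.
rewrite -[s]germ_repr -[t]germ_repr -[t']germ_repr -germ_linear !stalk_prE.
by rewrite pairing_linearr germ_linear.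
Qed.

Fact stalk_pr_sym d e f (h : d + e + l = f) (h' : e + d + l = f)
    (s : SE d) (t : SE e) :
  stalk_pr h s t = (-1) ^ ((d + l) * (e + l)) *: stalk_pr h' t s.
Proof.
rewrite -[s]germ_repr -[t]germ_repr !stalk_prE -germZ; congr germ.
exact: pairing_sym.
Qed.

Fact stalk_pr_act (d e a ae f f' : int) (hact : a + e = ae)
    (h : d + ae + l = f) (h' : d + e + l = f') (hmul : a + f' = f)
    (s : SE d) (u : SA a) (t : SE e) :
  stalk_pr h s (gmA SE hact u t) =
  (-1) ^ (a * (d + l)) *: gaM SA hmul u (stalk_pr h' s t).
Proof.
rewrite -[s]germ_repr -[t]germ_repr -[u]germ_repr.
rewrite [gmA _ _ _ _]stalk_actE !stalk_prE [gaM _ _ _ _]stalk_mulE -germZ.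
by congr germ; exact: pairing_act.
Qed.

Definition stalk_quad : quad R l :=
  @Quad R l SA SE stalk_value stalk_value_linear stalk_value1 stalk_valueM
    stalk_value_deg stalk_inv stalk_sqrt stalk_pr stalk_pr_linear stalk_pr_sym
    stalk_pr_act.

End StalkValues.

(** * Nondegeneracy of the stalks *)

Section Coordinates.
Variables (R : realType) (M : topologicalType) (A : galg_sheaf R M).
Variables (E : gmod_sheaf A) (r : int -> nat) (U : opens M) (I : finType).
Variables (deg : I -> int) (Phi : forall i, E U (deg i)).
Hypothesis frPhi : is_frame r Phi.
Implicit Types (V W : opens M).

Definition coord V (h : V `<=` U) d (psi : E V d) (i : I) : A V (d - deg i) :=
  sval (cid (frPhi.2 V h d psi)) i.

Lemma coordP V (h : V `<=` U) d (psi : E V d) :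
  psi = \sum_i gact E (subrK (deg i) d) (coord h psi i) (gres E h (Phi i)).
Proof. by rewrite /coord; case: cid => c cP /=; exact: cP.1. Qed.

Lemma coord_uniq V (h : V `<=` U) d (psi : E V d)
    (c : forall i : I, A V (d - deg i)) :
  psi = \sum_i gact E (subrK (deg i) d) (c i) (gres E h (Phi i)) ->
  forall i, coord h psi i = c i.
Proof. by move=> e i; rewrite /coord; case: cid => c' cP /=; rewrite (cP.2 c e). Qed.

Lemma coord_linear V (h : V `<=` U) d c (s t : E V d) i :
  coord h (c *: s + t) i = c *: coord h s i + coord h t i.
Proof.
apply: (coord_uniq (c := fun i => c *: coord h s i + coord h t i)).
rewrite {1}(coordP h s) {1}(coordP h t) scaler_sumr -big_split.
by apply: eq_bigr => j _ /=; rewrite gact_linearl.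
Qed.

Lemma coord_res V W (hV : V `<=` U) (hW : W `<=` V) (hU : W `<=` U) d
    (s : E V d) i : coord hU (gres E hW s) i = gres A hW (coord hV s i).
Proof.
apply: (coord_uniq (c := fun i => gres A hW (coord hV s i))).
rewrite {1}(coordP hV s) linear_sum; apply: eq_bigr => j _ /=.
by rewrite gres_act (gresE hV hW hU).
Qed.

Lemma coord_act V (h : V `<=` U) d e f (hact : d + e = f)
    (a : A V d) (s : E V e) i (hi : d + (e - deg i) = f - deg i) :
  coord h (gact E hact a s) i = gmul A hi a (coord h s i).
Proof.
have H j : d + (e - deg j) = f - deg j by rewrite addrA hact.
rewrite (eq_irrelevance hi (H i)).
apply: (coord_uniq (c := fun j => gmul A (H j) a (coord h s j))).
rewrite {1}(coordP h s) [LHS](gmA_sumr (E := sec_mod E V)).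
apply: eq_bigr => j _ /=.
by rewrite (gactA (H j) (subrK (deg j) e) (subrK (deg j) f) hact).
Qed.

Lemma coord_frame V (h : V `<=` U) i :
  (forall j, j != i -> coord h (gres E h (Phi i)) j = 0) /\
  (forall k : 0 + (deg i - deg i) = 0,
     gmul A k (gone A V) (coord h (gres E h (Phi i)) i) = gone A V).
Proof.
have [c [ci c0 c1]] := @coordinates_gen _ _ (sec_mod E V) I deg
  (fun i => gres E h (Phi i)) i.
have cE := coord_uniq ci.
by split=> [j ji|k]; rewrite cE; [exact: c0|exact: c1].
Qed.

End Coordinates.

Section DualFrame.
Variables (R : realType) (M : gmanifold R) (E : gvbundle M).
Local Notation A := (gm_fun M).
Variables (r : int -> nat) (U : opens M) (I : finType).
Variables (deg : I -> int) (Phi : forall i, E U (deg i)).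
Hypothesis frPhi : is_frame r Phi.
Variables (K' : opens M) (chi : A (whole M) 0).
Hypothesis cov : setT `<=` U `|` K'.
Hypothesis chiK : gres A (@sub_whole M K') chi = 0.
Variables (i : I) (k : int).
Hypothesis hk : k + deg i = 0.
Implicit Types (V W : opens M).

Fact dual_deg d f : k + d = f -> 0 + (d - deg i) = f.
Proof. by move: hk => ? ?; lia. Qed.

(* The coordinate functions of a frame are dual sections over [U] only; the
   factor [chi], supported in [U], makes them global. The sign is the one
   required by [dual_act]. *)
Definition dual_local W d f (h : k + d = f) (s : E W d) : A (capO W U) f :=
  (-1) ^ (k * d) *: gmul A (dual_deg h) (gres A (@sub_whole M (capO W U)) chi)
    (coord frPhi (@capOr _ W U) (gres E (@capOl _ W U) s) i).

Lemma cap_cover W : W `<=` capO W U `|` capO W K'.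
Proof. by move=> y Wy; have [Uy|Ky] := @cov y Logic.I; [left|right]. Qed.

(** On the overlap with [K'] the factor [chi] is 0, so the local function can be glued with 0. *)
Lemma cutoff_dual_exists W d f (h : k + d = f) (s : E W d) :
  exists v : A W f, gres A (@capOl _ W U) v = dual_local h s /\
    gres A (@capOl _ W K') v = 0.
Proof.
apply: (glue2 (@capOl _ W U) (@capOl _ W K') (@cap_cover W)).
rewrite linear0 linearZ gres_mul (gresE _ _ (@sub_whole _ _)).
set C := capO (capO W U) (capO W K').
have CK : C `<=` K' by move=> y [_ []].
rewrite -(gresE (@sub_whole _ K') CK) chiK linear0.
have -> b : gmul A (dual_deg h) (0 : A C 0) b = 0.
  exact: (gaM0l (A := sec_alg A C)).
by rewrite ?linear0 ?raddf0.
Qed.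

Definition cutoff_dual_fun W d f (h : k + d = f) (s : E W d) : A W f :=
  sval (cid (cutoff_dual_exists h s)).

Lemma cutoff_dualU W d f (h : k + d = f) (s : E W d) :
  gres A (@capOl _ W U) (cutoff_dual_fun h s) = dual_local h s.
Proof. by rewrite /cutoff_dual_fun; case: cid => v []. Qed.

Lemma cutoff_dualK W d f (h : k + d = f) (s : E W d) :
  gres A (@capOl _ W K') (cutoff_dual_fun h s) = 0.
Proof. by rewrite /cutoff_dual_fun; case: cid => v []. Qed.

Lemma cutoff_dual_uniq W d f (h : k + d = f) (s : E W d) (v : A W f) :
  gres A (@capOl _ W U) v = dual_local h s -> gres A (@capOl _ W K') v = 0 ->
  cutoff_dual_fun h s = v.
Proof.
move=> vU vK; apply: (sep2 (hU := @capOl _ W U) (hV := @capOl _ W K') (@cap_cover W)).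
  by rewrite cutoff_dualU -vU.
by rewrite cutoff_dualK -vK.
Qed.

Fact cutoff_dual_linear W d f (h : k + d = f) (c : R) (s t : E W d) :
  cutoff_dual_fun h (c *: s + t) =
  c *: cutoff_dual_fun h s + cutoff_dual_fun h t.
Proof.
apply: cutoff_dual_uniq; last first.
  by rewrite linearP !cutoff_dualK scaler0 addr0.
rewrite linearP !cutoff_dualU /dual_local linearP coord_linear gmul_linearr.
by rewrite scalerDr !scalerA mulrC.
Qed.

Fact cutoff_dual_res V W (hW : W `<=` V) d f (h : k + d = f) (s : E V d) :
  cutoff_dual_fun h (gres E hW s) = gres A hW (cutoff_dual_fun h s).
Proof.
have hU : capO W U `<=` capO V U by move=> y [/hW].
have hK : capO W K' `<=` capO V K' by move=> y [/hW].
have hWU := subset_trans (@capOl _ W U) hW.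
have hWK := subset_trans (@capOl _ W K') hW.
apply: cutoff_dual_uniq.
- rewrite (gresE _ _ hWU) -(gresE (@capOl _ V U) hU) cutoff_dualU.
  rewrite linearZ; congr (_ *: _); rewrite gres_mul (gresE _ _ (@sub_whole _ _)).
  congr gmul; rewrite -(coord_res frPhi _ hU (@capOr _ W U)).
  by rewrite (gresE _ _ hWU) (gresE _ _ hWU).
- by rewrite (gresE _ _ hWK) -(gresE (@capOl _ V K') hK) cutoff_dualK linear0.
Qed.

Fact cutoff_dual_act W (d e de f f' : int) (hact : d + e = de)
    (h : k + de = f) (h' : k + e = f') (hmul : d + f' = f)
    (a : A W d) (s : E W e) :
  cutoff_dual_fun h (gact E hact a s) =
  (-1) ^ (k * d) *: gmul A hmul a (cutoff_dual_fun h' s).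
Proof.
apply: cutoff_dual_uniq; last first.
  rewrite linearZ gres_mul cutoff_dualK.
  have -> b : gmul A hmul b (0 : A (capO W K') f') = 0.
    exact: (gaM0r (A := sec_alg A _)).
  by rewrite ?scaler0 ?linear0 ?raddf0.
have hi : d + (e - deg i) = de - deg i by lia.
rewrite linearZ /= gres_mul cutoff_dualU /dual_local gres_act.
rewrite (coord_act frPhi _ hact _ _ hi).
set C := capO W U; set a' := gres _ _ a; set c := coord _ _ _ _; set z := gres A _ chi.
rewrite [gmul A hmul a' _](gaMZr (A := sec_alg A C)) scalerA.
rewrite -signzD -mulrDr hact; congr (_ *: _).
have h1 : 0 + d = d by rewrite add0r.
have h2 : d + 0 = d by rewrite addr0.
have h3 : d + (e - deg i) = f by move: hk h hact => ? ? ?; lia.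
(* [chi] has degree 0 and therefore moves past [a] without a sign. *)
rewrite -(gmulA h1 hi h3); rewrite (gmulC h1 h2) mul0r expr0z scale1r.
symmetry; exact: (gmulA h2 (dual_deg h') h3 hmul).
Qed.

Definition cutoff_dual : dual_section E k :=
  DualSection cutoff_dual_linear cutoff_dual_res cutoff_dual_act.

End DualFrame.

Section StalkFrame.
Variables (R : realType) (M : gmanifold R) (x : M).
Local Notation A := (gm_fun M).
Implicit Types (V W : opens M).

Lemma extend_family (E : gmod_sheaf A) (U : opens M) (I : finType)
    (deg : I -> int) (s : forall i, E U (deg i)) : oset U x ->
  exists (S : forall i, E (whole M) (deg i)) V (hV : V `<=` U),
    oset V x /\ forall i, gres E (@sub_whole M V) (S i) = gres E hV (s i).
Proof.
move=> Ux; have H i := extend_section (s i) Ux.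
pose S i := sval (cid (H i)).
pose P i V := exists hV : V `<=` U,
  gres E (@sub_whole M V) (S i) = gres E hV (s i).
have [i V W WV [hV e]|i|V [Vx VP]] := @finite_nbhd _ x I P.
- exists (subset_trans WV hV); exact: gres_eq_sub e.
- by rewrite /P /S; case: cid => S' /= [V [hV [Vx e]]]; exists V; split=> //; exists hV.
have [W [Wx [WV WU]]] : exists W, oset W x /\ W `<=` V /\ W `<=` U.
  by exists (capO V U); split=> //; split; [exact: capOl|exact: capOr].
exists S, W, WU; split=> // i; have [hV e] := VP i.
exact: gres_eq_sub e.
Qed.

Variables (E : gvbundle M) (r : int -> nat) (U : opens M) (I : finType).
Variables (deg : I -> int) (Phi : forall i, E U (deg i)).
Hypothesis frPhi : is_frame r Phi.
Variables (S : forall i, E (whole M) (deg i)) (V : opens M) (hV : V `<=` U).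
Hypothesis Vx : oset V x.
Hypothesis SPhi : forall i, gres E (@sub_whole M V) (S i) = gres E hV (Phi i).

(** Coordinates in the frame are functions on [V] only; global functions that extend them near [x]
    represent the same germs. *)
Lemma stalk_generated :
  @generates R (stalk_alg x A) (stalk_mod x E) I deg (fun i => germ x (S i)).
Proof.
move=> X clX XS d s; rewrite -[s]germ_repr.
set T : E (whole M) d := lrepr s.
have [c [W [hW [Wx cW]]]] := @extend_family (self_mod A) V I _
  (fun i => coord frPhi hV (gres E (@sub_whole M V) T) i) Vx.
have -> : germ x T = \sum_i gmA (stalk_mod x E) (subrK (deg i) d)
    (germ x (c i) : stalk_alg x A _) (germ x (S i)).
  transitivity (germ x (\sum_i gact E (subrK (deg i) d) (c i : A (whole M) _) (S i))).
    apply/germ_eq; exists W; split=> //.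
    rewrite -(gresE (@sub_whole _ V) hW) (coordP frPhi hV (gres E _ T)).
    rewrite !linear_sum; apply: eq_bigr => i _ /=; rewrite !gres_act.
    rewrite -[gres A _ (c i)]/(gres (self_mod A) _ (c i)) cW -SPhi.
    by rewrite (gresE _ _ (@sub_whole _ W)).
  rewrite germ_sum; apply: eq_bigr => i _.
  by rewrite [RHS]stalk_actE.
by apply: (submod_sum clX) => i _; exact: (submodA clX).
Qed.

Variables (U0 : opens M) (ch : chart A U0) (U0x : oset U0 x).
Variables (l : int) (g : fiber_metric E l).

(** Surjectivity of [g_E] onto global dual sections yields a global section whose pairing near [x]
    is, up to sign, the coordinate function of index [i]. *)
Lemma frame_nondegenerate i :
  exists (d : int) (T : q_mod (stalk_quad ch U0x g) d),
    forall j, evp T (germ x (S j)) = (i == j)%:R.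
Proof.
have Ux : oset U x by exact: hV.
have [B [K' [chi [[Bx BU cov] [chiB chiK]]]]] := bump_function Ux.
(* Then [g_E] sends degree [d] to [d + l = - deg i], the degree of the coordinate function dual to
   [Phi i]. *)
pose d := - deg i - l; have hk : d + l + deg i = 0 by rewrite /d; ring.
pose D := cutoff_dual frPhi cov chiK hk.
have [gE [gP /(_ d)[gi gK Kg]]] := pairing_gE g.
pose T0 : E (whole M) d := gi D.
have gET : gE d T0 = D by exact: Kg.
pose W := capO V B.
have WU : W `<=` U by move=> y [/hV].
have WB : W `<=` B by exact: capOr.
have WwU : W `<=` capO (whole M) U by move=> y /WU.
have Wx : oset W x by split.
have DW j f (h : d + l + deg j = f) :
    gres A (@sub_whole M W) (dual_fun D (whole M) h (S j)) =
    (-1) ^ ((d + l) * deg j) *: gmul A (dual_deg hk h) (gone A W)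
      (coord frPhi WU (gres E WU (Phi j)) i).
  rewrite -(gresE (@capOl _ (whole M) U) WwU) [dual_fun _ _ _ _]/(cutoff_dual_fun frPhi cov chiK hk h (S j)).
  rewrite cutoff_dualU linearZ /=; congr (_ *: _); rewrite gres_mul.
  rewrite (gresE _ _ (@sub_whole _ W)) -(gresE (@sub_whole _ B) WB) chiB gres_one.
  congr gmul; rewrite -(coord_res frPhi _ WwU WU); congr (coord frPhi WU _ i).
  rewrite (gresE _ _ (@sub_whole _ W)).
  exact: (gres_eq_sub (@capOl _ V B) _ _ (SPhi j)).
(* The product of the signs in [g_E] and in [dual_local]; scaling by it turns the value for [j = i]
   into 1. *)
pose c : R := (-1) ^ (l * (d + l)) * (-1) ^ ((d + l) * deg i).
exists d, (c *: germ x T0 : stalk_mod x E d) => j.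
have evpZ : evp (Q := stalk_quad ch U0x g) (c *: germ x T0 : stalk_mod x E d)
    (germ x (S j)) = c * evp (Q := stalk_quad ch U0x g) (germ x T0 : stalk_mod x E d) (germ x (S j)).
  by rewrite /evp q_prZl q_evZ.
rewrite evpZ; have [ij|ij] := eqVneq i j; last first.
  have h : d + l + deg j = d + deg j + l by ring.
  have e : germ x (pairing g (erefl (d + deg j + l)) T0 (S j)) = germ x 0.
    apply/germ_eq; exists W; split=> //.
    rewrite (gP _ _ _ h) gET linearZ DW.
    have [H _] := coord_frame frPhi WU j; rewrite H //=.
    have -> : gmul A (dual_deg hk h) (gone A W) 0 = 0.
      exact: (gaM0r (A := sec_alg A W)).
    by rewrite !linear0.
  have -> : evp (Q := stalk_quad ch U0x g) (germ x T0 : stalk_mod x E d)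
    (germ x (S j)) = 0.
    by rewrite /evp [q_pr _ _ _ _]stalk_prE e q_ev0.
  by rewrite mulr0.
case: j / ij evpZ => evpZ; have h : d + deg i + l = 0 by rewrite -hk; ring.
have e : germ x (pairing g h T0 (S i)) = c *: germ x (gone A (whole M)).
  rewrite -germZ; apply/germ_eq; exists W; split=> //.
  rewrite (gP _ _ _ hk) gET !linearZ /= DW gres_one scalerA; congr (_ *: _).
  have [_ H] := coord_frame frPhi WU i.
  exact: H.
rewrite (evpE h) [q_pr _ _ _ _]stalk_prE e q_evZ.
rewrite [X in c * (c * X)](q_ev1 (stalk_quad ch U0x g)) mulr1 /c.
by rewrite mulrACA !signzz mulr1.
Qed.

End StalkFrame.

(** * From stalks to frames *)

Section LocalGram.
Variables (R : realType) (M : gmanifold R) (E : gvbundle M) (l : int).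
Variables (g : fiber_metric E l).
Local Notation A := (gm_fun M).
Implicit Types (V U : opens M).

Lemma pairing_on_res U d e f (h : d + e + l = f) (s : E (whole M) d)
    (t : E (whole M) e) :
  pairing_on g h (gres E (@sub_whole M U) s) (gres E (@sub_whole M U) t)
    (gres A (@sub_whole M U) (pairing g h s t)).
Proof.
move=> y Uy; exists U, (@subset_refl _ U), s, t.
by split=> //; rewrite gres_id.
Qed.

Lemma pairingZ d e f (h : d + e + l = f) a b (s : E (whole M) d)
    (t : E (whole M) e) :
  pairing g h (a *: s) (b *: t) = (a * b) *: pairing g h s t.
Proof.
have p0l t' : pairing g h (0 : E (whole M) d) t' = 0.
  have := pairing_linearl g h 1 0 0 t'; rewrite !scale1r addr0 => /esym/eqP.
  by rewrite -subr_eq0 addrK => /eqP.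
have p0r s' : pairing g h s' (0 : E (whole M) e) = 0.
  have := pairing_linearr g h 1 s' 0 0; rewrite !scale1r addr0 => /esym/eqP.
  by rewrite -subr_eq0 addrK => /eqP.
have := pairing_linearl g h a s 0 (b *: t); rewrite p0l !addr0 => ->.
have := pairing_linearr g h b s t 0; rewrite p0r !addr0 => ->.
by rewrite scalerA.
Qed.

Lemma dual_fun_sum k (D : dual_section E k) V d f (h : k + d = f) (I : finType)
    (s : I -> E V d) :
  dual_fun D V h (\sum_i s i) = \sum_i dual_fun D V h (s i).
Proof.
have D0 : dual_fun D V h 0 = 0.
  have := dual_linear D h 1 (0 : E V d) 0; rewrite !scale1r addr0 => /esym/eqP.
  by rewrite -subr_eq0 addrK => /eqP.
apply: (big_morph (dual_fun D V h)) => // a b.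
by have := dual_linear D h 1 a b; rewrite !scale1r.
Qed.

Variables (U : opens M) (J : finType) (deg : J -> int).
Variables (Psi : forall s, E (whole M) (deg s)) (partner : J -> J).
Hypothesis Psi_orth : forall s t, t <> partner s ->
  forall f (h : deg s + deg t + l = f),
    gres A (@sub_whole M U) (pairing g h (Psi s) (Psi t)) = 0.
Hypothesis Psi_pair : forall s t, t = partner s ->
  exists c : R, c != 0 /\ exists h : deg s + deg t + l = 0,
    gres A (@sub_whole M U) (pairing g h (Psi s) (Psi t)) = c *: gone A U.
Hypothesis partnerK : involutive partner.

(* The coefficient of [Psi s] is recovered by pairing with [Psi (partner s)]. *)
Lemma gram_independent V (hV : V `<=` U) d (c : forall s, A V (d - deg s)) :
  \sum_s gact E (subrK (deg s) d) (c s) (gres E (@sub_whole M V) (Psi s)) = 0 ->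
  forall s, c s = 0.
Proof.
move=> c0 s; set t := partner s.
have [gE [gP _]] := pairing_gE g.
have [a [a0 [h ha]]] : exists a : R, a != 0 /\ exists h : deg t + deg s + l = 0,
    gres A (@sub_whole M U) (pairing g h (Psi t) (Psi s)) = a *: gone A U.
  by apply: Psi_pair; rewrite /t partnerK.
pose D := gE (deg t) (Psi t).
have DPsi s' f (h' : deg t + l + deg s' = f) (h'' : deg t + deg s' + l = f) :
    dual_fun D V h' (gres E (@sub_whole M V) (Psi s')) =
    (-1) ^ (l * (deg t + l)) *:
      gres A hV (gres A (@sub_whole M U) (pairing g h'' (Psi t) (Psi s'))).
  rewrite dual_res (gP _ _ _ h' h'') (gresE _ _ (@sub_whole _ V)) linearZ /=.
  by rewrite scalerA signzz scale1r.
have hf : deg t + l + d = d - deg s by rewrite -[RHS]addr0 -h; ring.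
have D0 : dual_fun D V hf 0 = 0.
  have := dual_linear D hf 1 (0 : E V d) 0; rewrite !scale1r addr0 => /esym/eqP.
  by rewrite -subr_eq0 addrK => /eqP.
have := congr1 (dual_fun D V hf) c0; rewrite D0 dual_fun_sum (bigD1 s) //= big1.
  rewrite addr0; have hs : deg t + l + deg s = 0 by rewrite -h; ring.
  have hm : d - deg s + 0 = d - deg s by rewrite addr0.
  rewrite (dual_act D (subrK (deg s) d) hf hs hm) (DPsi _ _ hs h) ha.
  rewrite linearZ /= gres_one scalerA.
  have mul1 z : gmul A hm (c s) (z *: gone A V) = z *: c s.
    rewrite -[X in _ = _ *: X](gaM1 (A := sec_alg A V) hm).
    exact: (gaMZr (A := sec_alg A V)).
  rewrite mul1 scalerA => /eqP.
  rewrite scaler_eq0 !mulf_eq0 (negbTE a0) orbF.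
  have sn0 m : ((-1) ^ m == 0 :> R) = false.
    by case: (signz_cases R m) => ->; rewrite ?oppr_eq0 oner_eq0.
  by rewrite !sn0 /= => /eqP.
move=> s' s's.
have hs : deg t + l + deg s' = deg t + deg s' + l by ring.
have hm : d - deg s' + (deg t + deg s' + l) = d - deg s by rewrite -hf; ring.
rewrite (dual_act D (subrK (deg s') d) hf hs hm) (DPsi _ _ hs erefl).
rewrite Psi_orth; last by rewrite /t partnerK => e; rewrite e eqxx in s's.
have mul0 : gmul A hm (c s') 0 = 0 by exact: (gaM0r (A := sec_alg A V)).
by rewrite !linear0 mul0 linear0.
Qed.

(** Existence of coordinates is generation, and uniqueness is [gram_independent] applied to a
    difference of two coordinate families. *)
Lemma frame_of_gram (r : int -> nat) (Phi : forall s, E U (deg s)) :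
  (forall s, Phi s = gres E (@sub_whole M U) (Psi s)) ->
  (forall j : int, #|[set s | deg s == j]%SET| = r j) ->
  (forall V, V `<=` U -> @generates R (sec_alg A V) (sec_mod E V) J deg
    (fun s => gres E (@sub_whole M V) (Psi s))) ->
  is_frame r Phi.
Proof.
move=> PhiE cardJ gen; split=> // V hV d psi.
have PhiV s : gres E hV (Phi s) = gres E (@sub_whole M V) (Psi s).
  by rewrite PhiE (gresE _ _ (@sub_whole _ V)).
have [c cE] := generatesP (gen V hV) psi.
exists c; split=> [|c' c'E].
  by rewrite cE; apply: eq_bigr => s _; rewrite PhiV.
apply: functional_extensionality_dep => s; apply/eqP; rewrite -subr_eq0; apply/eqP.
apply: (gram_independent hV (c := fun s => c s - c' s)).
rewrite -[RHS](subrr psi) {1}cE c'E -sumrB; apply: eq_bigr => t _.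
rewrite PhiV [X in gact _ _ X _]addrC -scaleN1r gact_linearl scaleN1r.
by rewrite addrC.
Qed.

End LocalGram.

Section NormalForm.
Variables (R : realType) (M : gmanifold R) (E : gvbundle M) (l : int).
Variables (g : fiber_metric E l).
Local Notation A := (gm_fun M).
Local Notation n := (gvb_total_rank E).
Local Notation sg m := ((-1) ^ m : R).

(* Lifts the germs provided by [normal_form] to a neighbourhood [U]. *)
Record local_gram (U : opens M) (deg : 'I_n -> int)
    (S : forall i, E (whole M) (deg i)) (sigma : 'I_n -> 'I_n) (c : 'I_n -> R) :
    Prop := LocalGram {
  lg_card : forall j : int, #|[set i | deg i == j]%SET| = gvb_rank E j;
  lg_invol : involutive sigma;
  lg_sign : forall i, c i = 1 \/ c i = -1;
  lg_orth : forall i j, j <> sigma i -> forall f (h : deg i + deg j + l = f),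
    gres A (@sub_whole M U) (pairing g h (S i) (S j)) = 0;
  lg_pair : forall i, exists h : deg i + deg (sigma i) + l = 0,
    gres A (@sub_whole M U) (pairing g h (S i) (S (sigma i))) = c i *: gone A U;
  lg_fixed : forall i, deg i = deg (sigma i) ->
    (sigma i = i <-> sg (deg i + l) = 1);
  lg_generates : forall V : opens M, V `<=` U ->
    @generates R (sec_alg A V) (sec_mod E V) 'I_n deg
      (fun i => gres E (@sub_whole M V) (S i)) }.

(** Three finite families of identities between germs are realized on one neighbourhood:
    orthogonality, products of partners, and expressions of the original frame in the new family.
    The last one turns generation of the stalk into generation over every smaller open set. *)
Lemma local_normal_form (x : M) : exists (U : opens M) (deg : 'I_n -> int)
    (S : forall i, E (whole M) (deg i)) (sigma : 'I_n -> 'I_n) (c : 'I_n -> R),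
  oset U x /\ local_gram U S sigma c.
Proof.
have [U1 [U1x [deg [Phi fr]]]] := gvb_frame E x.
have [U0 [U0x [ch]]] := gm_chart x.
have [S0 [V [hV [Vx SPhi]]]] := extend_family Phi U1x.
have nd := frame_nondegenerate fr Vx SPhi ch U0x g.
have gen0 := stalk_generated fr Vx SPhi.
have [sigma [F [gF genF]]] := normal_form (Q := stalk_quad ch U0x g) nd gen0.
pose S i : E (whole M) (deg i) := lrepr (F i).
have sigmaK : involutive sigma.
  by move=> i; have [_ ->] := gram_invol gF (finset.in_setT i).
pose P1 (ij : 'I_n * 'I_n) W := ij.2 <> sigma ij.1 ->
  forall f (h : deg ij.1 + deg ij.2 + l = f),
    gres A (@sub_whole M W) (pairing g h (S ij.1) (S ij.2)) = 0.
have [ij W W' WW' H ne f h|[i j]|V1 [V1x HV1]] := @finite_nbhd _ x _ P1.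
- by rewrite -(gresE (@sub_whole _ W) WW') H // linear0.
- have [->|/eqP ne] := eqVneq j (sigma i).
    by exists (whole M); split=> // ne; case: ne.
  have o := gram_orth gF (finset.in_setT i) (finset.in_setT j) (introN eqP ne).
  have /germ_eq[W [Wx We]] : germ x (pairing g (erefl (deg i + deg j + l)) (S i) (S j)) = germ x 0.
    exact: (o _ erefl).
  exists W; split=> // _ f h; case: f / h.
  by rewrite We linear0.
pose P2 i W := exists c : R, (c = 1 \/ c = -1) /\
  exists h : deg i + deg (sigma i) + l = 0,
    gres A (@sub_whole M W) (pairing g h (S i) (S (sigma i))) = c *: gone A W.
have [i W W' WW' [c [cc [h H]]]|i|V2 [V2x HV2]] := @finite_nbhd _ x _ P2.
- exists c; split=> //; exists h.
  by rewrite -(gresE (@sub_whole _ W) WW') H linearZ /= gres_one.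
- have [c [cc [h H]]] := gram_pairs gF (finset.in_setT i).
  have /germ_eq[W [Wx We]] : germ x (pairing g h (S i) (S (sigma i))) =
      germ x (c *: gone A (whole M)) by rewrite germZ; exact: H.
  exists W; split=> //; exists c; split=> //; exists h.
  by rewrite We linearZ /= gres_one.
(* [S0 j] restricts to the frame element [Phi j], so these expressions make the new family generate
   wherever they hold inside the domain of the frame. *)
pose P3 j W := exists c : forall i, A W (deg j - deg i),
  gres E (@sub_whole M W) (S0 j) =
  \sum_i gact E (subrK (deg i) (deg j)) (c i) (gres E (@sub_whole M W) (S i)).
have [j W W' WW' [c H]|j|V3 [V3x HV3]] := @finite_nbhd _ x _ P3.
- exists (fun i => gres A WW' (c i)).
  rewrite -(gresE (@sub_whole _ W) WW') H linear_sum; apply: eq_bigr => i _ /=.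
  by rewrite gres_act (gresE _ _ (@sub_whole _ W')).
- have [c cE] := generatesP genF (germ x (S0 j)).
  have /germ_eq[W [Wx We]] : germ x (S0 j) =
      germ x (\sum_i gact E (subrK (deg i) (deg j)) (lrepr (c i) : A (whole M) _) (S i)).
    by rewrite germ_sum.
  exists W; split=> //; exists (fun i => gres A (@sub_whole M W) (lrepr (c i) : A (whole M) _)).
  by rewrite We linear_sum; apply: eq_bigr => i _ /=; rewrite gres_act.
pose U := capO (capO V V1) (capO V2 V3).
have UV : U `<=` V by move=> y [[]].
have UV1 : U `<=` V1 by move=> y [[]].
have UV2 : U `<=` V2 by move=> y [_ []].
have UV3 : U `<=` V3 by move=> y [_ []].
have HU2 i : P2 i U.
  have [c [cc [h H]]] := HV2 i; exists c; split=> //; exists h.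
  by rewrite -(gresE (@sub_whole _ V2) UV2) H linearZ /= gres_one.
exists U, deg, S, sigma, (fun i => sval (cid (HU2 i))); split.
  by split; split.
split.
- exact: fr.1.
- exact: sigmaK.
- by move=> i; case: cid => c [].
- move=> i j ne f h; rewrite -(gresE (@sub_whole _ V1) UV1).
  by rewrite (HV1 (i, j) ne) linear0.
- by move=> i; case: cid => c [].
- by move=> i; exact: (gram_fixed gF (finset.in_setT i)).
- move=> W WU X clX XS d psi.
  have WU1 := subset_trans WU (subset_trans UV hV).
  rewrite (coordP fr WU1 psi); apply: (submod_sum clX) => j _.
  apply: (submodA clX).
  have WV := subset_trans WU UV; have WV3 := subset_trans WU UV3.
  rewrite -(gresE hV WV WU1) -SPhi (gresE _ _ (@sub_whole _ W)).
  have [c H] := HV3 j.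
  rewrite -(gresE (@sub_whole _ V3) WV3) H linear_sum.
  apply: (submod_sum clX) => i _ /=; rewrite gres_act.
  apply: (submodA clX); rewrite (gresE _ _ (@sub_whole _ W)); exact: XS.
Qed.

Section Rescaling.
Variables (U : opens M) (deg : 'I_n -> int).
Variables (S : forall i, E (whole M) (deg i)) (sigma : 'I_n -> 'I_n) (c : 'I_n -> R).
Hypothesis lg : local_gram U S sigma c.

Lemma lg_c_neq0 i : c i != 0.
Proof. by case: (lg_sign lg i) => ->; rewrite ?oppr_eq0 oner_eq0. Qed.

Lemma scaled_orth i j a b : j <> sigma i ->
  pairs_to_zero g (gres E (@sub_whole M U) (a *: S i))
    (gres E (@sub_whole M U) (b *: S j)).
Proof.
move=> ij f h; have := pairing_on_res (U := U) g h (a *: S i) (b *: S j).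
suff -> : gres A (@sub_whole M U) (pairing g h (a *: S i) (b *: S j)) = 0 by [].
by rewrite pairingZ linearZ /= (lg_orth lg ij) scaler0.
Qed.

Lemma scaled_pair i j a b : j = sigma i ->
  pairs_to_const g (gres E (@sub_whole M U) (a *: S i))
    (gres E (@sub_whole M U) (b *: S j)) (a * b * c i).
Proof.
move=> ->; have [h hE] := lg_pair lg i; exists h.
have := pairing_on_res (U := U) g h (a *: S i) (b *: S (sigma i)).
suff -> : gres A (@sub_whole M U) (pairing g h (a *: S i) (b *: S (sigma i))) =
  (a * b * c i) *: gone A U by [].
by rewrite pairingZ linearZ /= hE scalerA.
Qed.

(** The degrees of a juxtaposed family are those of [S (tau s)] only pointwise, whence the cast.
    Once extensionality makes [degJ] the composite [deg \o tau], the cast disappears and [sigma] is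
    conjugated by [tau]. *)
Lemma scaled_frame (J : finType) (degJ : J -> int)
    (Psi : forall s, E (whole M) (degJ s)) (Phi : forall s, E U (degJ s))
    (tau : J -> 'I_n) (a : J -> R) (degE : forall s, degJ s = deg (tau s)) :
  bijective tau -> (forall s, a s != 0) ->
  (forall s, ecast d (E (whole M) d) (degE s) (Psi s) = a s *: S (tau s)) ->
  (forall s, Phi s = gres E (@sub_whole M U) (Psi s)) ->
  is_frame (gvb_rank E) Phi.
Proof.
move=> bij_tau a0.
have degE' : degJ = deg \o tau by apply/funext => s; exact: degE.
subst degJ => PsiE PhiE.
have {}PsiE s : Psi s = a s *: S (tau s).
  by rewrite -PsiE (eq_irrelevance (degE s) erefl).
have [tau' tauK tau'K] := bij_tau.
pose partner s := tau' (sigma (tau s)).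
apply: (frame_of_gram (g := g) (Psi := Psi) (partner := partner)) => //.
- move=> s t ts f h; rewrite !PsiE pairingZ linearZ /= (lg_orth lg) ?scaler0 //.
  by move=> e; apply: ts; rewrite /partner -e tauK.
- move=> s t ts; have e : tau t = sigma (tau s) by rewrite ts tau'K.
  exists (a s * a t * c (tau s)); rewrite !mulf_neq0 ?lg_c_neq0 //; split=> //.
  have [h hE] := lg_pair lg (tau s); move: h hE; rewrite -e => h hE; exists h.
  by rewrite !PsiE pairingZ linearZ /= hE scalerA.
- by move=> s; rewrite /partner tau'K (lg_invol lg) tauK.
- move=> j; rewrite -(lg_card lg j).
  rewrite -[RHS](on_card_preimset (f := tau)); last exact: onW_bij.
  by apply: eq_card => s; rewrite !inE.
- move=> V VU X clX XPsi; apply: (lg_generates lg VU clX) => i.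
  have H s : X _ (gres E (@sub_whole M V) (S (tau s))).
    have := submodZ clX (a s)^-1 (XPsi s).
    by rewrite PsiE linearZ /= scalerA mulVf // scale1r.
  by have := H (tau' i); rewrite tau'K.
Qed.

End Rescaling.

End NormalForm.

(** * Orbits of the involution and enumeration of the frame *)

Section Leading.
Variables (n : nat) (deg : 'I_n -> int) (sigma : 'I_n -> 'I_n).
Hypothesis sigmaK : involutive sigma.

(* Represents the two-element orbits of [sigma]. *)
Definition leading : {set 'I_n} :=
  [set i | (deg (sigma i) < deg i)%R ||
     ((deg i == deg (sigma i)) && (i < sigma i)%N)]%SET.

(** The comparison of indices decides for two-element orbits inside one degree, which occur where
    the pairing is antisymmetric. *)
Lemma leading_trichotomy i :
  ((i \in leading) + (sigma i \in leading) + (sigma i == i) = 1)%N.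
Proof.
rewrite !inE sigmaK -val_eqE /=.
case: (ltgtP (deg i) (deg (sigma i))) => [d|d|_].
- by case: ltngtP => // /val_inj e; rewrite (congr1 deg e) ltxx in d.
- by case: ltngtP => // /val_inj e; rewrite (congr1 deg e) ltxx in d.
- by case: ltngtP.
Qed.

Lemma leading_sigma i : i \in leading -> sigma i \notin leading.
Proof. by move=> iL; have := leading_trichotomy i; rewrite iL; case: (_ \in _). Qed.

Lemma leading_not_fixed i : i \in leading -> sigma i != i.
Proof.
by move=> iL; have := leading_trichotomy i; rewrite iL; case: (_ == _); case: (_ \in _).
Qed.

(** The trichotomy summed over all indices; as [sigma] is a permutation, each of its first two terms
    contributes [#|leading|]. *)
Lemma leading_card : (n = 2 * #|leading| + #|[set i | sigma i == i]%SET|)%N.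
Proof.
have H (P : pred 'I_n) : (\sum_i P i = #|[set i | P i]%SET|)%N.
  by rewrite -[RHS]sum1_card [RHS]big_mkcond; apply: eq_bigr => i _; rewrite inE; case: (P i).
transitivity (\sum_i ((i \in leading) + (sigma i \in leading) + (sigma i == i)))%N.
  rewrite (eq_bigr (fun=> 1%N)) => [|i _]; last exact: leading_trichotomy.
  by rewrite big_const_ord iter_addn_0 mul1n.
rewrite !big_split /= !H.
have -> : (#|[set i | sigma i \in leading]%SET| = #|leading|)%N.
  rewrite -[RHS](card_preimset leading (inv_inj sigmaK)).
  by apply: eq_card => i; rewrite !inE.
have -> : #|[set i | i \in leading]%SET| = #|leading|.
  by apply: eq_card => i; rewrite !inE.
by rewrite addnn mul2n.
Qed.

Definition leading_orbits (s : 'I_#|leading| + 'I_#|leading|) : 'I_n :=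
  match s with inl a => enum_val a | inr b => sigma (enum_val b) end.

Lemma leading_orbits_inj : injective leading_orbits.
Proof.
have L (a : 'I_#|leading|) : enum_val a \in leading by exact: enum_valP.
case=> a [] b /=; first by move=> /enum_val_inj ->.
- by move=> e; have := leading_sigma (L b); rewrite -e L.
- by move=> e; have := leading_sigma (L a); rewrite e L.
- by move=> /(inv_inj sigmaK)/enum_val_inj ->.
Qed.

Lemma leading_orbits_not_fixed s : sigma (leading_orbits s) != leading_orbits s.
Proof.
have L (a : 'I_#|leading|) := leading_not_fixed (enum_valP a : _ \in leading).
by case: s => a /=; rewrite ?sigmaK // eq_sym.
Qed.

End Leading.

(** Elements satisfying [pos] are listed first, as the diagonal of [minkowski_mx] requires; [p] is
    their number. *)
Lemma signature_enum (n r : nat) (C : {set 'I_n}) (pos : pred 'I_n) : #|C| = r ->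
  exists (f : 'I_r -> 'I_n) (p q : nat), [/\ injective f, (p + q)%N = r,
    forall a, f a \in C & forall a, pos (f a) = (a < p)%N].
Proof.
move=> Cr; pose C1 := [set i in C | pos i]%SET.
pose xs := enum C1 ++ enum (C :\: C1)%SET.
have C1C : (C1 \subset C)%SET by apply/fintype.subsetP => i; rewrite inE => /andP[].
have sz : size xs == r.
  rewrite size_cat -!cardE -Cr -(cardsID C1 C).
  by rewrite (finset.setIidPr C1C).
have un : uniq xs.
  rewrite cat_uniq !enum_uniq andbT /=; apply/hasPn => i.
  by rewrite !mem_enum inE => /andP[].
exists (tnth (Tuple sz)), #|C1|, #|(C :\: C1)%SET|; split.
- exact/tuple_uniqP.
- by rewrite -Cr -(cardsID C1 C) (finset.setIidPr C1C).
- move=> a; have := mem_tnth a (Tuple sz); rewrite mem_cat !mem_enum.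
  by case/orP => [/(fintype.subsetP C1C)|]; rewrite // inE => /andP[].
- move=> a; have aC1 : (a < size (enum C1))%N = (a < #|C1|)%N by rewrite -cardE.
  rewrite (tnth_nth (tnth (Tuple sz) a)) /= nth_cat aC1.
  case: ifPn => [h|h].
    have : nth (tnth (Tuple sz) a) (enum C1) a \in enum C1 by rewrite mem_nth ?aC1.
    by rewrite mem_enum inE => /andP[].
  have : nth (tnth (Tuple sz) a) (enum (C :\: C1)%SET) (a - size (enum C1))
      \in enum (C :\: C1)%SET.
    rewrite mem_nth // ltn_subLR; last by rewrite leqNgt aC1.
    by rewrite -size_cat (eqP sz).
  by rewrite mem_enum !inE => /andP[h1 h2]; move: h1; rewrite h2 => /negbTE.
Qed.

Theorem proposition10p3 (R : realType) (M : gmanifold R) (E : gvbundle M)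
    (l : int) (g : fiber_metric E l) (k eps : int) (x : M)
    (rank_gt0 : (0 < gvb_total_rank E)%N)
    (k_def : k = - (l %/ 2)%Z) (eps_def : eps = (l %% 2)%Z) :
  (eps = 1 \/ (eps = 0 /\ odd `|k|%N) ->
   exists m : nat, gvb_total_rank E = (2 * m)%N /\
   exists (U : opens M) (deg degbar : 'I_m -> int)
          (Phi : forall a, E U (deg a)) (Phibar : forall b, E U (degbar b)),
     [/\ oset U x,
         is_frame (gvb_rank E) (cat_fam Phi Phibar),
         forall a, k <= deg a
       & forall b, degbar b = - deg b + 2 * k - eps] /\
     [/\ forall a, pairs_to_const g (Phi a) (Phibar a) 1,
         forall a b, a != b -> pairs_to_zero g (Phi a) (Phibar b),
         forall a b, pairs_to_zero g (Phi a) (Phi b)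
       & forall a b, pairs_to_zero g (Phibar a) (Phibar b)]) /\
  (eps = 0 /\ ~~ odd `|k|%N ->
   exists m : nat, (gvb_total_rank E - gvb_rank E k)%N = (2 * m)%N /\
   exists (U : opens M) (deg degbar : 'I_m -> int)
          (degXi : 'I_(gvb_rank E k) -> int)
          (Phi : forall a, E U (deg a)) (Phibar : forall b, E U (degbar b))
          (Xi : forall c, E U (degXi c)) (p q : nat),
     [/\ oset U x,
         is_frame (gvb_rank E) (cat_fam (cat_fam Phi Phibar) Xi),
         forall a, k < deg a,
         forall b, degbar b = - deg b + 2 * k
       & forall c, degXi c = k] /\
     [/\ forall a, pairs_to_const g (Phi a) (Phibar a) 1,
         forall a b, a != b -> pairs_to_zero g (Phi a) (Phibar b),
         forall a b, pairs_to_zero g (Phi a) (Phi b)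
       & forall a b, pairs_to_zero g (Phibar a) (Phibar b)] /\
     [/\ (p + q)%N = gvb_rank E k,
         forall a b, pairs_to_const g (Xi a) (Xi b)
                       (minkowski_mx R (gvb_rank E k) p a b),
         forall a c, pairs_to_zero g (Phi a) (Xi c)
       & forall b c, pairs_to_zero g (Phibar b) (Xi c)]).
Proof.
have l_def : l = - (2 * k) + eps.
  by rewrite k_def eps_def {1}(divz_eq l 2); ring.
have eps01 : eps = 0 \/ eps = 1.
  have [h0 h1] : 0 <= eps /\ eps < 2 by rewrite eps_def modz_ge0 // ltz_pmod.
  by clear k_def eps_def; lia.
clear k_def eps_def.
have [U [deg [S [sigma [c [Ux lg]]]]]] := local_normal_form g x.
have sigmaK := lg_invol lg.
have sum_deg i : deg i + deg (sigma i) = 2 * k - eps.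
  have [h _] := lg_pair lg i; rewrite -[LHS](addrK l) h l_def; ring.
have cc i : c i * c i = 1 by case: (lg_sign lg i) => ->; rewrite ?mulrNN mulr1.
pose L := leading deg sigma; pose ev (a : 'I_#|L|) : 'I_(gvb_total_rank E) := enum_val a.
have evL a : ev a \in L by exact: enum_valP.
pose T i (e : R) := gres E (@sub_whole M U) (e *: S i).
have deg_lead a : deg (sigma (ev a)) <= deg (ev a).
  by have := evL a; rewrite inE => /orP[/ltW //|/andP[/eqP -> _]].
have deg_bar b : deg (sigma (ev b)) = - deg (ev b) + 2 * k - eps.
  by have := sum_deg (ev b); lia.
(* [c (ev b)] is 1 or -1, hence its own inverse, so this scaling makes the product of partners 1. *)
pose Phi a := T (ev a) 1; pose Phibar b := T (sigma (ev b)) (c (ev b)).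
have ev_pairs :
  [/\ forall a, pairs_to_const g (Phi a) (Phibar a) 1,
      forall a b, a != b -> pairs_to_zero g (Phi a) (Phibar b),
      forall a b, pairs_to_zero g (Phi a) (Phi b)
    & forall a b, pairs_to_zero g (Phibar a) (Phibar b)].
  split=> [a|a b ab|a b|a b].
  - have := scaled_pair lg 1 (c (ev a)) (erefl (sigma (ev a))).
    by rewrite mul1r cc.
  - apply: (scaled_orth lg) => /(inv_inj sigmaK)/enum_val_inj ba.
    by rewrite ba eqxx in ab.
  - apply: (scaled_orth lg) => e.
    by have := leading_sigma sigmaK (evL a); rewrite -e evL.
  - apply: (scaled_orth lg); rewrite sigmaK => e.
    by have := leading_sigma sigmaK (evL b); rewrite e evL.
(* A fixed index satisfies [2 deg i = 2 k - eps], which parity excludes for [eps = 1]. *)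
have fixed_deg i : sigma i = i -> eps = 0 /\ deg i = k.
  move=> si; have := sum_deg i; rewrite si.
  by move: eps01 => ? ?; lia.
(* For [eps = 0] the self-paired degree is [k], and there [k + l = - k]: the parity of [k] decides
   between symmetric and antisymmetric. *)
have sgk : eps = 0 -> (-1) ^ (k + l) = (-1) ^+ odd `|k|%N :> R.
  move=> e0; have -> : k + l = - k by lia.
  by rewrite signz_odd abszN.
pose tau1 := @leading_orbits _ deg sigma.
pose e1 (s : 'I_#|L| + 'I_#|L|) : R :=
  match s with inl _ => 1 | inr b => c (ev b) end.
have e1_neq0 s : e1 s != 0.
  by case: s => a /=; [exact: oner_neq0|exact: lg_c_neq0 lg _].
(* Defined by cases so that it reduces to [erefl] on each summand, which removes the cast of
   [scaled_frame]. *)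
pose deg1E s : cat_deg (fun a => deg (ev a)) (fun b => deg (sigma (ev b))) s =
    deg (tau1 s) :=
  match s with inl a => erefl | inr b => erefl end.
pose Psi1 := @cat_fam R M E (whole M) _ _ _ _ (fun a => 1 *: S (ev a))
  (fun b => c (ev b) *: S (sigma (ev b))).
split=> [case_i|[eps0 evenk]].
(* A fixed index would have degree [k] and a symmetric pairing there, contrary to [k] odd. *)
- have no_fixed i : sigma i != i.
    apply/eqP => si; have [e0 dk] := fixed_deg i si.
    have oddk : odd `|k|%N by case: case_i => [|[]//]; rewrite e0.
    have := (lg_fixed lg (congr1 deg (esym si))).1 si.
    rewrite dk sgk // oddk expr1 => e; have := ltrN10 R.
    by rewrite e ltr10.
  have nE : gvb_total_rank E = (2 * #|L|)%N.
    rewrite {1}(leading_card deg sigmaK) -/L.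
    have -> : [set i | sigma i == i]%SET = finset.set0.
      by apply/setP => i; rewrite !inE (negbTE (no_fixed i)).
    by rewrite cards0 addn0.
  exists #|L|; split=> //.
  exists U, (fun a => deg (ev a)), (fun b => deg (sigma (ev b))), Phi, Phibar.
  split=> //; split=> //.
  + apply: (@scaled_frame R M E l g U deg S sigma c lg _ _ Psi1 _ tau1 e1 deg1E) => //.
    * apply: inj_card_bij; first exact: (leading_orbits_inj sigmaK).
      by rewrite card_ord card_sum !card_ord addnn -mul2n eq_leq.
    * by case.
    * by case.
  (* A leading degree is at least half of [2 k - eps], and [eps <= 1] rounds this up to [k]. *)
  + by move=> a; have := deg_lead a; have := deg_bar a; lia.
(* For even [k] every index of degree [k] is fixed, so that the fixed vectors are exactly the [r_k]
   ones of degree [k]. *)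
- have fixedP i : (sigma i == i) = (deg i == k).
    apply/eqP/eqP => [/fixed_deg[]//|dk].
    have e : deg i = deg (sigma i) by have := sum_deg i; lia.
    by apply/(lg_fixed lg e); rewrite dk sgk // (negbTE evenk).
  have cardC : #|[set i | deg i == k]%SET| = gvb_rank E k by exact: (lg_card lg).
  have nE : gvb_total_rank E = (2 * #|L| + gvb_rank E k)%N.
    rewrite {1}(leading_card deg sigmaK) -/L -cardC; congr (_ + _)%N.
    by apply: eq_card => i; rewrite !inE fixedP.
  have [f [p [q [f_inj pq fC fp]]]] :=
    signature_enum (fun i => c i == 1) cardC.
  have {}fC a : deg (f a) = k by have := fC a; rewrite inE => /eqP.
  have f_fixed a : sigma (f a) = f a by apply/eqP; rewrite fixedP fC.
  have tau1f s a : tau1 s <> f a.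
    move=> e; have := leading_orbits_not_fixed sigmaK s.
    by rewrite -/(tau1 s) e f_fixed eqxx.
  exists #|L|; split; first by rewrite {1}nE addnK.
  pose Xi a := T (f a) 1.
  exists U, (fun a => deg (ev a)), (fun b => deg (sigma (ev b))), (fun a => deg (f a)).
  exists Phi, Phibar, Xi, p, q.
  split; [split=> //|split=> //; split=> //].
  + pose tau s := match s with inl s' => tau1 s' | inr a => f a end.
    pose e2 (s : ('I_#|L| + 'I_#|L|) + 'I_(gvb_rank E k)) : R :=
      match s with inl s' => e1 s' | inr a => 1 end.
    pose deg2E s : cat_deg (cat_deg (fun a => deg (ev a))
        (fun b => deg (sigma (ev b)))) (fun a => deg (f a)) s = deg (tau s) :=
      match s with inl s' => deg1E s' | inr a => erefl end.
    pose Psi2 := @cat_fam R M E (whole M) _ _ _ _ Psi1 (fun a => 1 *: S (f a)).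
    apply: (@scaled_frame R M E l g U deg S sigma c lg _ _ Psi2 _ tau e2 deg2E) => //.
    * apply: inj_card_bij; last first.
        by rewrite card_ord !card_sum !card_ord addnn -mul2n eq_leq.
      case=> [s|a] [t|b] //= => [/(leading_orbits_inj sigmaK) ->|/tau1f|/esym/tau1f|/f_inj ->] //.
    * by case=> [s|a] /=; [exact: e1_neq0|exact: oner_neq0].
    * by case=> [[]|].
    * by case=> [[]|].
  (* The inequality is strict because an index of degree [k] is fixed, hence not leading. *)
  + move=> a; rewrite lt_neqAle; have ka : k <= deg (ev a).
      by have := deg_lead a; have := deg_bar a; lia.
    rewrite ka andbT eq_sym -fixedP.
    exact: (leading_not_fixed sigmaK (evL a)).
  + by move=> b; rewrite deg_bar eps0 subr0.
  + move=> a b; rewrite !mxE.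
    have [<-|ab] := eqVneq a b; last first.
      have h : deg (f a) + deg (f b) + l = 0 by rewrite !fC; lia.
      exists h; rewrite mulr0n scale0r; apply: (scaled_orth lg).
      by rewrite f_fixed => /f_inj ba; rewrite ba eqxx in ab.
    rewrite mulr1n -fp.
    have -> : (if c (f a) == 1 then 1 else -1) = 1 * 1 * c (f a).
      rewrite !mul1r; case: eqP => [-> //|c1].
      by case: (lg_sign lg (f a)).
    by apply: (scaled_pair lg); rewrite f_fixed.
  + move=> a b; apply: (scaled_orth lg) => e.
    by apply: (tau1f (inr a) b); rewrite e.
  + move=> a b; apply: (scaled_orth lg); rewrite sigmaK => e.
    by apply: (tau1f (inl a) b); rewrite e.
Qed.
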